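(* Let $f\in C^3([0,1])$ satisfy $0<m\le|f''(x)|$ for all $x\in[0,1]$, for some constant $m$. Then $Z_f(s)$ admits a meromorphic continuation to the half-plane $\Re(s)>\tfrac35$, holomorphic there except for a simple pole at $s=\tfrac23$, and $$\operatorname{Res}_{s=2/3}Z_f(s)=\frac{\sqrt3\,\Gamma(1/3)^3}{2^{2/3}\pi^3}\int_0^1|f''(v)|^{2/3}dv.$$
   Context: A Farey interval is an interval $I=[c/d,a/b]\subset[0,1]$ with $b,d\in\mathbb{N}$, $a,c\in\mathbb{Z}$, $0\le c\le d$, $0\le a\le b$, $\gcd(a,b)=\gcd(c,d)=1$ and $ad-bc=1$. For $f\in C^2([0,1])$ set $c_I(f)=f\!\left(\frac{a+c}{b+d}\right)-\frac{b}{b+d}f\!\left(\frac ab\right)-\frac{d}{b+d}f\!\left(\frac cd\right)$ and $T_I(f)=(b+d)c_I(f)$. The Farey zeta function is $Z_f(s)=\sum_I|T_I(f)|^s$, summed over all Farey intervals, defined for $\Re(s)$ large. *)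

(* Defs.v *)
From HB Require Import structures.
From mathcomp Require Import all_boot all_order all_algebra complex.
From mathcomp Require Import all_classical all_reals all_analysis.
From mathcomp Require analysis.showcase.summability.

Set Implicit Arguments.
Unset Strict Implicit.
Unset Printing Implicit Defensive.

Import Order.TTheory GRing.Theory Num.Theory.
Import numFieldNormedType.Exports.

Local Open Scope classical_set_scope.
Local Open Scope ring_scope.
Local Open Scope complex_scope.

(* Throughout, [R[i]^o] is the field [R[i]] seen as a normed space over itself,
   so that [derivable F s 1] is complex differentiability. *)

(* Difference quotients are restricted to [A], so at an end point of an interval
   these are the one-sided notions, and values outside [A] play no role. *)
Definition diff_quotient (R : realType) (f : R -> R) (x y : R) : R :=
  (f y - f x) / (y - x).

Definition derivable_in (R : realType) (A : set R) (f : R -> R) (x : R) : Prop :=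
  cvg (diff_quotient f x @ within A x^').

Definition derive_in (R : realType) (A : set R) (f : R -> R) (x : R) : R :=
  lim (diff_quotient f x @ within A x^').

Definition derive_in_n (R : realType) (A : set R) (n : nat) (f : R -> R) :
  R -> R := iter n (derive_in A) f.

Definition class_C (R : realType) (n : nat) (A : set R) (f : R -> R) : Prop :=
  (forall (k : nat) (x : R), (k < n)%N -> A x ->
     derivable_in A (derive_in_n A k f) x) /\
  {within A, continuous (derive_in_n A n f)}.

(* The interval [c/d, a/b] is encoded as [((c, d), (a, b))]; numerators are
   nonnegative, hence in [nat], and [a d - b c = 1] is written without
   (truncated) subtraction. Fractions being reduced, the encoding is
   one-to-one. *)
Definition is_farey (I : (nat * nat) * (nat * nat)) : bool :=
  let: ((c, d), (a, b)) := I in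
  [&& (0 < b)%N, (0 < d)%N, (c <= d)%N, (a <= b)%N,
      coprime a b, coprime c d & (a * d == b * c + 1)%N].

Definition farey_interval : choiceType :=
  {I : (nat * nat) * (nat * nat) | is_farey I}.

Definition farey_c (R : realType) (f : R -> R) (I : farey_interval) : R :=
  let: ((c, d), (a, b)) := val I in
  f ((a + c)%:R / (b + d)%:R)
  - b%:R / (b + d)%:R * f (a%:R / b%:R)
  - d%:R / (b + d)%:R * f (c%:R / d%:R).

Definition farey_T (R : realType) (f : R -> R) (I : farey_interval) : R :=
  let: ((c, d), (a, b)) := val I in (b + d)%:R * farey_c f I.

(* x ^ s = exp (s log x) for x > 0; the value at x = 0 is 0 when Re s != 0. *)
Definition cpow (R : realType) (x : R) (s : R[i]) : R[i] :=
  (x `^ complex.Re s)%:C *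
  (cos (complex.Im s * ln x) +i* sin (complex.Im s * ln x)).

Definition farey_term (R : realType) (f : R -> R) (s : R[i])
  (I : farey_interval) : R[i]^o := cpow `|farey_T f I| s.

(* Unordered summation: the limit of the sums over finite sets of Farey
   intervals, directed by inclusion. In R[i] this is absolute convergence. *)
Definition farey_zeta_cvg (R : realType) (f : R -> R) (s : R[i]) : Prop :=
  cvg (summability.partial_sum (farey_term f s) @ summability.totally).

Definition farey_zeta (R : realType) (f : R -> R) (s : R[i]) : R[i] :=
  summability.sum (farey_term f s).

Definition holomorphic_on (R : realType) (U : set R[i]^o)
  (F : R[i]^o -> R[i]^o) : Prop :=
  forall s, U s -> derivable F s 1.

(* Principal part r / (s - s0) with r != 0, hence residue r. *)
Definition simple_pole_with_residue (R : realType) (F : R[i]^o -> R[i]^o)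
  (s0 r : R[i]^o) : Prop :=
  r != 0 /\
  exists h : R[i]^o -> R[i]^o,
    (\forall s \near s0, derivable h s 1) /\
    (\forall s \near s0^', F s = (r : R[i]) / (s - s0) + h s).

Definition Gamma (R : realType) (x : R) : R :=
  \int[@lebesgue_measure R]_(t in `]0, +oo[) (t `^ (x - 1) * expR (- t)).

(* Main.v *)
(* Put Λ_I = 1/|T_I|. By Taylor's formula Λ_I = bd(b+d) η(ξ) for some ξ in I, where
   η = 2/|f''|. The proof estimates the Riesz mean A(x) = Σ_I max(0, x - Λ_I)^2.

   An interval with b < d is determined by b and d, and its right end point is a/b
   with a the inverse of d modulo b; the reflection y -> 1 - y exchanges the cases b < d
   and d < b. Kloosterman's fourth moment bound makes these inverses equidistributed
   with a power saving, so that, by partial summation, η(ξ) may be averaged over [0, 1]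
   at the cost of O(x^(13/5)). What remains is a count of coprime pairs, which is the
   corresponding count of all pairs divided by ζ(2), and the latter is a Beta integral.
   Altogether A(x) = C x^(8/3) + O(x^(13/5)).

   Since Z_f(s) = s(s+1)(s+2)/2 ∫ A(x) x^(-s-3) dx, the main term contributes
   C s(s+1)(s+2)/(2(s - 2/3)) and the error term a function holomorphic for Re s > 3/5. *)

Require Import Defs.
From HB Require Import structures.
From mathcomp Require Import all_boot all_order all_algebra fingroup cyclic.
From mathcomp Require Import ring lra zify.

Set Implicit Arguments.
Unset Strict Implicit.
Unset Printing Implicit Defensive.

Import Order.TTheory GRing.Theory Num.Theory.

Local Open Scope ring_scope.

(** * Kloosterman sums *)

(** The obstacle to a direct count is that [Λ_I] depends on the position of [I] and not only on [b]
    and [d]: for fixed [b] the end point [a/b] jumps with the inverse of [d]. Hence the need for a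
    power saving, and its exponent fixes the half-plane. A box discrepancy [b^(4/5)] costs
    [x (x/b)^(3/2) b^(4/5)] for each [b]; summed over [b <= x^(1/3)] this is [x^(13/5)], whence
    [3/5]. The fourth moment gives [3/4] up to divisor and logarithmic factors, which is just enough
    room.

    The Riesz mean has order 2 because partial summation in [a] and in [d] meets the mixed second
    difference of the weight, and [max(0, x - z)^2] has a Lipschitz derivative in [z].

    The main constant for [b < d] is [9/80 B(1/3, 1/3) / ζ(2)], where [9/80] is half of the integral
    of [b (1 - b^3)^2] over [[0, 1]]. It is doubled for [d < b], and [40/27] is the value of
    [s(s+1)(s+2)/2] at [s = 2/3]. *)

Lemma card_fibers (T T' : finType) (X : {set T}) (Y : {set T'}) (g : T -> T') (k : nat) :
  (forall x, x \in X -> g x \in Y) ->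
  (forall y, y \in Y -> (#|[set x in X | g x == y]| <= k)%N) ->
  (#|X| <= #|Y| * k)%N.
Proof.
move=> XY gk; rewrite -sum1_card (partition_big g (mem Y)) //=.
rewrite -sum_nat_const; apply: leq_sum => y yY.
by rewrite sum1dep_card; apply: leq_trans (gk y yY); rewrite cardsE.
Qed.

Definition nb_ann (A : finComUnitRingType) (c : A) : nat := #|[set x : A | c * x == 0]|.

(** The number of pairs [(u, v)] with [u v = 0]. *)
Definition nb_zero_mul (A : finComUnitRingType) : nat := (\sum_(u : A) nb_ann u)%N.

(** A nonempty solution set is a translate of the annihilator of [c]. *)
Lemma nb_ann_sol (A : finComUnitRingType) (c e : A) :
  (#|[set x : A | (c * x == e)%R]| <= nb_ann c)%N.
Proof.
case: (set_0Vmem [set x : A | c * x == e]) => [->|[x0]]; first by rewrite cards0.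
rewrite inE => /eqP cx0.
rewrite -(card_imset _ (addIr (- x0))); apply/subset_leq_card/subsetP => y.
by case/imsetP => x; rewrite !inE => /eqP cx ->; rewrite mulrBr cx cx0 subrr.
Qed.

(** Multiplication by [d] sends the annihilator of [c d] into that of [c], and its fibres are
    solution sets of [d x = y]. *)
Lemma nb_annM (A : finComUnitRingType) (c d : A) :
  (nb_ann (c * d)%R <= nb_ann c * nb_ann d)%N.
Proof.
apply: (@card_fibers _ _ _ _ ( *%R d)) => [x|y _]; first by rewrite !inE mulrA.
apply: leq_trans (nb_ann_sol d y); apply/subset_leq_card/subsetP => x.
by rewrite !inE => /andP[].
Qed.

Section Kloosterman.
Variables (C : numClosedFieldType) (A : finComUnitRingType) (e : A -> C).
(** These three properties of the character [exp(2 pi i x / b)] of [Z/b] are all that the moment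
    argument asks of [e]. *)
Hypothesis e_add : forall x y, e (x + y) = e x * e y.
Hypothesis e_norm : forall x, `|e x| = 1.
Hypothesis e_sum : forall y, \sum_x e (x * y) = (#|A| * (y == 0))%:R.

Definition kloosterman (h k : A) : C :=
  \sum_(u : A | u \in GRing.unit) e (h * u + k * u^-1).

Lemma e_conj x : (e x)^* = e (- x).
Proof.
have e0 : e 0 = 1.
  have : e 0 * e 0 = e 0 * 1 by rewrite -e_add addr0 mulr1.
  by apply: mulfI; rewrite -normr_eq0 e_norm oner_eq0.
have exx : e x * e (- x) = 1 by rewrite -e_add subrr.
have ex0 : e x != 0 by rewrite -normr_eq0 e_norm oner_eq0.
by apply: (mulfI ex0); rewrite exx -normCK e_norm expr1n.
Qed.

(** Once the square is opened, orthogonality in [h] and in [k] keeps only the pairs with equal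
    frequencies. *)
Lemma sum_sqr_norm_expsum (J : finType) (P : pred J) (al be : J -> A) :
  \sum_h \sum_k `|\sum_(j | P j) e (h * al j + k * be j)| ^+ 2 =
  (#|A| ^ 2 * #|[set p : J * J | [&& P p.1, P p.2, al p.1 == al p.2 & be p.1 == be p.2]]|)%:R :> C.
Proof.
have E h k : `|\sum_(j | P j) e (h * al j + k * be j)| ^+ 2 =
  \sum_(p : J * J | P p.1 && P p.2) e (h * (al p.1 - al p.2)) * e (k * (be p.1 - be p.2)).
  rewrite normCK rmorph_sum /= mulr_suml.
  rewrite -(pair_big P P (fun i j => e (h * (al i - al j)) * e (k * (be i - be j)))) /=.
  apply: eq_bigr => i _; rewrite mulr_sumr; apply: eq_bigr => j _.
  by rewrite e_conj -!e_add; congr e; ring.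
under eq_bigr do under eq_bigr do rewrite E.
under eq_bigr do rewrite exchange_big /=.
rewrite exchange_big /=.
under eq_bigr => p _.
  under eq_bigr do rewrite -mulr_sumr e_sum.
  rewrite -mulr_suml e_sum.
  over.
rewrite -[#|[set _ | _]|]sum1_card natrM natr_sum mulr_sumr big_mkcond [RHS]big_mkcond /=.
apply: eq_bigr => p _; rewrite inE !subr_eq0.
case: (P p.1); case: (P p.2) => //=.
case: eqP => _ /=; rewrite ?(muln0, mul0r) //.
case: eqP => _ /=; rewrite ?(muln0, mulr0) // !muln1 mulr1 -natrM; congr _%:R.
Qed.

(** Presents the square as an exponential sum over pairs of units, so that a fourth moment becomes a
    second moment in [sum_sqr_norm_expsum]. *)
Lemma kloosterman_sqr h k : kloosterman h k ^+ 2 =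
  \sum_(p : A * A | (p.1 \in GRing.unit) && (p.2 \in GRing.unit))
    e (h * (p.1 + p.2) + k * (p.1^-1 + p.2^-1)).
Proof.
rewrite expr2 /kloosterman mulr_suml.
rewrite -(pair_big (fun u : A => u \in GRing.unit) (fun u : A => u \in GRing.unit)
  (fun i j => e (h * (i + j) + k * (i^-1 + j^-1)))) /=.
apply: eq_bigr => i _; rewrite mulr_sumr; apply: eq_bigr => j _.
by rewrite -e_add; congr e; ring.
Qed.

(* With [u = x3 - x1] and [v = x3 - x2], the system [x1 + x2 = x3 + x4],
   [1/x1 + 1/x2 = 1/x3 + 1/x4] implies [u v (2 x3 - u - v) = 0]. *)
Lemma card_kloosterman_system :
  (#|[set p : (A * A) * (A * A) |
      [&& (p.1.1 \in GRing.unit) && (p.1.2 \in GRing.unit),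
          (p.2.1 \in GRing.unit) && (p.2.2 \in GRing.unit),
          (p.1.1 + p.1.2 == p.2.1 + p.2.2)%R &
          (p.1.1^-1 + p.1.2^-1 == p.2.1^-1 + p.2.2^-1)%R]]|
   <= nb_ann (2%R : A) * nb_zero_mul A ^ 2)%N.
Proof.
set V := [set p | _].
pose g (p : (A * A) * (A * A)) := ((p.2.1 - p.1.1, p.2.1 - p.1.2), p.2.1).
pose W := [set q : (A * A) * A | q.1.1 * q.1.2 * (2 * q.2 - q.1.1 - q.1.2) == 0].
have g_inj : {in V &, injective g}.
  move=> [[x1 x2] [x3 x4]] [[y1 y2] [y3 y4]]; rewrite !inE /= /g /=.
  move=> /and4P[_ _ /eqP hx _] /and4P[_ _ /eqP hy _] [e1 e2 e3].
  move: e1 e2 hx hy; rewrite e3 => /addrI/oppr_inj -> /addrI/oppr_inj -> -> /addrI ->.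
  by [].
have gVW : g @: V \subset W.
  apply/subsetP => q /imsetP[[[x1 x2] [x3 x4]]]; rewrite !inE /= => /and4P[].
  move=> /andP[u1 u2] /andP[u3 u4] /eqP h1 /eqP h2 -> /=.
  have h3 : (x1 + x2) * (x3 * x4) = (x1 + x2) * (x1 * x2).
    have : x1 * x2 * x3 * x4 * (x1^-1 + x2^-1) = x1 * x2 * x3 * x4 * (x3^-1 + x4^-1).
      by rewrite h2.
    have -> : x1 * x2 * x3 * x4 * (x1^-1 + x2^-1) =
       (x1 / x1) * (x2 * x3 * x4) + (x2 / x2) * (x1 * x3 * x4) by ring.
    have -> : x1 * x2 * x3 * x4 * (x3^-1 + x4^-1) =
       (x3 / x3) * (x1 * x2 * x4) + (x4 / x4) * (x1 * x2 * x3) by ring.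
    rewrite !divrr // !mul1r.
    have -> : x2 * x3 * x4 + x1 * x3 * x4 = (x1 + x2) * (x3 * x4) by ring.
    have -> : x1 * x2 * x4 + x1 * x2 * x3 = (x3 + x4) * (x1 * x2) by ring.
    by rewrite h1.
  have -> : 2 * x3 - (x3 - x1) - (x3 - x2) = x1 + x2 by ring.
  have x4E : x4 = x1 + x2 - x3 by rewrite h1; ring.
  have -> : (x3 - x1) * (x3 - x2) * (x1 + x2) =
     (x1 + x2) * (x1 * x2) - (x1 + x2) * (x3 * x4) by rewrite x4E; ring.
  by rewrite h3 subrr.
rewrite -(card_in_imset g_inj); apply: leq_trans (subset_leq_card gVW) _.
rewrite -sum1_card (partition_big (fun q => q.1) predT) //=.
have -> : (nb_ann (2%R : A) * nb_zero_mul A ^ 2 =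
  \sum_(uv : A * A) nb_ann (2%R : A) * (nb_ann uv.1 * nb_ann uv.2))%N.
  rewrite -big_distrr /= -(pair_big predT predT (fun i j => nb_ann i * nb_ann j)%N) /=.
  rewrite expnS expn1; congr muln; rewrite /nb_zero_mul big_distrl /=.
  by apply: eq_bigr => i _; rewrite big_distrr.
apply: leq_sum => -[u v] _ /=.
rewrite sum1dep_card.
(* For fixed [u] and [v] the equation is linear in [x3]: [2 u v x3 = u v (u + v)]. *)
apply: leq_trans (_ : (nb_ann (u * v * 2)%R <= _)%N); last first.
  apply: leq_trans (nb_annM _ _) _; rewrite mulnC leq_mul2l nb_annM orbT //.
apply: leq_trans (nb_ann_sol (u * v * 2) (u * v * (u + v))).
pose pr (q : (A * A) * A) := q.2.
rewrite -(@card_in_imset _ _ pr); last first.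
  by move=> [uv x] [uv' x']; rewrite !inE /pr /= => /andP[_ /eqP ->] /andP[_ /eqP ->] ->.
apply/subset_leq_card/subsetP => x /imsetP[[[u' v'] x']].
rewrite !inE /pr /= => /andP[/eqP h0 /eqP[uu vv]] ->; rewrite uu vv in h0.
rewrite -subr_eq0; apply/eqP; rewrite -[RHS]h0.

by ring.
Qed.

(* Averages over the pairs [(h u, k / u)], [u] a unit, on which the sum is constant
   and each of which is hit at most [nb_ann k] times. *)
Lemma kloosterman_bound h k :
  `|kloosterman h k| ^+ 4 * #|[set u : A | u \in GRing.unit]|%:R <=
  (nb_ann k * (#|A| ^ 2 * (nb_ann (2%R : A) * nb_zero_mul A ^ 2)))%:R :> C.
Proof.
have inv u : u \in GRing.unit -> kloosterman (h * u) (k / u) = kloosterman h k.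
  move=> uu; rewrite /kloosterman (reindex (fun x => x / u)) /=; last first.
    by exists (fun x => x * u) => x _; rewrite ?mulrVK ?mulrK.
  apply: eq_big => [x|x]; first by rewrite unitrMl ?unitrV.
  rewrite unitrMl ?unitrV // => ux; rewrite invrM ?unitrV // invrK; congr e.
  have -> : h * u * (x / u) = h * x * (u / u) by ring.
  have -> : k / u * (u / x) = k / x * (u / u) by ring.
  by rewrite divrr // !mulr1.
have E : \sum_(u : A | u \in GRing.unit) `|kloosterman (h * u) (k / u)| ^+ 4 =
   `|kloosterman h k| ^+ 4 * #|[set u : A | u \in GRing.unit]|%:R.
  rewrite (eq_bigr (fun=> `|kloosterman h k| ^+ 4)) => [|u /inv -> //].
  by rewrite sumr_const cardsE mulr_natr.
rewrite -E natrM.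
have M : \sum_h' \sum_k' `|kloosterman h' k'| ^+ 4 <=
    (#|A| ^ 2 * (nb_ann (2%R : A) * nb_zero_mul A ^ 2))%:R.
  under eq_bigr do under eq_bigr do rewrite (exprM _ 2 2) -normrX kloosterman_sqr.
  by rewrite sum_sqr_norm_expsum ler_nat leq_mul2l card_kloosterman_system orbT.
apply: le_trans (ler_wpM2l (ler0n _ _) M).
rewrite mulr_natl.
pose F (p : A * A) := `|kloosterman p.1 p.2| ^+ 4.
rewrite (partition_big (fun u => (h * u, k / u)) predT) //=.
rewrite (pair_big predT predT (fun i j => `|kloosterman i j| ^+ 4)) /= -sumrMnl.
apply: ler_sum => -[h' k'] _ /=.
rewrite (eq_bigr (fun=> `|kloosterman h' k'| ^+ 4)) => [|u /andP[_ /eqP[-> ->]] //].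
rewrite sumr_const -mulr_natr -[leRHS]mulr_natr; apply: ler_wpM2l; first exact: exprn_ge0.
(* The inverse of [u] solves the linear equation [k y = k']. *)
rewrite ler_nat; apply: leq_trans (nb_ann_sol k k').
rewrite -(card_imset _ (@invr_inj A)).
apply/subset_leq_card/subsetP => y /imsetP[u].
by rewrite !inE => /andP[_ /eqP[_ uk]] ->; rewrite uk.
Qed.

End Kloosterman.

(** * The divisor function *)

Section DivisorCount.
Local Open Scope nat_scope.

Definition tau (n : nat) : nat := size (divisors n).

Lemma tauE n : 0 < n -> tau n = \sum_(1 <= d < n.+1 | d %| n) 1.
Proof.
move=> n0; rewrite /tau -sum1_size -[in RHS]big_filter; apply: perm_big.
apply: uniq_perm; rewrite ?divisors_uniq ?filter_uniq ?iota_uniq // => d.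
rewrite mem_filter mem_index_iota -dvdn_divisors //.
by case: (boolP (d %| n)) => //= dn; rewrite (dvdn_gt0 n0 dn) ltnS dvdn_leq.
Qed.

(** The divisors of [p^k m] are the products [p^i d] with [i <= k] and [d] dividing [m], each
    obtained once. *)
Lemma tau_pfactorM p k m : prime p -> 0 < m -> coprime p m ->
  tau (p ^ k * m) = k.+1 * tau m.
Proof.
move=> pp m0 pm; have p1 := prime_gt1 pp; have p0 := prime_gt0 pp.
have n0 : 0 < p ^ k * m by rewrite muln_gt0 expn_gt0 p0.
rewrite /tau -[k.+1](size_iota 0) -(size_allpairs (fun i d => p ^ i * d)).
apply: perm_size; apply: uniq_perm; first exact: divisors_uniq.
  apply: allpairs_uniq; rewrite ?iota_uniq ?divisors_uniq //.
  move=> [i1 d1] [i2 d2] in1 in2 /= E.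
  have hd : d1 \in divisors m by case/allpairsP: in1 => -[x y] /= [_ hy [_ ->]].
  have hd' : d2 \in divisors m by case/allpairsP: in2 => -[x y] /= [_ hy [_ ->]].
  move: hd hd'; rewrite -!dvdn_divisors // => hd hd'.
  have c1 : logn p d1 = 0 by apply: logn_coprime; rewrite (coprime_dvdr hd).
  have c2 : logn p d2 = 0 by apply: logn_coprime; rewrite (coprime_dvdr hd').
  have d10 := dvdn_gt0 m0 hd; have d20 := dvdn_gt0 m0 hd'.
  have := congr1 (logn p) E.
  rewrite !lognM ?expn_gt0 ?p0 // !pfactorK // c1 c2 !addn0 => e; rewrite e in E *.
  by move/eqP: E; rewrite eqn_pmul2l ?expn_gt0 ?p0 // => /eqP ->.
move=> d; rewrite -dvdn_divisors //; apply/idP/allpairsP => [dn|[[i d'] [hi hd ->]]].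
  have d0 := dvdn_gt0 n0 dn.
  have hi : logn p d \in iota 0 k.+1.
    rewrite mem_iota add0n ltnS leq0n /=.
    have := dvdn_leq_log p n0 dn; rewrite lognM ?expn_gt0 ?p0 // pfactorK //.
    by rewrite (logn_coprime pm) addn0.
  exists (logn p d, d %/ p ^ logn p d); split => //.
  - rewrite -dvdn_divisors //=.
    have [q qp dE] := pfactor_coprime pp d0.
    have E2 : d %/ p ^ logn p d = q by rewrite {1}dE mulnK // expn_gt0 p0.
    rewrite E2; move: dn; rewrite dE => /(dvdn_trans (dvdn_mulr _ (dvdnn q))).
    by rewrite Gauss_dvdr // coprimeXr // coprime_sym.
  - by rewrite /= mulnC divnK // pfactor_dvdnn.
move: hi hd; rewrite mem_iota add0n ltnS /= -dvdn_divisors // => hi hd.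
by apply: dvdn_mul => //; exact: dvdn_exp2l.
Qed.

(** Induction for multiplicative functions: the full power of the smallest prime divisor is split
    off. *)
Lemma pfactor_ind (P : nat -> Prop) :
  P 1 -> (forall p k m, prime p -> 0 < k -> 0 < m -> coprime p m -> P m -> P (p ^ k * m)) ->
  forall n, 0 < n -> P n.
Proof.
move=> P1 Pm; elim/ltn_ind => n IH n0.
have [->//|n1] := eqVneq n 1.
have pp : prime (pdiv n) by apply: pdiv_prime; lia.
have [m mp nE] := pfactor_coprime pp n0.
have k0 : 0 < logn (pdiv n) n by rewrite logn_gt0 mem_primes pp n0 pdiv_dvd.
have m0 : 0 < m by move: n0; rewrite nE; case: (m) => //; rewrite mul0n.
rewrite nE mulnC; apply: Pm => //; apply: IH => //.
rewrite nE -{1}[m]muln1 ltn_pmul2l //; apply: (@leq_trans (2 ^ logn (pdiv n) n)).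
  by rewrite -{1}(exp1n (logn (pdiv n) n)) ltn_exp2r.
by rewrite leq_exp2r // prime_gt1.
Qed.

(** Serves as the lower bound [b / tau b] for the number of units in [kloosterman_bound]. By
    multiplicativity it reduces to [p <= (p - 1)(k + 1)] with [k >= 1]. *)
Lemma leq_totient_tau n : 0 < n -> n <= totient n * tau n.
Proof.
move: n; apply: pfactor_ind => // p k m pp k0 m0 pm IH.
rewrite tau_pfactorM // totient_coprime ?coprimeXl // totient_pfactor //.
have p1 := prime_gt1 pp.
have h : p ^ k <= p.-1 * p ^ k.-1 * k.+1.
  rewrite -{1}(prednK k0) expnS; rewrite mulnAC leq_mul2r; apply/orP; right.
  by case: p {pp pm} p1 => // p; case: k k0 => // k _ p1 /=; nia.
by apply: leq_trans (leq_mul h IH) _; apply: eq_leq; lia.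
Qed.

(* [tau n ^ j <= C n]: for the primes [p >= 2 ^ j] one has
   [(k + 1) ^ j <= 2 ^ (j k) <= p ^ k], and the finitely many smaller primes
   contribute a bounded factor each. *)
Lemma tau_bound (j : nat) : exists C, forall n, 0 < n -> tau n ^ j <= C * n.
Proof.
have [K HK] : exists K, forall k, k.+1 ^ j <= K * 2 ^ k.
  case: j => [|j]; first by exists 1 => k; rewrite mul1n expn0 expn_gt0.
  (* With [q] the quotient of [k] by [j + 1], one has [k + 1 <= (j + 1)(q + 1) <= (j + 1) 2^q]. *)
  exists (j.+1 ^ j.+1) => k.
  apply: (@leq_trans ((j.+1 * (k %/ j.+1).+1) ^ j.+1)).
    by rewrite leq_exp2r // mulnC ltn_ceil.
  rewrite expnMn leq_mul2l; apply/orP; right.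
  apply: (@leq_trans ((2 ^ (k %/ j.+1)) ^ j.+1)); first by rewrite leq_exp2r // ltn_expl.
  by rewrite -expnM leq_exp2l // leq_trunc_div.
have K0 : 0 < K by move: (HK 0); rewrite exp1n muln1.
pose sm n := \sum_(p < 2 ^ j | prime p && (p %| n)) 1.
have smle n : sm n <= 2 ^ j.
  rewrite /sm big_mkcond -[leqRHS]card_ord -sum1_card; apply: leq_sum => i _.
  by case: ifP.
suff H n : 0 < n -> tau n ^ j <= K ^ sm n * n.
  exists (K ^ (2 ^ j)) => n n0; apply: leq_trans (H n n0) _.
  by rewrite leq_mul2r leq_pexp2l // orbT.
move: n; apply: pfactor_ind => [|p k m pp k0 m0 pm IH].
  by rewrite /tau /= exp1n muln1 expn_gt0 K0.
rewrite tau_pfactorM // expnMn.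
have p0 := prime_gt0 pp.
have pn q : prime q -> (q %| p ^ k * m) = (q == p) || (q %| m).
  move=> qp; rewrite Euclid_dvdM // Euclid_dvdX // k0 andbT.
  by rewrite dvdn_prime2.
have [pj|pj] := ltnP p (2 ^ j).
  have -> : sm (p ^ k * m) = (sm m).+1.
    rewrite /sm (bigD1 (Ordinal pj)) /=; last by rewrite pp pn ?eqxx.
    rewrite add1n; congr S; apply: eq_bigl => q.
    have [qp|//] := boolP (prime q); rewrite pn //= -val_eqE /=.
    have [->|//] := eqVneq (q : nat) p; last by rewrite andbT.
    by move: pm; rewrite prime_coprime // => /negbTE ->.
  rewrite expnS mulnACA; apply: leq_mul => //.
  apply: leq_trans (HK k) _; rewrite leq_mul2l leq_exp2r // prime_gt1 ?orbT //.
have -> : sm (p ^ k * m) = sm m.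
  rewrite /sm; apply: eq_bigl => q.
  have [qp|//] := boolP (prime q); rewrite pn //=.
  by have := ltn_ord q; case: eqVneq => // ->; lia.
rewrite mulnCA; apply: leq_mul => //.
apply: (@leq_trans ((2 ^ k) ^ j)).
  by case: (j) => // j'; rewrite leq_exp2r // ltn_expl.
rewrite -expnM mulnC expnM; by rewrite leq_exp2r.
Qed.
End DivisorCount.

(** * Inverses modulo b in a box *)

Lemma sum_multiples (V : nmodType) (d k : nat) (F : nat -> V) : (0 < d)%N ->
  \sum_(0 <= u < d * k | (d %| u)%N) F u = \sum_(0 <= j < k) F (d * j)%N.
Proof.
move=> d0; elim: k => [|k IH]; first by rewrite muln0 !big_geq.
have le1 : (d * k <= d * k.+1)%N by rewrite leq_mul2l leqnSn orbT.
rewrite (@big_cat_nat _ _ _ (d * k)%N) //= IH big_nat_recr //=; congr (_ + _).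
rewrite big_ltn_cond ?dvdn_mulr //; last by rewrite ltn_mul2l d0 ltnSn.
rewrite big_nat_cond big1 ?addr0 // => u /andP[/andP[h1 h2]] /dvdnP[q E].
by move: h1 h2; rewrite E ![(d * _)%N]mulnC !ltn_mul2r d0 /= ltnS; case: ltnP.
Qed.

Section ZmodCounts.
Local Open Scope nat_scope.
Variables (b : nat) (b1 : 1 < b).

Let bE : (Zp_trunc b).+2 = b. Proof. exact: Zp_cast. Qed.

Lemma Zp_eq0 (x : 'Z_b) (n : nat) : ((n%:R * x)%R == 0%R :> 'Z_b) = (b %| n * x).
Proof.
by rewrite -[x in LHS]natr_Zp -natrM -val_eqE /= Zp_nat /= [X in _ %% X]bE.
Qed.

(** With [g] the gcd, the annihilated residues are multiples of [b / g], and there are [g] of these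
    below [b]. *)
Lemma nb_ann_Zp (n : nat) : nb_ann (n%:R : 'Z_b)%R <= gcdn n b.
Proof.
set g := gcdn n b.
have g0 : 0 < g by rewrite gcdn_gt0 (ltnW b1) orbT.
have gb : g %| b by rewrite dvdn_gcdr.
rewrite /nb_ann -[leqRHS]card_ord.
have b'0 : 0 < b %/ g by rewrite divn_gt0 // dvdn_leq // ltnW.
have key (x : 'Z_b) : (n%:R * x)%R == 0%R :> 'Z_b -> b %/ g %| x.
  rewrite Zp_eq0 => h.
  have gn : g %| n by rewrite dvdn_gcdl.
  have : b %/ g %| (n %/ g) * x by rewrite -(dvdn_pmul2r g0) divnK // mulnAC divnK.
  rewrite Gauss_dvdr // coprime_sym /coprime.
  rewrite -(eqn_pmul2r g0) muln_gcdl !divnK // mul1n; exact/eqxx.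
have lt (x : 'Z_b) : x %/ (b %/ g) < g.
  rewrite ltn_divLR // mulnC divnK //.
  have := ltn_ord x. by rewrite [X in _ < X -> _]bE.
pose f (x : 'Z_b) : 'I_g := Ordinal (lt x).
rewrite -(@card_in_imset _ _ f) ?max_card // => x y.
rewrite !inE => /key hx /key hy /(congr1 val) /= h.
by apply/val_inj; rewrite /= -(divnK hx) -(divnK hy) h.
Qed.

(** The gcd is at most the sum of all common divisors [d]; after exchanging the sums, each [d]
    dividing [b] contributes [d] times [b / d]. *)
Lemma sum_gcdn_le : \sum_(0 <= u < b) gcdn u b <= b * tau b.
Proof.
have b0 := ltnW b1.
apply: (@leq_trans (\sum_(0 <= u < b) \sum_(1 <= d < b.+1 | d %| b) d * (d %| u))).
  apply: leq_sum => u _.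
  have hg : gcdn u b \in index_iota 1 b.+1.
    by rewrite mem_index_iota gcdn_gt0 b0 orbT ltnS dvdn_leq // dvdn_gcdr.
  rewrite (big_rem (gcdn u b) hg) /= dvdn_gcdr.
  by rewrite dvdn_gcdl muln1 leq_addr.
rewrite exchange_big /= tauE // big_distrr /=.
rewrite big_seq_cond [leqRHS]big_seq_cond; apply: leq_sum => d /andP[].
rewrite mem_index_iota => /andP[d0 _] db.
rewrite muln1 -big_distrr /=.
have E : (\sum_(0 <= u < b) (d %| u) = b %/ d)%N.
  rewrite (eq_bigr (fun u => if d %| u then 1 else 0)%N); last by move=> u _; case: ifP.
  rewrite -big_mkcond /= -{1}[b](divnK db) mulnC.
  by rewrite (@sum_multiples nat d (b %/ d) (fun=> 1%N) d0) sum_nat_const_nat subn0 muln1.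
by rewrite E mulnC divnK.
Qed.
End ZmodCounts.

Lemma gcdn_subl b k : (k <= b)%N -> gcdn (b - k) b = gcdn k b.
Proof.
by move=> kb; rewrite -{2 3}(subnK kb) gcdnDl gcdnDr gcdnC.
Qed.

Section Box.
Variables (C : numClosedFieldType) (b : nat) (w : C).
Hypothesis b1 : (1 < b)%N.
Hypothesis wb : w ^+ b = 1.
(** Since [b/h + b/(b - h) = b^2 / (h (b - h))], this is a lower bound for [|w^h - 1|], in the form
    in which it bounds geometric sums. It also makes [w] primitive. *)
Hypothesis w_sep : forall h, (0 < h < b)%N ->
  2 <= `|w ^+ h - 1| * (b%:R / h%:R + b%:R / (b - h)%:R).

Let bE : (Zp_trunc b).+2 = b. Proof. exact: Zp_cast. Qed.
Let b0 : (0 < b)%N := ltnW b1.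

(** The term [i = 0] is [0], as [0^-1 = 0]: this is the harmonic number of index [b - 1]. *)
Definition harm : C := \sum_(0 <= i < b) i%:R^-1.

Let H0 : 0 <= harm. Proof. by apply: sumr_ge0 => i _; rewrite invr_ge0. Qed.

(** As in [sum_gcdn_le], the gcd is bounded by the sum of the common divisors; on the multiples
    [k = d j] the quotient [d / k] is [1 / j], so each divisor costs one harmonic sum. *)
Lemma sum_gcdn_div_le :
  \sum_(0 <= k < b) (gcdn k b)%:R / k%:R <= (tau b)%:R * harm :> C.
Proof.
apply: (@le_trans _ _ (\sum_(0 <= k < b) \sum_(1 <= d < b.+1 | (d %| b)%N)
    (d * (d %| k))%:R / k%:R)).
  apply: ler_sum => k _; rewrite -mulr_suml ler_wpM2r ?invr_ge0 //.
  rewrite -natr_sum ler_nat.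
  have hg : (gcdn k b) \in index_iota 1 b.+1.
    by rewrite mem_index_iota gcdn_gt0 b0 orbT ltnS dvdn_leq // dvdn_gcdr.
  rewrite (big_rem (gcdn k b) hg) /= dvdn_gcdr.
  by rewrite dvdn_gcdl muln1 leq_addr.
rewrite exchange_big /= tauE // natr_sum mulr_suml.
rewrite big_seq_cond [leRHS]big_seq_cond; apply: ler_sum => d /andP[].
rewrite mem_index_iota => /andP[d0 _] db; rewrite mul1r.
rewrite (eq_bigr (fun k => if (d %| k)%N then d%:R / k%:R else 0)); last first.
  by move=> k _; case: ifP; rewrite ?muln1 ?muln0 ?mul0r.
rewrite -big_mkcond /= -{1}[b](divnK db) mulnC sum_multiples //.
rewrite /harm (@big_cat_nat _ _ _ (b %/ d) 0 b) ?leq_div //=.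
rewrite -[leLHS]addr0 lerD //; last by apply: sumr_ge0 => i _; rewrite invr_ge0.
apply: ler_sum => j _.
by rewrite natrM invfM mulrA divff ?mul1r // pnatr_eq0 -lt0n.
Qed.

Let e (x : 'Z_b) : C := w ^+ x.

Lemma eD x y : e (x + y) = e x * e y.
Proof. by rewrite /e -exprD /= [X in (_ %% X)%N]bE expr_mod. Qed.

Lemma e_nat n : e n%:R = w ^+ n.
Proof. by rewrite /e Zp_nat /= [X in (_ %% X)%N]bE expr_mod. Qed.

Lemma enorm x : `|e x| = 1.
Proof.
rewrite /e normrX.
have : `|w| ^+ b = 1 by rewrite -normrX wb normr1.
by move/eqP; rewrite pexpr_eq1 // => /eqP ->; rewrite expr1n.
Qed.

(** A geometric sum: the numerator has modulus at most 2, and [w_sep] takes care of the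
    denominator. *)
Lemma e_geo (h : 'Z_b) (D : nat) : h != 0 ->
  `|\sum_(0 <= d < D) e (h * d%:R)| <= b%:R / h%:R + b%:R / (b - h)%:R.
Proof.
move=> h0.
have hb : (0 < h < b)%N.
  have := ltn_ord h; rewrite [X in (_ < X)%N -> _]bE => ->.
  by rewrite andbT lt0n; apply: contra h0 => /eqP h0; apply/eqP/val_inj.
have E d : e (h * d%:R) = (w ^+ h) ^+ d.
  by rewrite -{1}[h]natr_Zp -natrM e_nat exprM.
under eq_bigr do rewrite E.
have G : (w ^+ h - 1) * \sum_(0 <= d < D) (w ^+ h) ^+ d = (w ^+ h) ^+ D - 1.
  by rewrite big_mkord -subrX1.
have n2 : `|(w ^+ h) ^+ D - 1| <= 2.
  apply: le_trans (ler_normB _ _) _.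
  by rewrite normr1 -E enorm.
have w0 : 0 < `|w ^+ h - 1|.
  rewrite lt_def normr_ge0 andbT; apply/eqP => z.
  by have := w_sep hb; rewrite z mul0r lern0.
rewrite -(ler_pM2l w0) -normrM G; exact: le_trans n2 (w_sep hb).
Qed.

(** Translating [x] by 1 multiplies the sum by [e y], and [w_sep] excludes [e y = 1] unless
    [y = 0]. *)
Lemma esum (y : 'Z_b) : \sum_x e (x * y) = (#|'Z_b| * (y == 0))%:R.
Proof.
have cE : #|'Z_b| = b by rewrite card_ord.
rewrite cE; have [->|y0] := eqVneq y 0.
  rewrite (eq_bigr (fun=> 1)) => [|x _]; last by rewrite mulr0 /e expr0.
  by rewrite sumr_const cE muln1.
rewrite muln0; set S := \sum_x _.
have SE : S = S * e y.
  rewrite {1}/S (reindex_inj (@addIr _ 1)) /= mulr_suml.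
  by apply: eq_bigr => x _; rewrite mulrDl mul1r eD.
have hb : (0 < y < b)%N.
  have := ltn_ord y; rewrite [X in (_ < X)%N -> _]bE => ->.
  by rewrite andbT lt0n; apply: contra y0 => /eqP y0; apply/eqP/val_inj.
have : S * (e y - 1) = 0 by rewrite mulrBr mulr1 -SE subrr.
move/eqP; rewrite mulf_eq0 => /orP[/eqP //|/eqP z].
by have := w_sep hb; rewrite -/(e y) z normr0 mul0r lern0.
Qed.

Let S := kloosterman e.

(** Here [q] stands for the fourth root of [b], and [g] for the gcd. The moment bound together with
    [b / tau b] units gives [s^4 <= 2 g tau^3 b^3], which is then weakened to a perfect fourth
    power. *)
Lemma kloosterman_Zp_bound (q : C) (h : 'Z_b) (k : nat) : 0 <= q -> q ^+ 4 = b%:R ->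
  `|S h k%:R| <= 2 * (gcdn k b)%:R * (tau b)%:R * q ^+ 3.
Proof.
move=> q0 qb.
have := kloosterman_bound eD enorm esum h k%:R.
set s := `|_|; set g := gcdn k b.
have -> : #|[set u : 'Z_b | u \in GRing.unit]| = totient b.
  rewrite -[in RHS]bE totient_count_coprime big_mkord cardsE -sum1_card big_mkcond /=.
  by apply: eq_bigr => u _; case: ifP => // uu; rewrite -[coprime _ _]/(u \in GRing.unit) uu.
rewrite card_ord [X in (X ^ 2)%N]bE => h1.
have s0 : 0 <= s by exact: normr_ge0.
have P1 : (nb_zero_mul ('Z_b : finComUnitRingType) <= b * tau b)%N.
  apply: leq_trans (sum_gcdn_le b1).
  rewrite big_mkord -(big_mkord predT (fun u => gcdn u b)) -bE big_mkord.
  by apply: leq_sum => u _; rewrite -{1}[u]natr_Zp [X in gcdn _ X]bE; exact: nb_ann_Zp.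
have N2 : (nb_ann (2%R : 'Z_b) <= 2)%N.
  apply: leq_trans (nb_ann_Zp b1 2) _; apply: dvdn_leq => //; exact: dvdn_gcdl.
have h2 : s ^+ 4 * b%:R <= (2 * g * b ^ 4 * tau b ^ 3)%:R.
  apply: (@le_trans _ _ (s ^+ 4 * (totient b * tau b)%:R)).
    by rewrite ler_wpM2l ?exprn_ge0 // ler_nat leq_totient_tau.
  rewrite natrM mulrA; apply: le_trans (ler_wpM2r (ler0n _ (tau b)) h1) _.
  rewrite -natrM ler_nat.
  have L1 := nb_ann_Zp b1 k.
  have L2 : (nb_zero_mul ('Z_b : finComUnitRingType) ^ 2 <= (b * tau b) ^ 2)%N by rewrite leq_exp2r.
  apply: (@leq_trans (g * (b ^ 2 * (2 * (b * tau b) ^ 2)) * tau b)%N).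
    by rewrite leq_mul2r; apply/orP; right; apply: leq_mul => //; apply: leq_mul => //; apply: leq_mul.
  by apply: eq_leq; rewrite !expnS !expn0; lia.
have bp : 0 < b%:R :> C by rewrite ltr0n.
have g1 : (0 < g)%N by rewrite gcdn_gt0 b0 orbT.
have t1 : (0 < tau b)%N.
  by have := leq_totient_tau b0; case: (tau b) => //; rewrite muln0; move: b0; case: (b).
have h3 : s ^+ 4 <= (2 * g%:R * (tau b)%:R * q ^+ 3) ^+ 4.
  rewrite -(ler_pM2r bp); apply: le_trans h2 _.
  have -> : (2 * g%:R * (tau b)%:R * q ^+ 3) ^+ 4 * b%:R =
     (16 * g ^ 4 * tau b ^ 4)%:R * (q ^+ 4) ^+ 3 * b%:R.
    by rewrite !natrM; ring.
  rewrite qb -natrX -!natrM ler_nat.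
  have -> : (16 * g ^ 4 * tau b ^ 4 * b ^ 3 * b = 2 * g * b ^ 4 * tau b ^ 3 * (8 * g ^ 3 * tau b))%N.
    by rewrite !expnS !expn0; lia.
  by rewrite leq_pmulr // !muln_gt0 ?expn_gt0 g1 t1.
by rewrite -(@ler_pXn2r _ 4) // nnegrE // !mulr_ge0 // exprn_ge0.
Qed.

(** The points of the modular hyperbola in a box; the side [D] is not limited by [b], since it will
    bound denominators larger than [b]. *)
Definition box_count (D v : nat) : nat :=
  (\sum_(0 <= d < D) \sum_(1 <= a < v.+1) (a * d == 1 %[mod b]))%N.

Definition coprime_count (D : nat) : nat := (\sum_(0 <= d < D) coprime d b)%N.

(** [A] and [B] are the Fourier coefficients of the two sides of the box. *)
Let A (D : nat) (h : 'Z_b) : C := \sum_(0 <= d < D) e (- h * d%:R).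
Let B (v : nat) (k : 'Z_b) : C := \sum_(1 <= a < v.+1) e (- k * a%:R).

Lemma Zp_indicator (x y : 'Z_b) :
  \sum_h e (h * (x - y)) = (b * (x == y))%:R.
Proof. by rewrite esum card_ord [X in (X * _)%N]bE subr_eq0. Qed.

Lemma unit_Zp_nat d : (d%:R : 'Z_b) \is a GRing.unit = coprime d b.
Proof.
by rewrite unitZpE // coprime_sym.
Qed.

Lemma eq_mod_Zp m n : (m%:R == n%:R :> 'Z_b) = (m == n %[mod b]).
Proof. by rewrite -val_eqE /= !val_Zp_nat. Qed.

(** Detecting [u = d] by the characters [h] and [u^-1 = a] by the characters [k] writes [b^2] times
    the count as the sum of all [B A S]. In the terms with [k = 0] the variable [a] is free, and
    they add up to the main term. *)
Lemma box_count_fourier (D v : nat) :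
  b%:R ^+ 2 * (box_count D v)%:R - v%:R * b%:R * (coprime_count D)%:R =
  \sum_(k | k != 0) B v k * \sum_h A D h * S h k.
Proof.
pose T k := B v k * \sum_h A D h * S h k.
have full : \sum_k T k = b%:R ^+ 2 * (box_count D v)%:R.
  have TE k : T k = \sum_(1 <= a < v.+1) \sum_(0 <= d < D) \sum_(u : 'Z_b | u \is a GRing.unit)
     e (k * (u^-1 - a%:R)) * \sum_h e (h * (u - d%:R)).
    rewrite /T mulr_suml; apply: eq_bigr => a _.
    rewrite mulr_sumr.
    under eq_bigr do rewrite /A /S /kloosterman mulr_suml mulr_sumr.
    rewrite exchange_big /=; apply: eq_bigr => d _.
    under [RHS]eq_bigr do rewrite mulr_sumr.
    rewrite exchange_big /=; apply: eq_bigr => h _.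
    rewrite mulrA mulr_sumr; apply: eq_bigr => u _.
    by rewrite -!eD; congr e; ring.
  under eq_bigr do rewrite TE.
  rewrite exchange_big /=.
  under eq_bigr do rewrite exchange_big /=.
  under eq_bigr do under eq_bigr do rewrite exchange_big /=.
  rewrite /box_count [X in _ = _ * X%:R]exchange_big_nat /= [X in _ = _ * X]natr_sum mulr_sumr.
  apply: eq_bigr => a _; rewrite natr_sum mulr_sumr; apply: eq_bigr => d _.
  under eq_bigr do rewrite -mulr_suml !Zp_indicator.
  have E : (a * d == 1 %[mod b])%N = (a%:R * d%:R == 1 :> 'Z_b).
    by rewrite -natrM -[1]/(1%:R) eq_mod_Zp.
  rewrite E; case: (boolP (_ == 1)) => [/eqP ad|ad].
    have du : (d%:R : 'Z_b) \is a GRing.unit by apply/unitrPr; exists a%:R; rewrite mulrC.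
    have dV : (d%:R : 'Z_b)^-1 = a%:R by apply: (mulIr du); rewrite mulVr.
    rewrite (bigD1 (d%:R : 'Z_b)) //= dV !eqxx !muln1 big1 ?addr0 ?mulr1 ?expr2 //.
    by move=> u /andP[_ /negbTE ->]; rewrite muln0 mulr0.
  rewrite mulr0 big1 // => u uu; have [ud|ud] := eqVneq u d%:R; last by rewrite muln0 mulr0.
  have [ua|ua] := eqVneq u^-1 a%:R; last by rewrite muln0 mul0r.
  by move: ad; rewrite -ua -ud mulVr ?eqxx.
have zero : T 0 = v%:R * b%:R * (coprime_count D)%:R.
  rewrite /T; have -> : B v 0 = v%:R.
    rewrite /B (eq_bigr (fun=> 1)) => [|a _]; last by rewrite oppr0 mul0r /e expr0.
    by rewrite sumr_const_nat subn1.
  rewrite -mulrA; congr (_ * _).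
  have E h : A D h * S h 0 = \sum_(0 <= d < D) \sum_(u : 'Z_b | u \is a GRing.unit)
      e (h * (u - d%:R)).
    rewrite /A mulr_suml; apply: eq_bigr => d _; rewrite mulr_sumr; apply: eq_bigr => u _.
    by rewrite -eD; congr e; ring.
  under eq_bigr do rewrite E.
  rewrite exchange_big /= natr_sum mulr_sumr; apply: eq_bigr => d _.
  rewrite exchange_big /=.
  under eq_bigr do rewrite Zp_indicator.
  rewrite -unit_Zp_nat; case: (boolP (_ \is a _)) => [du|du].
    rewrite (bigD1 (d%:R : 'Z_b)) //= eqxx muln1 big1 ?addr0 ?mulr1 //.
    by move=> u /andP[_ /negbTE ->]; rewrite muln0.
  rewrite mulr0 big1 // => u uu; case: eqVneq => [ud|]; last by rewrite muln0.
  by move: du; rewrite -ud uu.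
rewrite -full -zero; apply/eqP; rewrite subr_eq.
by rewrite [X in X == _](bigD1 (0 : 'Z_b)) //= addrC.
Qed.

Lemma sum_Zp_neq0 (F : nat -> C) :
  \sum_(k : 'Z_b | k != 0) F k = \sum_(1 <= k < b) F k.
Proof.
rewrite -(big_mkord (fun k => k != 0%N) F) [in LHS]bE big_ltn_cond //= big_nat_cond.
rewrite [RHS]big_nat_cond; apply: eq_bigl => k.
by case: k => //= k; rewrite andbT.
Qed.

Lemma A_le D (k : 'Z_b) : k != 0 -> `|A D k| <= b%:R / k%:R + b%:R / (b - k)%:R.
Proof.
move=> k0; have nk0 : - k != 0 by rewrite oppr_eq0.
have kb : (k < b)%N by have := ltn_ord k; rewrite [X in (_ < X)%N -> _]bE.
have kp : (0 < k)%N by rewrite lt0n; apply: contra k0 => /eqP h; apply/eqP/val_inj.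
have nk : nat_of_ord (- k) = (b - k)%N.
  by rewrite /= [X in (_ %% X)%N]bE [X in (X - _)%N]bE modn_small // ltn_subrL kp b0.
by have := e_geo D nk0; rewrite nk subKn 1?ltnW // addrC.
Qed.

Lemma B_le v (k : 'Z_b) : k != 0 -> `|B v k| <= b%:R / k%:R + b%:R / (b - k)%:R.
Proof.
move=> k0; apply: le_trans (A_le v k0).
(* Starting the range at 1 instead of 0 costs a factor of modulus 1. *)
rewrite /B big_add1 /= (eq_bigr (fun a => e (- k) * e (- k * a%:R))) => [|a _].
  by rewrite -mulr_sumr normrM enorm mul1r.
by rewrite -eD; congr e; rewrite -[a.+1]addn1 natrD mulrDr mulr1 addrC.
Qed.

(** The gcd of the Kloosterman bound depends on [k] alone and is absorbed into the sum of the
    [B v k]. The frequency [h = 0] contributes [D] to the sum of the [A D h], which is the origin of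
    [D / b]. *)
Lemma box_count_bound (q : C) (D v : nat) : 0 <= q -> q ^+ 4 = b%:R ->
  `|(box_count D v)%:R - v%:R / b%:R * (coprime_count D)%:R| <=
  4 * (tau b)%:R ^+ 2 * harm * (D%:R / b%:R + 2 * harm) * q ^+ 3.
Proof.
move=> q0 qb.
have bp : 0 < b%:R :> C by rewrite ltr0n.
have bn0 : b%:R != 0 :> C by rewrite gt_eqF.
have sym (F : nat -> C) : \sum_(1 <= k < b) F (b - k)%N / (b - k)%:R =
    \sum_(1 <= k < b) F k / k%:R.
  by rewrite [RHS]big_nat_rev.
have drop0 (F : nat -> C) : \sum_(1 <= k < b) F k / k%:R = \sum_(0 <= k < b) F k / k%:R.
  by rewrite [RHS]big_ltn // invr0 mulr0 add0r.
have hB : \sum_(k : 'Z_b | k != 0) `|B v k| * (gcdn k b)%:R <= 2 * b%:R * (tau b)%:R * harm.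
  apply: (@le_trans _ _ (\sum_(k : 'Z_b | k != 0)
      (b%:R / k%:R + b%:R / (b - k)%:R) * (gcdn k b)%:R)).
    by apply: ler_sum => k k0; apply: ler_wpM2r => //; exact: B_le.
  rewrite (sum_Zp_neq0 (fun k => (b%:R / k%:R + b%:R / (b - k)%:R) * (gcdn k b)%:R)).
  have -> : \sum_(1 <= k < b) (b%:R / k%:R + b%:R / (b - k)%:R) * (gcdn k b)%:R =
    b%:R * (\sum_(1 <= k < b) (gcdn k b)%:R / k%:R + \sum_(1 <= k < b) (gcdn (b - k) b)%:R / (b - k)%:R) :> C.
    rewrite -big_split mulr_sumr big_nat [RHS]big_nat; apply: eq_bigr => k /andP[k0 kb] /=.
    rewrite gcdn_subl ?(ltnW kb) //.
    by ring.
  rewrite (sym (fun k => (gcdn k b)%:R)) drop0.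
  have := sum_gcdn_div_le; set s := \sum_(_ <= _ < _) _ => hs.
  have -> : b%:R * (s + s) = 2 * b%:R * s by ring.
  by rewrite -[leRHS]mulrA ler_wpM2l // mulr_ge0.
have hA : \sum_h `|A D h| <= D%:R + 2 * b%:R * harm.
  rewrite (bigD1 (0 : 'Z_b)) //= lerD //.
    rewrite /A (eq_bigr (fun=> 1)) => [|a _]; last by rewrite oppr0 mul0r /e expr0.
    by rewrite sumr_const_nat subn0 normr_nat.
  apply: (@le_trans _ _ (\sum_(k : 'Z_b | k != 0) (b%:R / k%:R + b%:R / (b - k)%:R))).
    by apply: ler_sum => k k0; exact: A_le.
  rewrite (sum_Zp_neq0 (fun k => (b%:R / k%:R + b%:R / (b - k)%:R))).
  rewrite big_split /= (sym (fun=> b%:R)) drop0 /harm.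
  by rewrite -mulr_sumr -mulrA [X in _ <= X]mulr_natl mulr2n.
have key : `|b%:R ^+ 2 * (box_count D v)%:R - v%:R * b%:R * (coprime_count D)%:R| <=
    (2 * b%:R * (tau b)%:R * harm) * ((D%:R + 2 * b%:R * harm) * (2 * (tau b)%:R * q ^+ 3)).
  rewrite box_count_fourier.
  apply: (@le_trans _ _ (\sum_(k : 'Z_b | k != 0) (`|B v k| * (gcdn k b)%:R) *
      ((D%:R + 2 * b%:R * harm) * (2 * (tau b)%:R * q ^+ 3)))).
    apply: le_trans (ler_norm_sum _ _ _) _; apply: ler_sum => k k0.
    rewrite normrM -mulrA ler_wpM2l //.
    apply: le_trans (ler_norm_sum _ _ _) _.
    apply: (@le_trans _ _ (\sum_h `|A D h| * ((gcdn k b)%:R * (2 * (tau b)%:R * q ^+ 3)))).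
      apply: ler_sum => h _; rewrite normrM ler_wpM2l //.
      have := kloosterman_Zp_bound h k q0 qb.
      by rewrite natr_Zp => /le_trans; apply; rewrite le_eqVlt; apply/orP; left; apply/eqP; ring.
    rewrite -mulr_suml [leRHS]mulrCA; apply: ler_wpM2r; last exact: hA.
    by do ![apply: mulr_ge0 => //]; exact: exprn_ge0.
  rewrite -mulr_suml; apply: ler_wpM2r; last exact: hB.
  apply: mulr_ge0; last by apply: mulr_ge0; [exact: mulr_ge0|exact: exprn_ge0].
  by apply: addr_ge0 => //; apply: mulr_ge0 => //; exact: mulr_ge0.
have -> : (box_count D v)%:R - v%:R / b%:R * (coprime_count D)%:R =
  (b%:R ^+ 2 * (box_count D v)%:R - v%:R * b%:R * (coprime_count D)%:R) / b%:R ^+ 2 :> C.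
  by field.
rewrite normrM normfV normrX normr_nat ler_pdivrMr ?exprn_gt0 //.
apply: le_trans key _; rewrite le_eqVlt; apply/orP; left; apply/eqP; by field.
Qed.

End Box.

From mathcomp Require Import complex finmap.
From mathcomp Require Import all_classical all_reals all_analysis measurable_realfun.
From mathcomp Require analysis.showcase.summability.
Import numFieldNormedType.Exports.

Local Open Scope classical_set_scope.
Local Open Scope ring_scope.
Local Open Scope complex_scope.

(** * Separation of the roots of unity from 1 *)

Lemma ler_of_derive (R : realType) (f df : R -> R) (a b : R) : a <= b ->
  (forall x, a <= x <= b -> is_derive x 1 f (df x)) ->
  (forall x, a <= x <= b -> 0 <= df x) -> f a <= f b.
Proof.
move=> ab fdf df0.
have [||c /= hc E] := @MVT_segment R f df a b ab.
- by move=> x; rewrite in_itv /= => /andP[h1 h2]; apply: fdf; rewrite !ltW.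
- apply: derivable_within_continuous => x; rewrite in_itv /= => hx.
  by have := fdf x hx => -[].
- rewrite -subr_ge0 E mulr_ge0 ?subr_ge0 //; apply: df0.
  by move: hc; rewrite in_itv.
Qed.

Lemma mulr_cos_le_sin (R : realType) (x : R) : 0 <= x <= pi -> x * cos x <= sin x.
Proof.
move=> /andP[x0 xpi].
rewrite -subr_ge0.
have := @ler_of_derive R (fun y => sin y - y * cos y) (fun y => y * sin y) 0 x x0.
rewrite sin0 mul0r subr0; apply => y /andP[y0 yx].
  have -> : y * sin y = cos y - (y * (- sin y) + cos y * 1) by ring.
  by apply: is_deriveB.
by rewrite mulr_ge0 // sin_ge0_pi // y0 (le_trans yx).
Qed.

(** With [y = x/2]: [sin x = 2 sin y cos y >= 2 y cos(y)^2 >= y], the last step because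
    [2 cos(y)^2 - 1 = cos x >= 0]. *)
Lemma half_le_sin (R : realType) (x : R) : 0 <= x <= pi / 2 -> x / 2 <= sin x.
Proof.
move=> /andP[x0 xpi].
have ppos := @pi_gt0 R.
pose y := x / 2.
have y0 : 0 <= y by rewrite divr_ge0.
have ypi : y <= pi / 4 by rewrite /y; lra.
have xE : x = y *+ 2 by rewrite /y -mulr_natr; field.
have h1 : y * cos y <= sin y by apply: mulr_cos_le_sin; rewrite y0 /=; lra.
have c0 : 0 <= cos y by apply: cos_ge0_pihalf; lra.
have hc : 0 <= cos x by apply: cos_ge0_pihalf; lra.
have : 0 <= cos y ^+ 2 *+ 2 - 1 by rewrite -cos_mulr2n -xE.
rewrite {2}xE sin_mulr2n -mulr_natr -/y => h2.
rewrite -mulr_natr; nra.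
Qed.

Section RootOfUnity.
Variables (R : realType) (b : nat).

Let th : R := 2 * pi / b%:R.
Definition unity_root : R[i] := cos th +i* sin th.

Lemma unity_rootX n : unity_root ^+ n = cos (n%:R * th) +i* sin (n%:R * th).
Proof.
elim: n => [|n IH]; first by rewrite expr0 mul0r cos0 sin0.
rewrite exprS IH -[n.+1]add1n natrD mulrDl mul1r cosD sinD.
by rewrite /unity_root; simpc; congr (_ +i* _); ring.
Qed.

Lemma unity_root_order : (0 < b)%N -> unity_root ^+ b = 1.
Proof.
move=> b0; rewrite unity_rootX /th mulrC divfK ?pnatr_eq0 -?lt0n //.
by rewrite mulr_natl cos2pi sin2pi.
Qed.

(** The modulus is [2 sin x] with [x = pi h / b]. According to which of [0] and [pi] is nearer to
    [x], one of the two summands suffices, and [half_le_sin] reduces the claim to [pi >= 2]. *)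
Lemma unity_root_sep h : (0 < h < b)%N ->
  2 <= `|unity_root ^+ h - 1| * (b%:R / h%:R + b%:R / (b - h)%:R).
Proof.
move=> /andP[h0 hb].
have b0 : 0 < b%:R :> R by rewrite ltr0n; lia.
have ppos := @pi_gt0 R. have p2 := @pi_ge2 R.
pose x : R := pi * h%:R / b%:R.
have hp : 0 < h%:R :> R by rewrite ltr0n.
have hbR : h%:R < b%:R :> R by rewrite ltr_nat.
have hx : h%:R * th = x *+ 2 by rewrite /th /x -mulr_natr; ring.
have xpos : 0 < x by rewrite /x divr_gt0 // mulr_gt0.
have xpi : x < pi by rewrite /x ltr_pdivrMr // ltr_pM2l.
have sx : 0 <= sin x by apply: sin_ge0_pi; rewrite !ltW.
have nE : `|unity_root ^+ h - 1| = (2 * sin x)%:C.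
  rewrite unity_rootX hx normc_def /=; congr (_ %:C).
  rewrite subr0 cos_mulr2n sin_mulr2n.
  have -> : (cos x ^+ 2 *+ 2 - 1 - 1) ^+ 2 + ((cos x * sin x) *+ 2) ^+ 2 = (2 * sin x) ^+ 2.
    rewrite !mulr2n.
    have -> : (cos x ^+ 2 + cos x ^+ 2 - 1 - 1) ^+ 2 + (cos x * sin x + cos x * sin x) ^+ 2 =
      (cos x ^+ 2 + cos x ^+ 2 - 1 - 1) ^+ 2 + 4 * cos x ^+ 2 * sin x ^+ 2 by ring.
    by rewrite cos2sin2; ring.
  by rewrite sqrtr_sqr ger0_norm // mulr_ge0.
have cE (n : nat) : n%:R = (n%:R : R)%:C by rewrite rmorph_nat.
rewrite nE !cE -!fmorphV -!rmorphM -rmorphD -rmorphM /= lecR.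
have bhp : 0 < (b - h)%:R :> R by rewrite ltr0n subn_gt0.
have bhE : (b - h)%:R = b%:R - h%:R :> R by rewrite natrB // ltnW.
have [xle|xgt] := leP x (pi / 2).
  have := @half_le_sin R x; rewrite (ltW xpos) xle => /(_ isT) hs.
  apply: (@le_trans _ _ (2 * sin x * (b%:R / h%:R))); last first.
    by rewrite ler_wpM2l ?mulr_ge0 // lerDl divr_ge0 // ltW.
  apply: (@le_trans _ _ (x * (b%:R / h%:R))); last first.
    apply: ler_wpM2r; first by rewrite divr_ge0 // ltW.
    by rewrite -ler_pdivrMl // mulrC.
  have -> : x * (b%:R / h%:R) = pi by rewrite /x; field; rewrite !gt_eqF.
  by [].
have := @half_le_sin R (pi - x); rewrite sinB sinpi cospi mul0r sub0r mulN1r opprK.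
have -> : 0 <= pi - x <= pi / 2 by lra.
move=> /(_ isT) hs.
apply: (@le_trans _ _ (2 * sin x * (b%:R / (b - h)%:R))); last first.
  by rewrite ler_wpM2l ?mulr_ge0 // lerDr divr_ge0 // ltW.
apply: (@le_trans _ _ ((pi - x) * (b%:R / (b - h)%:R))); last first.
  apply: ler_wpM2r; first by rewrite divr_ge0 // ltW.
  by rewrite -ler_pdivrMl // mulrC.
have -> : (pi - x) * (b%:R / (b - h)%:R) = pi.
  rewrite /x bhE; field; rewrite !gt_eqF //; lra.
by [].
Qed.
End RootOfUnity.

(** * The box discrepancy with real exponents *)

Lemma onePln_le (R : realType) (e x : R) : 0 < e -> 1 <= x -> 1 + ln x <= (1 + e^-1) * x `^ e.
Proof.
move=> e0 x1; have x0 : 0 < x by lra.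
have p1 : 1 <= x `^ e.
  by rewrite -(powRr0 x); apply: ler_powR => //; rewrite ltW.
have h : e * ln x <= x `^ e by rewrite -ln_powR ltW // ln_sublinear // powR_gt0.
have : ln x <= e^-1 * x `^ e by rewrite mulrC ler_pdivlMr // mulrC.
lra.
Qed.

Lemma harm_le (R : realType) (b : nat) :
  \sum_(0 <= i < b.+2) i%:R^-1 <= 1 + ln b.+1%:R :> R.
Proof.
elim: b => [|b IH].
  by rewrite big_nat_recr //= big_nat1 invr0 add0r invr1 ln1 addr0.
rewrite big_nat_recr //=; apply: le_trans (lerD IH (lexx _)) _.
rewrite -addrA lerD2l.
have p2 : 0 < b.+1%:R :> R by rewrite ltr0n.
have p3 : 0 < b.+2%:R :> R by rewrite ltr0n.
have bE : b.+2%:R = b.+1%:R + 1 :> R by rewrite -natr1.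
have E : ln b.+1%:R - ln b.+2%:R = ln (1 + - b.+2%:R^-1) :> R.
  rewrite -ln_div ?posrE //; congr ln.
  by rewrite bE; field; lra.
have := @le_ln1Dx R (- b.+2%:R^-1); rewrite -E ltrN2 invf_lt1 // ltr1n => /(_ isT).
by rewrite lerBlDr [X in _ <= X -> _]addrC lerBrDr.
Qed.

(** The [j]-th root of [tau_bound], for an integer [j >= 1/e]. *)
Lemma tau_le (R : realType) (e : R) : 0 < e ->
  exists2 K : R, 0 < K & forall b, (0 < b)%N -> (tau b)%:R <= K * b%:R `^ e.
Proof.
move=> e0.
have [j je] : exists j : nat, e^-1 <= j.+1%:R.
  exists (Num.trunc e^-1); rewrite ltW //; exact: truncnS_gt.
have [C HC] := tau_bound j.+1.
have C0 : (0 < C)%N.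
  by have := HC 1%N isT; rewrite /tau /= exp1n muln1.
exists (C%:R `^ (j.+1%:R^-1)); first by rewrite powR_gt0 // ltr0n.
move=> b b0.
have bR : 1 <= b%:R :> R by rewrite ler1n.
have h : (tau b)%:R ^+ j.+1 <= C%:R * b%:R :> R by rewrite -natrX -natrM ler_nat HC.
have j0 : j.+1%:R != 0 :> R by rewrite pnatr_eq0.
have -> : (tau b)%:R = ((tau b)%:R ^+ j.+1) `^ (j.+1%:R^-1) :> R.
  by rewrite -powR_mulrn // -powRrM divff // powRr1.
apply: (@le_trans _ _ ((C%:R * b%:R) `^ (j.+1%:R^-1))).
  by apply: ge0_ler_powR; rewrite ?nnegrE ?invr_ge0 ?exprn_ge0 // mulr_ge0.
rewrite powRM // ler_wpM2l ?powR_ge0 // ler_powR //.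
by rewrite invf_ple ?posrE // ltr0n.
Qed.

(* The exponent [4/5] absorbs the divisor and logarithmic factors of the
   exponent [3/4] given by the fourth moment of Kloosterman sums. *)
Lemma box_discrepancy (R : realType) : exists2 K : R, 0 < K &
  forall b D v, (0 < b)%N ->
  `|(box_count b D v)%:R - v%:R / b%:R * (coprime_count b D)%:R|
    <= K * (D%:R / b%:R + 1) * b%:R `^ (4 / 5).
Proof.
(* Two divisor factors and two logarithms, each of order at most [b^(1/80)], make up the gap
   [4/5 - 3/4 = 4/80]. *)
have [K K0 HK] := @tau_le R (80%:R^-1) (ltac:(by rewrite invr_gt0)).
exists (8 * K ^+ 2 * 82 ^+ 2); first by rewrite !mulr_gt0 // exprn_gt0.
move=> b D v b0.
have bR : 1 <= b%:R :> R by rewrite ler1n.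
have b'0 : 0 < b%:R :> R by rewrite ltr0n.
(* Modulo 1 every pair is a solution and the discrepancy is zero; the Fourier argument is for
   [b > 1]. *)
have [b1|b1] := leqP b 1%N.
  have -> : b = 1%N by apply/eqP; rewrite eqn_leq b1.
  rewrite powR1 divr1 mulr1.
  have -> : box_count 1 D v = (D * v)%N.
    rewrite /box_count (eq_bigr (fun=> v)) => [|d _]; first by rewrite sum_nat_const_nat subn0.
    rewrite (eq_bigr (fun=> 1%N)) => [|a _]; last by rewrite !modn1.
    by rewrite sum_nat_const_nat subn1 muln1.
  have -> : coprime_count 1 D = D.
    rewrite /coprime_count (eq_bigr (fun=> 1%N)) => [|d _]; last by rewrite coprimen1.
    by rewrite sum_nat_const_nat subn0 muln1.
  rewrite natrM divr1 mulrC subrr normr0 !mulr_ge0 ?exprn_ge0 ?(ltW K0) //.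
set q : R := b%:R `^ (4%:R^-1).
have q0 : 0 <= q by exact: powR_ge0.
have qb : q ^+ 4 = b%:R by rewrite -powR_mulrn // -powRrM mulVf ?powRr1.
have cE (n : nat) : n%:R = (n%:R : R)%:C by rewrite rmorph_nat.
pose H : R := \sum_(0 <= i < b) i%:R^-1.
have HE : harm R[i] b = H%:C.
  rewrite /harm /H rmorph_sum /=; apply: eq_bigr => i _.
  by rewrite fmorphV /= -cE.
have := @box_count_bound R[i] b (unity_root R b) b1 (unity_root_order R b0)
  (@unity_root_sep R b) q%:C D v.
have -> : (0 <= q%:C) = true by rewrite lecR.
have -> : q%:C ^+ 4 = b%:R by rewrite -rmorphXn qb rmorph_nat.
move=> /(_ isT erefl).
have nC (r : R) : `|r%:C| = `|r|%:C by rewrite normc_def /= expr0n addr0 sqrtr_sqr.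
rewrite HE.
have -> : (box_count b D v)%:R - v%:R / b%:R * (coprime_count b D)%:R =
   ((box_count b D v)%:R - v%:R / b%:R * (coprime_count b D)%:R : R)%:C.
  by rewrite !(rmorphB, rmorphM, fmorphV, rmorph_nat).
have -> : 4 * (tau b)%:R ^+ 2 * H%:C * (D%:R / b%:R + 2 * H%:C) * q%:C ^+ 3 =
   (4 * (tau b)%:R ^+ 2 * H * (D%:R / b%:R + 2 * H) * q ^+ 3)%:C.
  by rewrite !(rmorphD, rmorphM, rmorphXn, fmorphV, rmorph_nat).
rewrite nC lecR.
move=> /le_trans; apply.
(* [82 = 1 + (1 + 80)]: [onePln_le] with [e = 1/80], and one more unit. *)
have Hb : 1 + H <= 82 * b%:R `^ (80%:R^-1).
  apply: (@le_trans _ _ (1 + (1 + ln b%:R))).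
    rewrite lerD2l /H; case: (b) b1 => [|[|n]] // _; apply: le_trans (harm_le R n) _.
    by rewrite lerD2l ler_ln ?posrE ?ltr0n // ler_nat.
  have := @onePln_le R (80%:R^-1) b%:R (ltac:(by rewrite invr_gt0)) bR.
  rewrite invrK; have : 1 <= b%:R `^ (80%:R^-1) :> R.
    by rewrite -[leLHS](powRr0 b%:R); apply: ler_powR => //; rewrite invr_ge0.
  lra.
have H0 : 0 <= H by apply: sumr_ge0 => i _; rewrite invr_ge0.
set p : R := b%:R `^ (80%:R^-1) in Hb.
have p0 : 0 <= p by exact: powR_ge0.
have HKb := HK b b0; rewrite -/p in HKb.
have t0 : 0 <= (tau b)%:R :> R by [].
have -> : b%:R `^ (4 / 5) = p ^+ 4 * q ^+ 3 :> R.
  rewrite -!powR_mulrn ?powR_ge0 // -!powRrM -powRD; last by rewrite gt_eqF ?implybT.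
  by congr (_ `^ _); field.
set x := D%:R / b%:R; have x0 : 0 <= x by rewrite divr_ge0.
have -> : 8 * K ^+ 2 * 82 ^+ 2 * (x + 1) * (p ^+ 4 * q ^+ 3) =
   8 * (K * p) ^+ 2 * (82 * p) ^+ 2 * (x + 1) * q ^+ 3 by ring.
apply: ler_wpM2r; first exact: exprn_ge0.
apply: (@le_trans _ _ (8 * (tau b)%:R ^+ 2 * (1 + H) ^+ 2 * (x + 1))).
  set t := (tau b)%:R ^+ 2; have tt : 0 <= t by exact: exprn_ge0.
  have -> : 4 * t * H * (x + 2 * H) = t * (4 * H * (x + 2 * H)) by ring.
  have -> : 8 * t * (1 + H) ^+ 2 * (x + 1) = t * (8 * (1 + H) ^+ 2 * (x + 1)) by ring.
  apply: ler_wpM2l => //.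
  have h1 : 0 <= H * x by exact: mulr_ge0.
  have h2 : 0 <= H ^+ 2 * x by rewrite mulr_ge0 ?exprn_ge0.
  nra.
apply: ler_wpM2r; first by rewrite addr_ge0.
have T1 : (tau b)%:R ^+ 2 <= (K * p) ^+ 2 by rewrite lerXn2r ?nnegrE // mulr_ge0 // ltW.
have T2 : (1 + H) ^+ 2 <= (82 * p) ^+ 2 by rewrite lerXn2r ?nnegrE ?mulr_ge0 // addr_ge0.
by apply: ler_pM => //; rewrite ?mulr_ge0 ?exprn_ge0 ?addr_ge0 // ler_wpM2l.
Qed.

(** * Riesz weights *)

(** Stated over any [numFieldType], because it serves both for real derivatives of the weight and
    for complex derivatives of Laplace transforms. *)
Lemma is_derive_quadratic (K : numFieldType) (f : K^o -> K^o) (x l M e : K) :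
  0 < e -> 0 <= M ->
  (forall h, `|h| < e -> `|f (h + x) - f x - h * l| <= M * `|h| ^+ 2) ->
  is_derive (x : K^o) 1 f l.
Proof.
move=> e0 M0 H.
have cv : (fun h => h^-1 *: (f (h *: (1 : K^o) + x) - f x)) @ 0^' --> (l : K^o).
  apply/cvgrPdist_le => eps eps0.
  near=> h.
  have h0 : h != 0 by near: h; exact: nbhs_dnbhs_neq.
  have he : `|h| < e by near: h; apply: dnbhs0_lt.
  have hM : `|h| <= eps / (M + 1).
    by near: h; apply: dnbhs0_le; rewrite divr_gt0 // ltr_wpDl.
  have := H h he.
  rewrite [h *: _]mulr1 => Hh.
  have -> : l - h^-1 *: (f (h + x) - f x) = - (h^-1 * (f (h + x) - f x - h * l)).
    rewrite [h^-1 *: _]/(h^-1 * _); rewrite [in RHS]mulrBr mulKf //; by rewrite opprB.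
  rewrite normrN normrM normfV ler_pdivrMl ?normr_gt0 //.
  apply: le_trans Hh _; rewrite expr2 mulrCA ler_wpM2l //.
  apply: (@le_trans _ _ (M * (eps / (M + 1)))); first by rewrite ler_wpM2l.
  by rewrite mulrCA ler_piMr ?(ltW eps0) // ler_pdivrMr ?mul1r ?lerDl // ltr_wpDl.
apply: DeriveDef; first by apply/cvg_ex; exists l.
by rewrite /derive; apply: cvg_lim.
Unshelve. all: by end_near. Qed.

Section Weights.
Variable R : realType.
Implicit Types x z : R.

(** The square, rather than the first power, makes the weight continuously differentiable in [z];
    [mixed_riesz_le] rests on that. *)
Definition riesz (x z : R) : R := Num.max 0 (x - z) ^+ 2.

Lemma riesz0 x z : x <= z -> riesz x z = 0.
Proof. by move=> xz; rewrite /riesz max_l ?expr0n // subr_le0. Qed.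

Lemma riesz_ge0 x z : 0 <= riesz x z. Proof. exact: sqr_ge0. Qed.

Lemma riesz_le x z : 0 <= x -> 0 <= z -> riesz x z <= x ^+ 2.
Proof.
move=> x0 z0; rewrite /riesz lerXn2r ?nnegrE ?le_max ?lexx //.
by rewrite ge_max x0 /= lerBlDr lerDl.
Qed.

Lemma riesz_lip x z z' : 0 <= x -> 0 <= z -> 0 <= z' ->
  `|riesz x z - riesz x z'| <= 2 * x * `|z - z'|.
Proof.
move=> x0 z0 z'0; rewrite /riesz.
wlog: z z' z0 z'0 / z <= z' => [H|zz'].
  case/orP: (le_total z z') => zz'; first exact: H.
  by rewrite distrC [ `|z - z'|]distrC; exact: H.
rewrite [ `|z - z'|]ler0_norm ?subr_le0 // opprB.
case: (leP 0 (x - z)) => h1; case: (leP 0 (x - z')) => h2; rewrite ler_norml; nra.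
Qed.

Lemma riesz_quadratic x z h :
  `|riesz x (h + z) - riesz x z - h * (- 2 * Num.max 0 (x - z))| <= `|h| ^+ 2.
Proof.
rewrite real_normK ?num_real // /riesz.
case: (leP 0 (x - z)) => h1; case: (leP 0 (x - (h + z))) => h2;
  rewrite ler_norml; nra.
Qed.

(** The mean value theorem in [P] leaves the difference at [e1] and [e2] of [2 e max(0, x - c e)],
    and this function of [e] is Lipschitz with constant [2 x], since [e (x - c e)] has slope
    [x - 2 c e]. *)
Lemma mixed_riesz_le x (P1 P2 e1 e2 : R) : 0 <= x -> 0 <= P1 -> P1 <= P2 ->
  0 <= e1 -> 0 <= e2 ->
  `|riesz x (P1 * e1) - riesz x (P1 * e2) - (riesz x (P2 * e1) - riesz x (P2 * e2))|
   <= 2 * x * (P2 - P1) * `|e1 - e2|.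
Proof.
move=> x0 P10 P12 e10 e20.
have dr e (P : R) : is_derive (P : R^o) 1 (fun P => riesz x (P * e)) (- 2 * e * Num.max 0 (x - P * e)).
  apply: (@is_derive_quadratic R _ P _ (e ^+ 2) 1) => // [|h _]; first exact: sqr_ge0.
  have := riesz_quadratic x (P * e) (h * e).
  rewrite -mulrDl normrM exprMn [_ * `|e| ^+ 2]mulrC real_normK ?num_real //.
  have -> : h * (- 2 * e * Num.max 0 (x - P * e)) = h * e * (- 2 * Num.max 0 (x - P * e)) by ring.
  by [].
pose k (P : R) := riesz x (P * e1) - riesz x (P * e2).
pose dk (P : R) := - 2 * e1 * Num.max 0 (x - P * e1) - (- 2 * e2 * Num.max 0 (x - P * e2)).
have H1 : forall P, P \in `]P1, P2[ -> is_derive P 1 k (dk P).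
  by move=> P _; apply: is_deriveB; apply: dr.
have H2 : {within `[P1, P2], continuous k}.
  apply: derivable_within_continuous => P _.
  by apply: derivableB; [have [] := dr e1 P|have [] := dr e2 P].
have [c /= + E] := MVT_segment P12 H1 H2.
rewrite in_itv /= => /andP[c1 c2].
rewrite -/(k P1) -/(k P2) distrC E normrM [ `|P2 - P1|]ger0_norm ?subr_ge0 //.
rewrite mulrAC; apply: ler_wpM2r; first by rewrite subr_ge0.
have c0 : 0 <= c by apply: le_trans c1.
rewrite /dk.
wlog: e1 e2 e10 e20 {k dk E H1 H2} / e1 <= e2 => [H|e12].
  case/orP: (le_total e1 e2) => e12; first exact: H.
  by rewrite distrC [ `|e1 - e2|]distrC; exact: H.
rewrite [ `|e1 - e2|]ler0_norm ?subr_le0 // opprB.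
have m1 : c * e1 <= c * e2 by apply: ler_wpM2l.
have m0 : 0 <= c * e1 by apply: mulr_ge0.
have p2 : 0 <= c * e2 by apply: mulr_ge0.
have -> : - 2 * e1 * Num.max 0 (x - c * e1) - - 2 * e2 * Num.max 0 (x - c * e2) =
   2 * (e2 * Num.max 0 (x - c * e2) - e1 * Num.max 0 (x - c * e1)) by ring.
rewrite normrM ger0_norm // -mulrA ler_wpM2l //.
have d0 : 0 <= e2 - e1 by rewrite subr_ge0.
case: (leP 0 (x - c * e1)) => h1; case: (leP 0 (x - c * e2)) => h2.
- have -> : e2 * (x - c * e2) - e1 * (x - c * e1) = (x - c * e1 - c * e2) * (e2 - e1) by ring.
  rewrite normrM (ger0_norm d0) ler_wpM2r // ler_norml; lra.
- have -> : e2 * 0 - e1 * (x - c * e1) = - (e1 * (x - c * e1)) by ring.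
  rewrite normrN normrM (ger0_norm e10) (ger0_norm h1).
  apply: (@le_trans _ _ (e1 * (c * e2 - c * e1))); first by rewrite ler_wpM2l //; lra.
  have -> : e1 * (c * e2 - c * e1) = c * e1 * (e2 - e1) by ring.
  by rewrite ler_wpM2r //; lra.
- lra.
- by rewrite !mulr0 subrr normr0 mulr_ge0.
Qed.
End Weights.

(** * Sums of powers and partial summation *)

Section PowerSums.
Variable R : realType.

Lemma powRn_step (c : R) (n : nat) : 0 < c < 1 ->
  c * n.+1%:R `^ (c - 1) <= n.+1%:R `^ c - n%:R `^ c.
Proof.
move=> /andP[c0 c1].
(* At [n = 0] the mean value theorem would meet the singularity of the derivative; the claim there
   is just [c <= 1]. *)
case: n => [|n].
  rewrite mulr0n mulr1n !powR1 mulr1 powR0 ?gt_eqF //; lra.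
pose df (t : R) := c * t `^ (c - 1).
have n1 : n.+1%:R <= n.+2%:R :> R by rewrite ler_nat.
have pos (x : R) : n.+1%:R <= x -> 0 < x by move=> h; apply: lt_le_trans h; rewrite ltr0n.
have H1 : forall x : R, x \in `]n.+1%:R, n.+2%:R[ -> is_derive x 1 (fun t : R => t `^ c) (df x).
  move=> x; rewrite in_itv /= => /andP[/ltW/pos x0 _].
  have xin : x \in `]0, +oo[ by rewrite in_itv /= x0.
  apply: DeriveDef; first exact: derivable_powR.
  by rewrite -derive1E powR_derive1.
have H2 : {within `[n.+1%:R, n.+2%:R], continuous (fun t : R => t `^ c)}.
  apply: derivable_within_continuous => x; rewrite in_itv /= => /andP[/pos x0 _].
  by apply: derivable_powR; rewrite in_itv /= x0.
have [x /= + ->] := MVT_segment n1 H1 H2.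
rewrite in_itv /= => /andP[x1 x2].
have -> : n.+2%:R - n.+1%:R = 1 :> R by rewrite -natr1 addrAC subrr add0r.
rewrite mulr1 /df ler_wpM2l ?(ltW c0) //.
have -> : c - 1 = - (1 - c) by ring.
rewrite !powRN lef_pV2 ?posrE ?powR_gt0 ?ltr0n ?(pos x) //.
by apply: ge0_ler_powR => //; rewrite ?nnegrE ?subr_ge0 ?(ltW c1) ?(ltW (pos _ x1)).
Qed.

(** [powRn_step] telescopes. The cut-off [N] keeps the sum finite and leaves no trace in the
    bound. *)
Lemma sum_powRn_le (c Y : R) (N : nat) : 0 < c < 1 -> 0 <= Y ->
  \sum_(1 <= b < N | b%:R < Y) b%:R `^ (c - 1) <= c^-1 * Y `^ c.
Proof.
move=> c01 Y0; have /andP[c0 c1] := c01.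
have main n : \sum_(1 <= b < n.+1) b%:R `^ (c - 1) <= c^-1 * n%:R `^ c.
  elim: n => [|n IH]; first by rewrite big_geq // mulr_ge0 ?powR_ge0 // invr_ge0 ltW.
  rewrite big_nat_recr //=.
  have := powRn_step n c01; rewrite -ler_pdivlMl // mulrBr.
  rewrite lerBrDl => h; apply: le_trans h; rewrite lerD2r //.
elim: N => [|N IH]; first by rewrite big_geq // mulr_ge0 ?powR_ge0 // invr_ge0 ltW.
case: N IH => [|N] IH; first by rewrite big_geq // mulr_ge0 ?powR_ge0 // invr_ge0 ltW.
have [h|h] := ltP (N.+1%:R) Y; last first.
  by rewrite big_mkcond big_nat_recr //= ltNge h /= addr0 -big_mkcond.
apply: (@le_trans _ _ (\sum_(1 <= b < N.+2) b%:R `^ (c - 1))).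
  rewrite big_mkcond /=; apply: ler_sum => b _; case: ifP => // _; exact: powR_ge0.
apply: le_trans (main _) _; rewrite ler_wpM2l ?invr_ge0 ?(ltW c0) //.
by apply: ge0_ler_powR => //; rewrite ?nnegrE ?(ltW c0) ?(ltW h).
Qed.

Lemma card_lt_le (Y : R) (N : nat) : 0 <= Y ->
  \sum_(1 <= d < N | d%:R < Y) 1 <= Y.
Proof.
move=> Y0; elim: N => [|N IH]; first by rewrite big_geq.
case: N IH => [|N] IH; first by rewrite big_geq.
have [h|h] := ltP (N.+1%:R) Y; last first.
  by rewrite big_mkcond big_nat_recr //= ltNge h /= addr0 -big_mkcond.
apply: (@le_trans _ _ (\sum_(1 <= b < N.+2) 1)).
  by rewrite big_mkcond /=; apply: ler_sum => b _; case: ifP.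
by rewrite sumr_const_nat subn1 ltW.
Qed.

Lemma abel_sum (F g : nat -> R) (m n : nat) : (m <= n)%N ->
  \sum_(m <= i < n) (F i.+1 - F i) * g i =
  \sum_(m <= i < n) (F i.+1 - F m) * (g i - g i.+1) + (F n - F m) * g n.
Proof.
elim: n => [|n IH]; first by rewrite leqn0 => /eqP ->; rewrite !big_geq // subrr mul0r addr0.
rewrite leq_eqVlt => /orP[/eqP ->|mn]; first by rewrite !big_geq // subrr mul0r addr0.
by rewrite !big_nat_recr //= IH //; ring.
Qed.
End PowerSums.

(** * Equidistribution of the end points *)

Definition farey_poly (b d : nat) : nat := (b * d * (b + d))%N.

Definition is_inv_mod (b a d : nat) : bool := (a * d == 1 %[mod b])%N.

Lemma frac01 (R : realType) (a b : nat) : (0 < b)%N -> (a <= b)%N -> 0 <= (a%:R / b%:R : R) <= 1.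
Proof.
by move=> b0 ab; rewrite divr_ge0 //= ler_pdivrMr ?ltr0n // mul1r ler_nat.
Qed.

Lemma leq_farey_poly b d : (farey_poly b d <= farey_poly b d.+1)%N.
Proof. rewrite /farey_poly; nia. Qed.

Lemma farey_poly_step b d : (b < d)%N ->
  (farey_poly b d.+1 <= 4 * b * d + farey_poly b d)%N.
Proof. by rewrite /farey_poly => bd; nia. Qed.

(** A residue prime to [b] has exactly one inverse, and others have none. The representatives run
    from 1 to [b], as numerators do, so that [b = 1] has the inverse 1. *)
Lemma sum_is_inv_mod b d : (0 < b)%N ->
  (\sum_(1 <= a < b.+1) is_inv_mod b a d = coprime d b)%N.
Proof.
move=> b0; have [b1|b1] := leqP b 1%N.
  have -> : b = 1%N by lia.
  by rewrite big_nat1 /is_inv_mod !modn1 coprimen1.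
rewrite big_add1 /=.
have E a : is_inv_mod b a d = (a%:R * d%:R == 1 :> 'Z_b).
  by rewrite -natrM -[1]/(1%:R) eq_mod_Zp.
have bE : (Zp_trunc b).+2 = b by exact: Zp_cast.
have -> : (\sum_(0 <= i < b) is_inv_mod b i.+1 d = \sum_(0 <= i < b) is_inv_mod b i d)%N.
  have := big_nat_recr b 0 (fun i => is_inv_mod b i d : nat) (leq0n b) (op := addn) (idx := 0%N).
  rewrite big_nat_recl //= addnC.
  have -> : is_inv_mod b 0 d = is_inv_mod b b d by rewrite /is_inv_mod mul0n mod0n modnMr.
  by move/addIn.
have -> : (\sum_(0 <= i < b) is_inv_mod b i d = \sum_(i : 'Z_b) is_inv_mod b i d)%N.
  by rewrite -(big_mkord xpredT (fun i => is_inv_mod b i d : nat)) [in RHS]bE.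
rewrite -(unit_Zp_nat b1 d).
have E2 (i : 'Z_b) : is_inv_mod b i d = (i * d%:R == 1) by rewrite E natr_Zp.
rewrite (eq_bigr (fun i : 'Z_b => (i * d%:R == 1) : nat)) => [|i _]; last by rewrite E2.
case: (boolP (_ \is a _)) => du.
  rewrite (bigD1 (d%:R^-1 : 'Z_b)) //= mulVr // eqxx big1 // => i iV.
  case: eqP => // h; have iE : i = d%:R^-1 by apply: (mulIr du); rewrite mulVr.
  by rewrite iE eqxx in iV.
rewrite big1 // => i _; case: eqP => // h.
by move: du; rewrite (_ : d%:R \is a GRing.unit) //; apply/unitrPr; exists i; rewrite mulrC.
Qed.

Section Weighted.
Variables (R : realType) (eta : R -> R) (e0 L : R).
Hypothesis e0_gt0 : 0 < e0.
Hypothesis eta_ge : forall y : R, 0 <= y <= 1 -> e0 <= eta y.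
Hypothesis L_ge0 : 0 <= L.
Hypothesis eta_lip : forall y z : R, 0 <= y <= 1 -> 0 <= z <= 1 -> `|eta y - eta z| <= L * `|y - z|.

Let W x b (d a : nat) : R := riesz x ((farey_poly b d)%:R * eta (a%:R / b%:R)).

Lemma riesz_farey0 x b d y : 0 <= y <= 1 -> x <= b%:R * d%:R ^+ 2 * e0 ->
  riesz x ((farey_poly b d)%:R * eta y) = 0.
Proof.
move=> y01 hx; apply: riesz0; apply: le_trans hx _; apply: ler_pM; [by rewrite mulr_ge0 // exprn_ge0|exact: ltW| |exact: eta_ge].
rewrite -natrX -natrM ler_nat /farey_poly expnS expn1; nia.
Qed.

Variables (K : R).
Hypothesis K_ge0 : 0 <= K.
Hypothesis K_box : forall b D v, (0 < b)%N ->
  `|(box_count b D v)%:R - v%:R / b%:R * (coprime_count b D)%:R|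
    <= K * (D%:R / b%:R + 1) * b%:R `^ (4 / 5).

(** Partial summation in [a] and then in [d] pairs box discrepancies with mixed differences of the
    weight. There are no boundary terms: in [a] the discrepancy vanishes at [0] and at [b], in [d]
    the weight vanishes at the upper end. For [d] below [Dr] the discrepancy is [O((d/b) b^(4/5))]
    and the mixed difference [O(x L d)]; summing over [d], and over the [b] values of [a], gives the
    cube of [Dr]. *)
Lemma weighted_discrepancy x b N : (0 < b)%N -> 0 <= x -> x <= N%:R ^+ 2 * e0 ->
  `|\sum_(b.+1 <= d < N) (\sum_(1 <= a < b.+1) (is_inv_mod b a d)%:R * W x b d a
       - (coprime d b)%:R / b%:R * \sum_(1 <= a < b.+1) W x b d a)|
   <= 48 * K * L * x * b%:R `^ (4 / 5) * ((x / (b%:R * e0)) `^ (2^-1)) ^+ 3.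
Proof.
move=> b0 x0 xN.
have bp : 0 < b%:R :> R by rewrite ltr0n.
have bn0 : b%:R != 0 :> R by rewrite gt_eqF.
(* [e d v] is the discrepancy of the single column [d] up to height [v]; its sums [E D v] are the
   discrepancies of boxes. *)
pose e d v : R := \sum_(1 <= a < v.+1) (is_inv_mod b a d)%:R - v%:R / b%:R * (coprime d b)%:R.
pose E D v : R := \sum_(0 <= d < D) e d v.
have EE D v : E D v = (box_count b D v)%:R - v%:R / b%:R * (coprime_count b D)%:R.
  rewrite /E /e big_split /= sumrN -mulr_sumr /box_count /coprime_count !natr_sum.
  by congr (_ - _); apply: eq_bigr => d _; rewrite natr_sum.
have e_b d : e d b = 0.
  by rewrite /e -natr_sum sum_is_inv_mod // divff // mul1r subrr.
have E_b D : E D b = 0 by rewrite /E big1.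
have e_0 d : e d 0%N = 0 by rewrite /e big_geq // mul0r mul0r subr0.
have stepA d : \sum_(1 <= a < b.+1) (is_inv_mod b a d)%:R * W x b d a
       - (coprime d b)%:R / b%:R * \sum_(1 <= a < b.+1) W x b d a =
    \sum_(0 <= i < b) e d i.+1 * (W x b d i.+1 - W x b d i.+2).
  rewrite mulr_sumr -sumrB big_add1 /=.
  have := abel_sum (e d) (fun i => W x b d i.+1) (leq0n b).
  rewrite e_b e_0 subrr mul0r addr0.
  under [X in _ = X]eq_bigr do rewrite subr0.
  move=> <-; apply: eq_bigr => i _.
  by rewrite /e (@big_nat_recr _ _ _ i.+1) //= -[i.+1%:R]natr1; field.
under eq_bigr do rewrite stepA.
rewrite exchange_big /=.
have [Nb|bN] := leqP N b.+1.
  under eq_bigr do rewrite big_geq //.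
  by rewrite big1 // normr0 !mulr_ge0 ?exprn_ge0 ?powR_ge0.
pose Y i d := W x b d i.+1 - W x b d i.+2.
(* For [d >= Dr] one has [b d^2 e0 >= x], and the weight is zero. *)
set Dr := (x / (b%:R * e0)) `^ (2^-1).
have Dr0 : 0 <= Dr by exact: powR_ge0.
have Dr2 : Dr ^+ 2 = x / (b%:R * e0).
  rewrite -powR_mulrn // -powRrM mulVf // powRr1 //.
  by rewrite divr_ge0 // mulr_ge0 // ltW.
have Y0 i d : (i.+2 <= b)%N -> Dr <= d%:R -> Y i d = 0.
  move=> ib hd; rewrite /Y /W !riesz_farey0 ?subrr // ?frac01 // ?(ltnW ib) //;
    rewrite -mulrAC -ler_pdivrMl ?mulr_gt0 // mulrC -Dr2 lerXn2r // nnegrE //.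
have bE : 0 <= b%:R `^ (4 / 5) :> R by exact: powR_ge0.
have inner i : (i < b)%N -> `|\sum_(b.+1 <= d < N) e d i.+1 * Y i d| <=
    48 * K * L * x * b%:R `^ (4 / 5) * Dr ^+ 3 / b%:R.
  move=> ib.
  have RHS0 : 0 <= 48 * K * L * x * b%:R `^ (4 / 5) * Dr ^+ 3 / b%:R.
    by rewrite divr_ge0 ?mulr_ge0 ?exprn_ge0.
  have -> : \sum_(b.+1 <= d < N) e d i.+1 * Y i d =
     \sum_(b.+1 <= d < N) (E d.+1 i.+1 - E d i.+1) * Y i d.
    by apply: eq_bigr => d _; congr (_ * _); rewrite /E big_nat_recr //= [RHS]addrC addKr.
  move: ib; rewrite leq_eqVlt => /orP[/eqP ib|ib].
    by rewrite big1 ?normr0 // => d _; rewrite ib !E_b subrr mul0r.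
  rewrite (abel_sum (fun d => E d i.+1) (Y i) (ltnW bN)).
  have -> : Y i N = 0.
    have N1 : 1 <= b%:R :> R by rewrite ler1n.
    rewrite Y0 // -(@ler_pXn2r _ 2) ?nnegrE // Dr2 ler_pdivrMr ?mulr_gt0 //.
    apply: le_trans xN _; rewrite ler_wpM2l ?exprn_ge0 // ler_peMl // ltW //.
  rewrite mulr0 addr0.
  apply: le_trans (ler_norm_sum _ _ _) _.
  apply: (@le_trans _ _ (\sum_(1 <= d < N | d%:R < Dr) 48 * K * L * x * b%:R `^ (4 / 5) * Dr ^+ 2 / b%:R)).
    rewrite [leRHS](@big_cat_nat _ _ _ b.+1) ?(ltnW bN) //=.
    rewrite -[leLHS]add0r lerD //.
      by apply: sumr_ge0 => d _; rewrite divr_ge0 ?mulr_ge0 ?exprn_ge0.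
    rewrite [leRHS]big_mkcond /= big_nat_cond [leRHS]big_nat_cond.
    apply: ler_sum => d; rewrite andbT => /andP[bd dN].
    case: ltP => hd; last first.
      rewrite Y0 // Y0 ?subrr ?mulr0 ?normr0 //.
      by apply: le_trans hd _; rewrite ler_nat.
    have d1 : 1 <= d%:R :> R by rewrite ler1n (leq_ltn_trans (leq0n b)).
    have bdR : b%:R + 1 <= d%:R :> R by rewrite natr1 ler_nat.
    have h1 D : (D <= d.+1)%N -> `|E D i.+1| <= 3 * K * (d%:R / b%:R) * b%:R `^ (4 / 5).
      move=> Dd; rewrite EE; apply: le_trans (K_box D i.+1 b0) _.
      have DR : D%:R <= d%:R + 1 :> R by rewrite natr1 ler_nat.
      have hh : D%:R / b%:R + 1 <= 3 * (d%:R / b%:R) :> R.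
        have -> : D%:R / b%:R + 1 = (D%:R + b%:R) / b%:R :> R by field.
        by rewrite mulrA ler_wpM2r ?invr_ge0 //; lra.
      have -> : 3 * K * (d%:R / b%:R) = K * (3 * (d%:R / b%:R)) by ring.
      by rewrite ler_wpM2r // ler_wpM2l.
    have h2 : `|Y i d - Y i d.+1| <= 8 * x * L * d%:R.
      have i01 : 0 <= (i.+1%:R / b%:R : R) <= 1 by apply: frac01 => //; exact: ltnW.
      have i11 : 0 <= (i.+2%:R / b%:R : R) <= 1 by apply: frac01.
      have PP : (farey_poly b d)%:R <= (farey_poly b d.+1)%:R :> R by rewrite ler_nat leq_farey_poly.
      have eg y : 0 <= y <= 1 -> 0 <= eta y by move=> hy; rewrite (le_trans (ltW e0_gt0)) // eta_ge.
      have := mixed_riesz_le x0 (ler0n R _) PP (eg _ i01) (eg _ i11).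
      rewrite -/(W x b d i.+1) -/(W x b d i.+2) -/(W x b d.+1 i.+1) -/(W x b d.+1 i.+2).
      move=> /le_trans; apply.
      have := eta_lip i01 i11.
      have -> : `|i.+1%:R / b%:R - i.+2%:R / b%:R| = b%:R^-1 :> R.
        have -> : i.+1%:R / b%:R - i.+2%:R / b%:R = - b%:R^-1 :> R.
          by rewrite -[i.+2%:R]natr1; field.
        by rewrite normrN ger0_norm // invr_ge0.
      set de := `|_| => hde.
      have hP : (farey_poly b d.+1)%:R - (farey_poly b d)%:R <= 4 * b%:R * d%:R :> R.
        by rewrite lerBlDr -!natrM -natrD ler_nat farey_poly_step.
      apply: (@le_trans _ _ (2 * x * (4 * b%:R * d%:R) * (L / b%:R))).
        apply: ler_pM; [by rewrite !mulr_ge0 // subr_ge0|exact: normr_ge0| |exact: hde].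
        by apply: ler_wpM2l => //; rewrite mulr_ge0.
      by rewrite le_eqVlt; apply/orP; left; apply/eqP; field.
    rewrite normrM.
    apply: (@le_trans _ _ (6 * K * (d%:R / b%:R) * b%:R `^ (4 / 5) * (8 * x * L * d%:R))).
      apply: ler_pM => //.
      apply: le_trans (ler_normB _ _) _.
      have := lerD (h1 d.+1 (leqnn _)) (h1 b.+1 (ltnW bd)); lra.
    have -> : 6 * K * (d%:R / b%:R) * b%:R `^ (4 / 5) * (8 * x * L * d%:R) =
      48 * K * L * x * b%:R `^ (4 / 5) * d%:R ^+ 2 / b%:R by field.
    apply: ler_wpM2r; first by rewrite invr_ge0.
    apply: ler_wpM2l; first by rewrite !mulr_ge0.
    by rewrite lerXn2r ?nnegrE // ltW.
  rewrite (eq_bigr (fun d => (48 * K * L * x * b%:R `^ (4 / 5) * Dr ^+ 2 / b%:R) * 1)); last first.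
    by move=> d _; rewrite mulr1.
  rewrite -mulr_sumr; apply: le_trans (ler_wpM2l _ (card_lt_le N Dr0)) _.
    by rewrite divr_ge0 ?mulr_ge0 ?exprn_ge0.
  by rewrite le_eqVlt; apply/orP; left; apply/eqP; field.
apply: le_trans (ler_norm_sum _ _ _) _.
apply: (@le_trans _ _ (\sum_(0 <= i < b) 48 * K * L * x * b%:R `^ (4 / 5) * Dr ^+ 3 / b%:R)).
  rewrite big_nat [leRHS]big_nat; apply: ler_sum => i /andP[_ ib]; exact: inner.
by rewrite sumr_const_nat subn0 -[leLHS]mulr_natr divfK.
Qed.
End Weighted.

(** * Riemann sums on the unit interval *)

Section UnitIntegral.
Variable R : realType.
Notation mu := (@lebesgue_measure R).

Lemma continuous_itv_integrable (g : R -> R) (a b : R) :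
  continuous g -> mu.-integrable `[a, b] (EFin \o g).
Proof.
move=> cg; apply: continuous_compact_integrable; first exact: segment_compact.
exact: continuous_subspaceT.
Qed.

Lemma lipschitz_continuous (g : R -> R) (M : R) :
  (forall y z, `|g y - g z| <= M * `|y - z|) -> continuous g.
Proof.
move=> H y; apply/cvgrPdist_le => e e0.
have M0 : 0 <= M.
  by have := H 0 1; rewrite sub0r normrN normr1 mulr1; apply: le_trans.
near=> z.
apply: le_trans (H y z) _.
have h : `|y - z| <= e / (M + 1).
  near: z; apply: cvgr_dist_le; first exact: cvg_id.
  by rewrite divr_gt0 // ltr_wpDl.
apply: le_trans (ler_wpM2l M0 h) _.
by rewrite mulrCA ler_piMr ?(ltW e0) // ler_pdivrMr ?mul1r ?lerDl // ltr_wpDl.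
Unshelve. all: by end_near. Qed.

Lemma Rintegral_sum_seq (I : Type) (s : seq I) (F : I -> R -> R) (D : set R) :
  measurable D -> (forall i, mu.-integrable D (EFin \o F i)) ->
  mu.-integrable D (EFin \o (fun y => \sum_(i <- s) F i y)) /\
  \int[mu]_(y in D) (\sum_(i <- s) F i y) = \sum_(i <- s) \int[mu]_(y in D) F i y.
Proof.
move=> mD iF.
have itg t : mu.-integrable D (EFin \o (fun y => \sum_(i <- t) F i y)).
  have S : mu.-integrable D (fun y => (\sum_(i <- t) (F i y)%:E)%E).
    by apply: integrable_sum => // i _; exact: iF.
  by move: S; apply: eq_integrable => // y _; rewrite /= sumEFin.
split; first exact: itg.
elim: s => [|i s IH].
  under eq_Rintegral do rewrite big_nil.
  by rewrite big_nil Rintegral_cst // mul0r.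
under eq_Rintegral do rewrite big_cons.
by rewrite RintegralD // IH big_cons.
Qed.

Lemma norm_between (c e m z : R) :
  (c - e) * m <= z -> z <= (c + e) * m -> `|z - c * m| <= e * m.
Proof. by move=> h1 h2; rewrite ler_norml; lra. Qed.

Lemma norm_step (s i j g e f : R) :
  `|s - i| <= e -> `|j - i - g| <= f -> `|s + g - j| <= e + f.
Proof. by rewrite !ler_norml; lra. Qed.

Lemma Rintegral_near_cst (g : R -> R) (D : set R) (c e m : R) : measurable D ->
  mu D = m%:E -> mu.-integrable D (EFin \o g) ->
  (forall y, D y -> `|g y - c| <= e) ->
  `|\int[mu]_(y in D) g y - c * m| <= e * m.
Proof.
move=> mD muD ig H.
have icst k : mu.-integrable D (EFin \o (fun=> k : R)).
  apply/integrableP; split; first exact: measurable_cst.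
  by rewrite /= integral_cst // [X in (_ * X)%E]muD -EFinM ltry.
have cst k : \int[mu]_(y in D) k = k * m by rewrite Rintegral_cst // [X in fine X]muD.
have le1 : \int[mu]_(y in D) (c - e) <= \int[mu]_(y in D) g y.
  by apply: le_Rintegral => // y /H; rewrite ler_norml; lra.
have le2 : \int[mu]_(y in D) g y <= \int[mu]_(y in D) (c + e).
  by apply: le_Rintegral => // y /H; rewrite ler_norml; lra.
by rewrite !cst in le1 le2; exact: norm_between.
Qed.

(** On each cell of length [1/b] the function stays within [M/b] of its value at the right end
    point; the induction adds one cell at a time. *)
Lemma riemann_sum (g : R -> R) (M : R) (b : nat) : (0 < b)%N ->
  (forall y z, `|g y - g z| <= M * `|y - z|) ->
  `|b%:R^-1 * \sum_(1 <= a < b.+1) g (a%:R / b%:R) - \int[mu]_(y in `[0, 1]) g y| <= M / b%:R.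
Proof.
move=> b0 H; have bp : 0 < b%:R :> R by rewrite ltr0n.
have bn : b%:R != 0 :> R by rewrite gt_eqF.
have cg := lipschitz_continuous H.
have M0 : 0 <= M.
  by have := H 0 1; rewrite sub0r normrN normr1 mulr1; apply: le_trans.
suff S k : `|b%:R^-1 * \sum_(1 <= a < k.+1) g (a%:R / b%:R)
    - \int[mu]_(y in `[0, k%:R / b%:R]) g y| <= k%:R * (M / b%:R ^+ 2).
  have := S b; rewrite divff //.
  by have -> : b%:R * (M / b%:R ^+ 2) = M / b%:R by field.
elim: k => [|k IH].
  by rewrite big_geq // !mul0r mulr0 set_itv1 Rintegral_set1 subrr normr0.
have kk : k%:R / b%:R <= k.+1%:R / b%:R :> R by rewrite ler_pM2r ?invr_gt0 // ler_nat.
have := @Rintegral_itvB R g (BLeft 0) (BRight (k.+1%:R / b%:R)) (k%:R / b%:R)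
  (continuous_itv_integrable _ _ cg).
rewrite !bnd_simp divr_ge0 // kk => /(_ isT isT) E.
have muE : mu `](k%:R / b%:R), (k.+1%:R / b%:R)] = (b%:R^-1)%:E.
  rewrite lebesgue_measure_itv /= lte_fin ltr_pM2r ?invr_gt0 // ltr_nat ltnSn.
  by rewrite -EFinD; congr (_%:E); rewrite -[k.+1%:R]natr1; field.
have := @Rintegral_near_cst g _ (g (k.+1%:R / b%:R)) (M / b%:R) _ _ muE.
have iI : mu.-integrable `](k%:R / b%:R), (k.+1%:R / b%:R)] (EFin \o g).
  apply: integrableS (continuous_itv_integrable (k%:R / b%:R) (k.+1%:R / b%:R) cg) => //.
  exact: subset_itv_oc_cc.
move=> /(_ (measurable_itv _) iI).
have HI y : `](k%:R / b%:R), (k.+1%:R / b%:R)]%classic y -> `|g y - g (k.+1%:R / b%:R)| <= M / b%:R.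
  rewrite /= in_itv /= => /andP[y1 y2]; apply: le_trans (H _ _) _.
  rewrite ler_wpM2l // ler0_norm ?subr_le0 // opprB.
  apply: (@le_trans _ _ (k.+1%:R / b%:R - k%:R / b%:R)); first by rewrite lerD2l lerN2 ltW.
  by rewrite -mulrBl -[k.+1%:R]natr1 addrAC subrr add0r mul1r.
move=> /(_ HI); rewrite -E.
rewrite [X in b%:R^-1 * X](@big_nat_recr _ _ _ k.+1) //=.
have -> : k.+1%:R * (M / b%:R ^+ 2) = k%:R * (M / b%:R ^+ 2) + M / b%:R / b%:R.
  by rewrite -natr1; field.
rewrite mulrDr [g _ / _]mulrC => h2.
exact: norm_step IH h2.
Qed.
End UnitIntegral.

Lemma farey_poly_ge b d : (b * d ^ 2 <= farey_poly b d)%N.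
Proof. rewrite /farey_poly expnS expn1; nia. Qed.

(** * Averaging over the position of the end point *)

Section MainTerm.
Variables (R : realType) (eta : R -> R) (e0 L : R).
Hypothesis e0_gt0 : 0 < e0.
Hypothesis eta_ge : forall y : R, e0 <= eta y.
Hypothesis eta_lip : forall y z : R, `|eta y - eta z| <= L * `|y - z|.
Notation mu := (@lebesgue_measure R).

Let L_ge0 : 0 <= L.
Proof. by have := eta_lip 0 1; rewrite sub0r normrN normr1 mulr1; apply: le_trans. Qed.

Let W (x : R) b d (y : R) : R := riesz x ((farey_poly b d)%:R * eta y).

Let W_lip x b d : 0 <= x -> forall y z,
  `|W x b d y - W x b d z| <= 2 * x * (farey_poly b d)%:R * L * `|y - z|.
Proof.
move=> x0 y z; have P0 : 0 <= (farey_poly b d)%:R :> R by [].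
have eg t : 0 <= eta t by rewrite (le_trans _ (eta_ge t)) // ltW.
apply: le_trans (riesz_lip x0 (mulr_ge0 P0 (eg y)) (mulr_ge0 P0 (eg z))) _.
rewrite -mulrBr normrM ger0_norm // mulrA -[leRHS]mulrA; apply: ler_wpM2l => //.
by rewrite !mulr_ge0.
Qed.

(* For [a d = 1 mod b] and [a <= b < d], [a/b] is the right end point of the Farey
   interval with denominators [d] and [b]. *)
Definition farey_sum (N : nat) (x : R) : R :=
  \sum_(1 <= b < N) \sum_(b.+1 <= d < N) \sum_(1 <= a < b.+1)
    (is_inv_mod b a d)%:R * W x b d (a%:R / b%:R).

Definition farey_mean (N : nat) (x : R) : R :=
  \sum_(1 <= b < N) \sum_(b.+1 <= d < N)
    (coprime d b)%:R * \int[mu]_(y in `[0, 1]) W x b d y.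

(** For each [b] the error is at most a constant times [x (x/e0)^(3/2) b^(4/5 - 3/2)]. As
    [4/5 - 3/2 = 3/10 - 1], the sum over [b < (x/e0)^(1/3)] contributes [(x/e0)^(1/10)], and
    [1 + 3/2 + 1/10 = 13/5]. *)
Lemma farey_sum_mean : exists2 C : R, 0 <= C & forall N x, 0 < x -> x <= N%:R ^+ 2 * e0 ->
  `|farey_sum N x - farey_mean N x| <= C * x `^ (13 / 5).
Proof.
have [K K0 HK] := box_discrepancy R.
pose C1 : R := 48 * K * L + 2 * L.
have C10 : 0 <= C1 by rewrite addr_ge0 ?mulr_ge0 // ltW.
exists (C1 * e0 `^ (- (3 / 2)) * (10 / 3 * e0 `^ (- (10%:R^-1)))).
  by rewrite !mulr_ge0 ?powR_ge0.
move=> N x x0 xN; have x0' := ltW x0.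
(* As [d > b], the weight vanishes as soon as [b^3 e0 >= x]. *)
pose Br := (x / e0) `^ (3%:R^-1).
have Br0 : 0 <= Br by exact: powR_ge0.
have xe0 : 0 < x / e0 by rewrite divr_gt0.
have Br3 : Br ^+ 3 = x / e0.
  by rewrite -powR_mulrn // -powRrM mulVf // powRr1 // ltW.
have W0 b d y : 0 <= y <= 1 -> x <= b%:R * d%:R ^+ 2 * e0 -> W x b d y = 0.
  by move=> hy hx; apply: (@riesz_farey0 R eta e0) => // *.
have perb b : (1 <= b)%N ->
   `|\sum_(b.+1 <= d < N) \sum_(1 <= a < b.+1) (is_inv_mod b a d)%:R * W x b d (a%:R / b%:R)
   - \sum_(b.+1 <= d < N) (coprime d b)%:R * \int[mu]_(y in `[0, 1]) W x b d y| <=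
   (if b%:R < Br then C1 * x * (x / e0) `^ (3 / 2) * b%:R `^ (3 / 10 - 1) else 0).
  move=> b1; have b0 : 0 < b%:R :> R by rewrite ltr0n.
  have b1R : 1 <= b%:R :> R by rewrite ler1n.
  have bn : b%:R != 0 :> R by rewrite gt_eqF.
  case: ltP => hb; last first.
    have vb d : (b < d)%N -> x <= b%:R * d%:R ^+ 2 * e0.
      move=> bd; rewrite -ler_pdivrMr // -Br3.
      apply: (@le_trans _ _ (b%:R ^+ 3)); first by rewrite lerXn2r ?nnegrE.
      by rewrite exprS ler_wpM2l // lerXn2r ?nnegrE // ler_nat ltnW.
    rewrite big_nat_cond [X in _ - X]big_nat_cond big1 => [|d /andP[/andP[bd _] _]]; last first.
      rewrite big_nat_cond big1 // => a /andP[/andP[a1 ab] _].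
      by rewrite W0 ?mulr0 ?vb // frac01.
    rewrite big1 ?subrr ?normr0 // => d /andP[/andP[bd _] _].
    under eq_Rintegral => y hy.
      rewrite W0; last exact: vb; last first.
        by move: hy; rewrite inE /= in_itv.
      over.
    by rewrite Rintegral_cst // mul0r mulr0.
  pose Dr := (x / (b%:R * e0)) `^ (2%:R^-1).
  have Dr0 : 0 <= Dr by exact: powR_ge0.
  have xb0 : 0 <= x / (b%:R * e0) by rewrite divr_ge0 // mulr_ge0 // ltW.
  have Dr2 : Dr ^+ 2 = x / (b%:R * e0).
    by rewrite -powR_mulrn // -powRrM mulVf // powRr1.
  have DrE : Dr = (x / e0) `^ (2%:R^-1) * b%:R `^ (- 2%:R^-1).
    rewrite /Dr invfM [b%:R^-1 * _]mulrC mulrA powRM ?invr_ge0 // ?(ltW xe0) //.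
    by rewrite -[b%:R^-1]powR_inv1 // -powRrM mulN1r.
  (* The comparison passes through the mean over all fractions [a/b]: [E1] is the equidistribution
     of inverses, [E2] the error of a Riemann sum, which carries the smaller power [b^(-3/2)]. *)
  pose mid d := (coprime d b)%:R / b%:R * \sum_(1 <= a < b.+1) W x b d (a%:R / b%:R).
  have E1 := @weighted_discrepancy R eta e0 L e0_gt0 (fun y _ => eta_ge y) L_ge0
    (fun y z _ _ => eta_lip y z) K (ltW K0) HK x b N b1 x0' xN.
  have E2 : `|\sum_(b.+1 <= d < N) (mid d - (coprime d b)%:R * \int[mu]_(y in `[0, 1]) W x b d y)|
     <= 2 * x ^+ 2 / e0 * L / b%:R * Dr.
    have cst0 : 0 <= 2 * x ^+ 2 / e0 * L / b%:R.
      by rewrite !mulr_ge0 ?exprn_ge0 ?invr_ge0 // ltW.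
    apply: le_trans (ler_norm_sum _ _ _) _.
    apply: (@le_trans _ _ (\sum_(1 <= d < N | d%:R < Dr) 2 * x ^+ 2 / e0 * L / b%:R * 1)); last first.
      rewrite -mulr_sumr; apply: ler_wpM2l => //; exact: card_lt_le.
    have [Nb|bN] := leqP N b.+1.
      by rewrite big_geq // sumr_ge0 // => *; rewrite mulr1.
    rewrite [leRHS](@big_cat_nat _ _ _ b.+1) ?(ltnW bN) //=.
    rewrite -[leLHS]add0r lerD //; first by apply: sumr_ge0 => *; rewrite mulr1.
    rewrite [leRHS]big_mkcond /= big_nat_cond [leRHS]big_nat_cond.
    apply: ler_sum => d; rewrite andbT => /andP[bd dN].
    have -> : mid d - (coprime d b)%:R * \int[mu]_(y in `[0, 1]) W x b d y =
      (coprime d b)%:R * (b%:R^-1 * \sum_(1 <= a < b.+1) W x b d (a%:R / b%:R) - \int[mu]_(y in `[0, 1]) W x b d y).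
      by rewrite /mid mulrBr mulrA.
    rewrite normrM normr_nat.
    apply: (@le_trans _ _ (1 * `|b%:R^-1 * \sum_(1 <= a < b.+1) W x b d (a%:R / b%:R) - \int[mu]_(y in `[0, 1]) W x b d y|)).
      by rewrite ler_wpM2r // lern1 leq_b1.
    rewrite mul1r.
    have vd : x <= (farey_poly b d)%:R * e0 -> `|b%:R^-1 * \sum_(1 <= a < b.+1) W x b d (a%:R / b%:R) - \int[mu]_(y in `[0, 1]) W x b d y| = 0.
      move=> hx; have Wz y : W x b d y = 0.
        by apply: riesz0; apply: le_trans hx _; apply: ler_wpM2l.
      under eq_Rintegral do rewrite Wz.
      rewrite Rintegral_cst // mul0r subr0 big1 ?mulr0 ?normr0 //.
    case: ltP => hd; last first.
      rewrite vd //; apply: (@le_trans _ _ (b%:R * d%:R ^+ 2 * e0)).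
        have -> : b%:R * d%:R ^+ 2 * e0 = d%:R ^+ 2 * (b%:R * e0) by ring.
        by rewrite -ler_pdivrMr ?mulr_gt0 // -Dr2 lerXn2r // nnegrE.
      by rewrite ler_wpM2r ?(ltW e0_gt0) // -natrX -natrM ler_nat farey_poly_ge.
    have [hP|hP] := leP x ((farey_poly b d)%:R * e0); first by rewrite vd // mulr1.
    apply: le_trans (riemann_sum b1 (W_lip b d x0')) _.
    rewrite mulr1; apply: ler_wpM2r; first by rewrite invr_ge0.
    apply: ler_wpM2r => //.
    have -> : 2 * x ^+ 2 / e0 = 2 * x * (x / e0) by field; rewrite gt_eqF.
    apply: ler_wpM2l; first by rewrite mulr_ge0.
    by rewrite ler_pdivlMr // ltW.
  have tri (s m t : R) : `|s - t| <= `|s - m| + `|m - t|.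
    by have := ler_normD (s - m) (m - t); rewrite addrA subrK.
  apply: le_trans (tri _ (\sum_(b.+1 <= d < N) mid d) _) _.
  rewrite -!sumrB; apply: le_trans (lerD E1 E2) _.
  have xe (r : R) : 0 <= (x / e0) `^ r by exact: powR_ge0.
  have bb (r : R) : 0 <= b%:R `^ r by exact: powR_ge0.
  have D3 : Dr ^+ 3 = (x / e0) `^ (3 / 2) * b%:R `^ (- (3 / 2)).
    rewrite DrE exprMn -!powR_mulrn // -!powRrM.
    by congr (_ `^ _ * _ `^ _); field.
  have -> : 2 * x ^+ 2 / e0 * L / b%:R * Dr =
      2 * L * x * ((x / e0) `^ (3 / 2)) * b%:R `^ (- (3 / 2)).
    have -> : (x / e0) `^ (3 / 2) = (x / e0) * (x / e0) `^ (2%:R^-1).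
      rewrite -{2}[x / e0]powRr1 ?(ltW xe0) // -powRD; last by rewrite (gt_eqF xe0) implybT.
      by congr (_ `^ _); field.
    have -> : b%:R `^ (- (3 / 2)) = b%:R^-1 * b%:R `^ (- 2%:R^-1) :> R.
      rewrite -[b%:R^-1]powR_inv1 // -powRD; last by rewrite bn implybT.
      by congr (_ `^ _); field.
    by rewrite DrE; ring.
  have D4 : b%:R `^ (4 / 5) * b%:R `^ (- (3 / 2)) = b%:R `^ (3 / 10 - 1) :> R.
    rewrite -powRD; last by rewrite bn implybT.
    by congr (_ `^ _); field.
  have D5 : b%:R `^ (- (3 / 2)) <= b%:R `^ (3 / 10 - 1) :> R by apply: ler_powR => //; lra.
  rewrite D3.
  have -> : 48 * K * L * x * b%:R `^ (4 / 5) * ((x / e0) `^ (3 / 2) * b%:R `^ (- (3 / 2))) =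
     48 * K * L * x * (x / e0) `^ (3 / 2) * b%:R `^ (3 / 10 - 1) by rewrite -D4; ring.
  rewrite /C1.
  have -> : (48 * K * L + 2 * L) * x * (x / e0) `^ (3 / 2) * b%:R `^ (3 / 10 - 1) =
    48 * K * L * x * (x / e0) `^ (3 / 2) * b%:R `^ (3 / 10 - 1) +
    2 * L * x * (x / e0) `^ (3 / 2) * b%:R `^ (3 / 10 - 1) by ring.
  by rewrite lerD2l ler_wpM2l // !mulr_ge0.
rewrite /farey_sum /farey_mean -sumrB; apply: le_trans (ler_norm_sum _ _ _) _.
apply: (@le_trans _ _ (\sum_(1 <= b < N | b%:R < Br) C1 * x * (x / e0) `^ (3 / 2) * b%:R `^ (3 / 10 - 1))).
  rewrite [leRHS]big_mkcond /= big_nat_cond [leRHS]big_nat_cond.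
  by apply: ler_sum => b; rewrite andbT => /andP[b1 _]; exact: perb.
have xe (r : R) : 0 <= (x / e0) `^ r by exact: powR_ge0.
rewrite -mulr_sumr.
have h310 : 0 < (3 / 10 : R) < 1 by lra.
apply: (@le_trans _ _ (C1 * x * (x / e0) `^ (3 / 2) * ((3 / 10)^-1 * Br `^ (3 / 10)))).
  by apply: ler_wpM2l; [rewrite !mulr_ge0|exact: sum_powRn_le].
have -> : Br `^ (3 / 10) = (x / e0) `^ (10%:R^-1).
  by rewrite /Br -powRrM; congr (_ `^ _); field.
have dv (r : R) : (x / e0) `^ r = x `^ r * e0 `^ (- r).
  rewrite powRM ?invr_ge0 ?(ltW e0_gt0) //; congr (_ * _).
  by rewrite -[e0^-1]powR_inv1 ?(ltW e0_gt0) // -powRrM mulN1r.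
rewrite !dv.
have -> : x `^ (13 / 5) = x * x `^ (3 / 2) * x `^ (10%:R^-1).
  rewrite -{2}[x]powRr1 // -!powRD ?(gt_eqF x0) ?implybT //.
  by congr (_ `^ _); field.
rewrite le_eqVlt; apply/orP; left; apply/eqP; by field.
Qed.
End MainTerm.

(** * Gamma and Beta integrals *)

Section HalfLine.
Variable R : realType.
Notation mu := (@lebesgue_measure R).
Notation D0 := (`]0%R, +oo[%classic : set R).
Local Open Scope ereal_scope.

Lemma measurable_minus : measurable_fun [set: measurableTypeR R] (-%R : measurableTypeR R -> measurableTypeR R).
Proof. by apply: continuous_measurable_fun; exact: opp_continuous. Qed.

Section Scaling.
Variables (c : R) (c0 : (0 < c)%R).

Lemma measurable_scale :
  measurable_fun [set: measurableTypeR R] ( *%R c : measurableTypeR R -> measurableTypeR R).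
Proof. exact: measurable_funM. Qed.

Let pm : {measure set (measurableTypeR R) -> \bar R} :=
  measure_function_pushforward__canonical__measure_function_Measure mu measurable_scale.
Let pm2 : {measure set (measurableTypeR R) -> \bar R} := mscale (NngNum (ltW c0)) pm.

(** Both measures agree on half-open intervals, which determines Lebesgue measure. *)
Lemma lebesgue_measure_scale (A : set (measurableTypeR R)) : measurable A -> mu A = pm2 A.
Proof.
move=> mA; apply: lebesgue_measure_unique => // _ [[a b]] _ <-.
rewrite -[RHS]/(c%:E * mu ( *%R c @^-1` `]a, b]%classic)).
have -> : *%R c @^-1` `]a, b]%classic = `](a / c)%R, (b / c)%R]%classic.
  by apply/seteqP; split => x /=; rewrite !in_itv /= ltr_pdivrMr // ler_pdivlMr // ![(x * c)%R]mulrC.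
rewrite !lebesgue_measure_itv /= !lte_fin ltr_pM2r ?invr_gt0 //.
case: ifP => _; last by rewrite mule0.
by rewrite -!EFinD -EFinM -mulrBl mulrC divfK ?gt_eqF.
Qed.

(** The substitution of [c x] for [x], for nonnegative functions with values in the extended reals,
    so that finiteness need not be settled beforehand. *)
Lemma integral_scale (f : R -> \bar R) : measurable_fun D0 f ->
  (forall x, (0 < x)%R -> 0 <= f x) ->
  \int[mu]_(x in D0) f x = c%:E * \int[mu]_(x in D0) f (c * x)%R.
Proof.
move=> mf f0.
have D0E : *%R c @^-1` D0 = D0.
  by apply/seteqP; split => x /=; rewrite !in_itv /= !andbT pmulr_rgt0.
have f0' x : D0 x -> 0 <= f x by rewrite /= in_itv /= andbT; exact: f0.
transitivity (\int[pm2]_(x in D0) f x).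
  by apply: eq_measure_integral => A mA _; exact: lebesgue_measure_scale.
rewrite ge0_integral_mscale //=; congr (_ * _).
have := @ge0_integral_pushforward _ _ _ _ R _ measurable_scale mu D0 f (measurable_itv _) mf.
rewrite D0E; apply => x; by rewrite inE => /f0'.
Qed.
End Scaling.

Lemma tonelli_half_line (g : R * R -> R) : measurable_fun setT g ->
  (forall x y, (0 < x)%R -> (0 < y)%R -> (0 <= g (x, y))%R) ->
  \int[mu]_(x in D0) \int[mu]_(y in D0) (g (x, y))%:E =
  \int[mu]_(y in D0) \int[mu]_(x in D0) (g (x, y))%:E.
Proof.
move=> mg g0.
pose f (z : R * R) : \bar R := (g z * (\1_D0 z.1 * \1_D0 z.2))%:E.
have mf : measurable_fun setT f.
  apply/measurable_EFinP; apply: measurable_funM => //.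
  by apply: measurable_funM; apply: measurableT_comp => //; exact: measurable_indic.
have D0P (x : R) : (x \in D0) = (0 < x)%R.
  by apply/idP/idP; rewrite inE /= in_itv /= andbT.
have fE x y : f (x, y) = if (x \in D0) && (y \in D0) then (g (x, y))%:E else 0.
  rewrite /f !indicE -[(x, y).1]/x -[(x, y).2]/y.
  by case: (x \in D0); case: (y \in D0) => /=; rewrite ?mulr1n ?mulr0n ?mulr0 ?mul0r ?mulr0 ?mulr1.
have f0 z : 0 <= f z.
  case: z => x y; rewrite fE !D0P.
  by case: ifP => // /andP[x0 y0]; rewrite lee_fin g0.
have E := @fubini_tonelli _ _ _ _ _ mu mu f mf f0.
transitivity (\int[mu]_x \int[mu]_y f (x, y)).
  rewrite integral_mkcond; apply: eq_integral => x _; rewrite patchE.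
  case: ifPn => hx.
    rewrite integral_mkcond; apply: eq_integral => y _; rewrite patchE fE hx.
    by case: ifP.
  by apply/esym/integral0_eq => y _; rewrite fE (negbTE hx).
rewrite E.
rewrite [RHS]integral_mkcond; apply: eq_integral => y _; rewrite patchE.
case: ifPn => hy.
  rewrite [RHS]integral_mkcond; apply: eq_integral => x _; rewrite patchE fE hy andbT.
  by case: ifP.
by apply/integral0_eq => x _; rewrite fE (negbTE hy) andbF.
Qed.

(** Extended real values allow Tonelli's theorem before convergence is known; for [a = 1/3]
    finiteness comes out of [beta_third]. *)
Definition gamma_int (a : R) : \bar R := \int[mu]_(x in D0) (x `^ (a - 1) * expR (- x))%:E.

Lemma measurable_gamma_fun (a : R) : measurable_fun setT (fun x : R => x `^ (a - 1) * expR (- x))%R.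
Proof.
apply: measurable_funM; first exact: measurable_powR.
by apply: measurableT_comp => //; exact: measurable_minus.
Qed.

Lemma measurable_gamma_fun_scale (a c : R) :
  measurable_fun setT (fun x : R => (c * x) `^ (a - 1) * expR (- (c * x)))%R.
Proof. exact: measurableT_comp (measurable_gamma_fun a) (measurable_scale c). Qed.

Lemma gamma_int_ge0 a : 0 <= gamma_int a.
Proof. by apply: integral_ge0 => x _; rewrite lee_fin mulr_ge0 ?powR_ge0 ?expR_ge0. Qed.

Lemma gamma_int_scale (a c : R) : (0 < c)%R ->
  \int[mu]_(y in D0) (y `^ (a - 1) * expR (- (c * y)))%:E = (c `^ (- a))%:E * gamma_int a.
Proof.
move=> c0; rewrite /gamma_int [X in _ = _ * X](integral_scale c0); last 2 first.
- by apply: measurable_funTS; apply/measurable_EFinP; exact: measurable_gamma_fun.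
- by move=> x _; rewrite lee_fin mulr_ge0 ?powR_ge0 ?expR_ge0.
rewrite muleA -EFinM -[RHS]ge0_integralZl //; last 3 first.
- apply: measurable_funTS; apply/measurable_EFinP.
  exact: measurable_gamma_fun_scale.
- by move=> x _; rewrite lee_fin mulr_ge0 ?powR_ge0 ?expR_ge0.
- by rewrite lee_fin mulr_ge0 ?powR_ge0 // ltW.
apply: eq_integral => y; rewrite inE /= in_itv /= andbT => y0.
rewrite -EFinM; congr (_%:E).
rewrite powRM ?ltW // !mulrA; congr (_ * _)%R.
have -> : (c `^ (- a) * c * c `^ (a - 1) = 1)%R; last by rewrite mul1r.
rewrite -{2}[c]powRr1 ?(ltW c0) // -!powRD ?(gt_eqF c0) ?implybT //.
by rewrite (_ : (- a + 1 + (a - 1) = 0)%R) ?powRr0 //; ring.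
Qed.

(** The first factor on the right is the Beta integral [B(a, b)]. The substitution [x = y u] in the
    inner integral, an exchange of the integrals, and the scaling of [y] by [1 + u] give the
    classical identity. *)
Lemma gamma_intM (a b : R) : gamma_int a * gamma_int b =
  (\int[mu]_(u in D0) (u `^ (a - 1) * (1 + u) `^ (- (a + b)))%:E) * gamma_int (a + b).
Proof.
pose g (z : R * R) := (z.1 * (z.1 * z.2) `^ (a - 1) * expR (- (z.1 * z.2)) *
   (z.1 `^ (b - 1) * expR (- z.1)))%R.
have mg : measurable_fun setT g.
  have m12 : measurable_fun setT (fun z : R * R => z.1 * z.2)%R by exact: measurable_funM.
  apply: measurable_funM.
    apply: measurable_funM.
      apply: measurable_funM; first exact: measurable_fst.
      exact: (measurableT_comp (@measurable_powR R (a - 1)%R) m12).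
    apply: (measurableT_comp (@measurable_expR R)).
    exact: (measurableT_comp measurable_minus m12).
  exact: (measurableT_comp (measurable_gamma_fun b) measurable_fst).
have g0 x y : (0 < x)%R -> (0 < y)%R -> (0 <= g (x, y))%R.
  by move=> x0 y0; rewrite /g /= !mulr_ge0 ?powR_ge0 ?expR_ge0 // ltW.
transitivity (\int[mu]_(y in D0) \int[mu]_(x in D0) (g (y, x))%:E).
  rewrite {2}/gamma_int -ge0_integralZl ?gamma_int_ge0 //; last 2 first.
  - by apply: measurable_funTS; apply/measurable_EFinP; exact: measurable_gamma_fun.
  - by move=> x _; rewrite lee_fin mulr_ge0 ?powR_ge0 ?expR_ge0.
  apply: eq_integral => y; rewrite inE /= in_itv /= andbT => y0.
  rewrite /gamma_int (integral_scale y0); last 2 first.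
  - by apply: measurable_funTS; apply/measurable_EFinP; exact: measurable_gamma_fun.
  - by move=> x _; rewrite lee_fin mulr_ge0 ?powR_ge0 ?expR_ge0.
  rewrite muleAC -EFinM -ge0_integralZl //; last 3 first.
  - apply: measurable_funTS; apply/measurable_EFinP.
    exact: measurable_gamma_fun_scale.
  - by move=> x _; rewrite lee_fin mulr_ge0 ?powR_ge0 ?expR_ge0.
  - by rewrite lee_fin !mulr_ge0 ?powR_ge0 ?expR_ge0 // ltW.
  apply: eq_integral => x _; rewrite -EFinM; congr (_%:E); rewrite /g /=; ring.
rewrite tonelli_half_line // -ge0_integralZr ?gamma_int_ge0 //; last 2 first.
- apply: measurable_funTS; apply/measurable_EFinP; apply: measurable_funM.
    exact: measurable_powR.
  apply: (measurableT_comp (@measurable_powR R _)); exact: measurable_funD.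
- by move=> x _; rewrite lee_fin mulr_ge0 ?powR_ge0.
apply: eq_integral => u; rewrite inE /= in_itv /= andbT => u0.
have u1 : (0 < 1 + u)%R by rewrite addr_gt0.
rewrite EFinM -muleA -(gamma_int_scale _ u1) -ge0_integralZl //; last 3 first.
- apply: measurable_funTS; apply/measurable_EFinP.
  apply: measurable_funM; first exact: measurable_powR.
  apply: (measurableT_comp (@measurable_expR R)); apply: (measurableT_comp measurable_minus).
  exact: measurable_funM.
- by move=> x _; rewrite lee_fin mulr_ge0 ?powR_ge0 ?expR_ge0.
- by rewrite lee_fin powR_ge0.
apply: eq_integral => y; rewrite inE /= in_itv /= andbT => y0.
rewrite -EFinM; congr (_%:E); rewrite /g /=.
have -> : (expR (- ((1 + u) * y)) = expR (- (y * u)) * expR (- y))%R.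
  by rewrite -expRD; congr expR; ring.
have -> : (y `^ (a + b - 1) = y * y `^ (a - 1) * y `^ (b - 1))%R.
  rewrite -{2}[y]powRr1 ?(ltW y0) // -!powRD ?(gt_eqF y0) ?implybT //.
  by congr (_ `^ _)%R; ring.
by rewrite powRM ?(ltW y0) ?(ltW u0) //; ring.
Qed.
End HalfLine.

Section GammaThird.
Variable R : realType.
Notation mu := (@lebesgue_measure R).
Notation D0 := (`]0%R, +oo[%classic : set R).

Lemma bigcup_itv_invS : \bigcup_i `[(i.+1%:R^-1 : R), +oo[%classic = D0.
Proof.
apply/seteqP; split => x /=.
  move=> [i _] /=; rewrite !in_itv /= !andbT; apply: lt_le_trans.
  by rewrite invr_gt0.
rewrite in_itv /= andbT => x0.
exists (Num.trunc x^-1) => //=; rewrite in_itv /= andbT.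
rewrite invf_ple ?posrE // ltW //; exact: truncnS_gt.
Qed.

(** The integrand may be singular at [0]: the half line is exhausted by the intervals from
    [1/(i + 1)] on, with monotone convergence. *)
Lemma FTC_half_line (f F : R -> R) (l m : R) :
  (forall x, 0 < x -> 0 <= f x) -> (forall x, 0 < x -> {for x, continuous f}) ->
  (forall x : R, 0 < x -> is_derive x 1 F (f x)) ->
  F x @[x --> +oo] --> l -> F x @[x --> 0^'+] --> m ->
  (\int[mu]_(x in D0) (f x)%:E = (l - m)%:E)%E.
Proof.
move=> f0 cf dF Fl Fm.
pose A i := `[(i.+1%:R^-1 : R), +oo[%classic.
have Apos i x : A i x -> 0 < x.
  by rewrite /A /= in_itv /= andbT; apply: lt_le_trans; rewrite invr_gt0.
have pos i : 0 < i.+1%:R^-1 :> R by rewrite invr_gt0.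
have IA i : (\int[mu]_(x in A i) (f x)%:E = (l - F (i.+1%:R^-1))%:E)%E.
  rewrite EFinB; apply: ge0_continuous_FTC2y => //.
  - by move=> x hx; apply: f0; apply: lt_le_trans hx; rewrite invr_gt0.
  - apply: continuous_in_subspaceT => x; rewrite inE => /Apos; exact: cf.
  - by move=> x hx; have [] := dF x (lt_trans (pos i) hx).
  - apply: cvg_at_right_filter.
    by have [d _] := dF _ (pos i); apply/differentiable_continuous/derivable1_diffP.
  - move=> x; rewrite in_itv /= andbT => hx.
    have x0 : 0 < x by apply: lt_trans hx; rewrite invr_gt0.
    by rewrite derive1E; have [_ ->] := dF x x0.
have ndA : nondecreasing_seq A.
  move=> i j ij; apply/subsetPset => x; rewrite /A /= !in_itv /= !andbT.
  by apply: le_trans; rewrite lef_pV2 ?posrE // ler_nat.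
have mA i : measurable (A i : set (measurableTypeR R)) by exact: measurable_itv.
have mfA i : measurable_fun (A i) (EFin \o f).
  apply/measurable_EFinP.
  apply: subspace_continuous_measurable_fun; first exact: mA.
  apply: continuous_in_subspaceT => x; rewrite inE => /Apos; exact: cf.
have f0A i x : A i x -> (0 <= (EFin \o f) x)%E by move=> /Apos x0 /=; rewrite lee_fin f0.
have := ge0_nondecreasing_set_cvg_integral (mu := mu) ndA mA mfA f0A.
rewrite bigcup_itv_invS.
under eq_fun do rewrite /= IA.
move=> c1.
have c2 : (l - F (i.+1%:R^-1))%:E @[i --> \oo] --> (l - m)%:E.
  apply: cvg_EFin; first by near=> i.
  apply: cvgB; first exact: cvg_cst.
  move: Fm => /cvg_at_rightP; apply; split => [i|]; first by rewrite invr_gt0.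
  exact: cvg_harmonic.
by rewrite -(cvg_lim (@ereal_hausdorff R) c1) -(cvg_lim (@ereal_hausdorff R) c2).
Unshelve. all: by end_near. Qed.

Lemma gamma_int1 : gamma_int (1 : R) = 1%E.
Proof.
rewrite /gamma_int.
have -> : 1%E = (0 - (-1))%:E :> \bar R by rewrite sub0r opprK.
apply: (@FTC_half_line _ (fun x => - expR (- x))).
- by move=> x _; rewrite mulr_ge0 ?powR_ge0 ?expR_ge0.
- move=> x x0.
  rewrite (_ : (fun y => _) = (fun y => expR (- y))); last first.
    by apply/funext => y; rewrite subrr powRr0 mul1r.
  by apply: continuous_comp; [exact: opp_continuous|exact: continuous_expR].
- move=> x x0; rewrite subrr powRr0 mul1r.
  have -> : expR (- x) = - (expR (- x) * -1) by ring.
  by apply: is_deriveN; apply: is_derive1_comp.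
- rewrite -[X in _ --> X]oppr0; apply: cvgN.
  exact: cvgr_expR.
- have -> : -1 = - expR (- 0) :> R by rewrite oppr0 expR0.
  apply: cvg_at_right_filter; apply: cvgN.
  by apply: continuous_comp; [exact: opp_continuous|exact: continuous_expR].
Qed.

Lemma cvgy_powR (a : R) : 0 < a -> x `^ a @[x --> +oo] --> +oo.
Proof.
move=> a0; apply/cvgryPge => A; near=> x.
have A1 : A <= (Num.max A 0) by rewrite le_max lexx.
apply: le_trans A1 _.
have x0 : 0 <= Num.max A 0 by rewrite le_max lexx orbT.
have -> : Num.max A 0 = (Num.max A 0 `^ a^-1) `^ a by rewrite -powRrM mulVf ?gt_eqF // powRr1.
have h : Num.max A 0 `^ a^-1 <= x by near: x; exact: nbhs_pinfty_ge.
apply: ge0_ler_powR => //; rewrite ?nnegrE ?powR_ge0 ?(ltW a0) //.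
Unshelve. all: by end_near. Qed.

(** At [x = pi/6] the triple angle formula gives [0 = cos(3 x) = cos x (4 cos(x)^2 - 3)]. *)
Lemma atan_invsqrt3 : atan (1 / Num.sqrt 3) = pi / 6 :> R.
Proof.
have ppos := @pi_gt0 R.
pose x : R := pi / 6.
have xin : x \in `](- (pi / 2)), (pi / 2)[ by rewrite in_itv /=; apply/andP; split; rewrite /x; lra.
rewrite -[RHS]/x -[RHS](tanK xin); congr atan.
have c0 : 0 < cos x by apply: cos_gt0_pihalf; move: xin; rewrite in_itv.
have s0 : 0 < sin x by apply: sin_gt0_pi; rewrite /x; lra.
have h3 : cos (x *+ 2 + x) = 0 by rewrite -mulrSr -cos_pihalf; congr cos; rewrite /x; field.
have c2 : cos x ^+ 2 = 3 / 4.
  move: h3; rewrite cosD cos_mulr2n sin_mulr2n => h3.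
  have : cos x * (4 * cos x ^+ 2 - 3) = 0.
    by rewrite -[RHS]h3 -[in RHS]mulrnAl -mulrA -expr2 sin2cos2; ring.
  by move/eqP; rewrite mulf_eq0 gt_eqF //= subr_eq0 => /eqP h; lra.
have s2 : sin x = 1 / 2.
  have : sin x ^+ 2 = (1 / 2) ^+ 2 by rewrite sin2cos2 c2; field.
  by move/eqP; rewrite eqrXn2 ?(ltW s0) // => /eqP.
have cE : cos x = Num.sqrt 3 / 2.
  have : cos x ^+ 2 = (Num.sqrt 3 / 2) ^+ 2 by rewrite c2 exprMn sqr_sqrtr //; field.
  by move/eqP; rewrite eqrXn2 ?(ltW c0) ?divr_ge0 ?sqrtr_ge0 // => /eqP.
by rewrite /tan s2 cE; field; rewrite gt_eqF // sqrtr_gt0.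
Qed.

(** The product is a Beta integral in two ways, one for each order of the factors. With
    [v = u^(1/3)] the sum of the two integrands is [u^(-2/3) / (v^2 - v + 1)]: the logarithms of the
    separate primitives cancel and an arctangent remains. *)
Lemma gamma_third_two_third :
  (gamma_int (3^-1) * gamma_int (2 / 3))%E = (2 * pi / Num.sqrt 3)%:E :> \bar R.
Proof.
set p := (_ * _)%E.
have s3 : 0 < Num.sqrt 3 :> R by rewrite sqrtr_gt0.
have s3n : Num.sqrt 3 != 0 :> R by rewrite gt_eqF.
have s32 : Num.sqrt 3 ^+ 2 = 3 :> R by rewrite sqr_sqrtr.
pose f1 (u : R) := u `^ (3^-1 - 1) * (1 + u) `^ (- 1).
pose f2 (u : R) := u `^ (2 / 3 - 1) * (1 + u) `^ (- 1).
have e12 : 3^-1 + 2 / 3 = 1 :> R by field.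
have e21 : 2 / 3 + 3^-1 = 1 :> R by field.
have E1 : p = (\int[mu]_(u in D0) (f1 u)%:E)%E.
  by rewrite /p gamma_intM e12 gamma_int1 mule1.
have E2 : p = (\int[mu]_(u in D0) (f2 u)%:E)%E.
  by rewrite /p muleC gamma_intM e21 gamma_int1 mule1.
have mf a b : measurable_fun D0 (fun u : R => (u `^ a * (1 + u) `^ b)%:E).
  apply: measurable_funTS; apply/measurable_EFinP; apply: measurable_funM.
    exact: measurable_powR.
  by apply: (measurableT_comp (@measurable_powR R _)); exact: measurable_funD.
have E3 : (p + p = (4 * pi / Num.sqrt 3)%:E)%E.
  rewrite {1}E1 E2 -ge0_integralD //; last 4 first.
  - by move=> x _; rewrite lee_fin mulr_ge0 ?powR_ge0.
  - exact: mf.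
  - by move=> x _; rewrite lee_fin mulr_ge0 ?powR_ge0.
  - exact: mf.
  have -> : 4 * pi / Num.sqrt 3 = 2 * Num.sqrt 3 * (pi / 2) - 2 * Num.sqrt 3 * - (atan (1 / Num.sqrt 3)) :> R.
    rewrite atan_invsqrt3.
    have -> : 4 * pi / Num.sqrt 3 = 4 * pi * Num.sqrt 3 / (Num.sqrt 3 ^+ 2) :> R by field.
    by rewrite s32; field.
  pose w (u : R) := (2 * u `^ (3^-1) - 1) / Num.sqrt 3.
  apply: (@FTC_half_line (fun u => f1 u + f2 u) (fun u => 2 * Num.sqrt 3 * atan (w u))).
  - by move=> x _; rewrite addr_ge0 // mulr_ge0 ?powR_ge0.
  - move=> x x0.
    have c a : {for x, continuous (fun u : R => u `^ a)}.
      by apply/differentiable_continuous/derivable1_diffP; have [] := is_derive1_powR a x0.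
    have c1 a : {for x, continuous (fun u : R => (1 + u) `^ a)}.
      have x1 : 0 < 1 + x by rewrite addr_gt0.
      apply: (@continuous_comp _ _ _ (fun u : R => 1 + u) (fun y : R => y `^ a)).
        by apply: cvgD; [exact: cvg_cst|exact: cvg_id].
      by apply/differentiable_continuous/derivable1_diffP; have [] := is_derive1_powR a x1.
    by apply: continuousD; apply: continuousM.
  - move=> x x0.
    have dw : is_derive x 1 w (2 * (3^-1 * x `^ (3^-1 - 1)) / Num.sqrt 3).
      rewrite (_ : w = (fun u => (Num.sqrt 3)^-1 * (2 * u `^ (3^-1) - 1))); last first.
        by apply/funext => u; rewrite /w [RHS]mulrC.
      have -> : 2 * (3^-1 * x `^ (3^-1 - 1)) / Num.sqrt 3 =
        (Num.sqrt 3)^-1 * (2 * (3^-1 * x `^ (3^-1 - 1)) - 0) by rewrite subr0 [RHS]mulrC.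
      apply: is_deriveZ; apply: is_deriveB; apply: is_deriveZ; exact: is_derive1_powR.
    have -> : f1 x + f2 x = 2 * Num.sqrt 3 * ((1 + w x ^+ 2)^-1 * (2 * (3^-1 * x `^ (3^-1 - 1)) / Num.sqrt 3)).
      pose v := x `^ (3^-1); pose z := x `^ (3^-1 - 1).
      have v0 : 0 < v by exact: powR_gt0.
      have v3 : v ^+ 3 = x by rewrite -powR_mulrn ?(ltW v0) // -powRrM mulVf // powRr1 // ltW.
      have e1 : x `^ (2 / 3 - 1) = z * v.
        by rewrite -powRD ?(gt_eqF x0) ?implybT //; congr (_ `^ _); field.
      have x1 : 0 <= 1 + x by rewrite addr_ge0 // ltW.
      have e2 : (1 + x) `^ (- 1) = (1 + v ^+ 3)^-1 by rewrite powR_inv1 ?v3.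
      rewrite /f1 /f2 e1 e2 -/z /w -/v.
      rewrite exprMn exprVn s32.
      have q1 : v ^+ 2 - v + 1 != 0 by rewrite gt_eqF //; nra.
      have q2 : 1 + v ^+ 3 != 0 by rewrite gt_eqF // v3 addr_gt0.
      have q3 : 3 + (2 * v - 1) ^+ 2 != 0 by rewrite gt_eqF //; nra.
      have -> : 2 * Num.sqrt 3 * ((1 + (2 * v - 1) ^+ 2 / 3)^-1 * (2 * (3^-1 * z) / Num.sqrt 3)) =
         4 / 3 * z / (1 + (2 * v - 1) ^+ 2 / 3).
        by field; rewrite s3n q3.
      by field; rewrite q2 q3.
    apply: is_deriveZ; apply: is_derive1_comp.
  - apply: cvgM; first exact: cvg_cst.
    apply: (@cvg_comp _ _ _ w atan _ +oo); last exact: cvgy_atan.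
    have /cvgryPge H : x `^ (3^-1) @[x --> +oo] --> (+oo : set_system R) by apply: cvgy_powR; rewrite invr_gt0.
    apply/cvgryPge => A; near=> u.
    rewrite /w ler_pdivlMr // lerBrDr -ler_pdivrMl //.
    by near: u; exact: H.
  - apply: cvgM; first exact: cvg_cst.
    rewrite -atanN.
    have -> : - (1 / Num.sqrt 3) = w 0 :> R by rewrite /w powR0 // mulr0 sub0r mulN1r div1r.
    apply: (@cvg_comp _ _ _ w atan _ (nbhs (w 0))); last exact: continuous_atan.
    apply: cvgM; last exact: cvg_cst.
    apply: cvgB; last exact: cvg_cst.
    apply: cvgM; first exact: cvg_cst.
    by rewrite powR0 //; exact: powR_cvg0.
have p0 : (0 <= p)%E by rewrite mule_ge0 ?gamma_int_ge0.
case: p E1 E2 E3 p0 => [r| |] _ _ //= E3 _.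
by move: E3; rewrite -EFinD => -[h]; congr (_%:E); lra.
Unshelve. all: by end_near. Qed.

Definition gamma3 : R := fine (gamma_int (3^-1)).

(** Because the product of [Γ(1/3)] and [Γ(2/3)] is finite and positive, each factor is. Then
    [B(1/3, 1/3) = Γ(1/3)^2 / Γ(2/3)], where [Γ(2/3)] is eliminated. *)
Lemma beta_third : gamma_int (3^-1) = gamma3%:E /\ 0 < gamma3 /\
  (\int[mu]_(u in D0) (u `^ (3^-1 - 1) * (1 + u) `^ (- (2 / 3)))%:E =
    (Num.sqrt 3 * gamma3 ^+ 3 / (2 * pi))%:E)%E.
Proof.
have ppos := @pi_gt0 R.
have s3 : 0 < Num.sqrt 3 :> R by rewrite sqrtr_gt0.
have cpos : 0 < 2 * pi / Num.sqrt 3 :> R by rewrite divr_gt0 // mulr_gt0.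
have E1 := gamma_third_two_third.
have E2 := gamma_intM (3^-1 : R) (3^-1).
have e23 : 3^-1 + 3^-1 = 2 / 3 :> R by field.
rewrite e23 in E2.
have g0 := gamma_int_ge0 (3^-1 : R); have h0 := gamma_int_ge0 (2 / 3 : R).
have B0 : (0 <= \int[mu]_(u in D0) (u `^ (3^-1 - 1) * (1 + u) `^ (- (2 / 3)))%:E)%E.
  by apply: integral_ge0 => x _; rewrite lee_fin mulr_ge0 ?powR_ge0.
rewrite /gamma3.
move: E1 E2 g0 h0 B0; move: (gamma_int 3^-1) (gamma_int (2 / 3)) (integral _ _ _) => g h B.
case: g => [g| |] //; case: h => [h| |] // E1 E2 g0 h0 B0.
- move: E1; rewrite -EFinM => -[E1].
  have gp : 0 < g.
    by rewrite lt_def -lee_fin g0 andbT; apply/eqP => gz; move: cpos; rewrite -E1 gz mul0r ltxx.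
  have hp : 0 < h by rewrite -(pmulr_rgt0 _ gp) E1.
  split => //; split => //=.
  case: B E2 B0 => [B| |] //.
    rewrite -!EFinM => -[E2] _; congr (_%:E).
    have s3n : Num.sqrt 3 != 0 :> R by rewrite gt_eqF.
    have hE : h = 2 * pi / Num.sqrt 3 / g by rewrite -E1 mulrC mulKf // gt_eqF.
    have -> : B = g * g / h by rewrite E2 mulfK // gt_eqF.
    rewrite hE; move: (pi : R) ppos => q q0; by field; rewrite s3n (gt_eqF q0) (gt_eqF gp).
  by rewrite -EFinM gt0_mulye ?lte_fin.
- move: E1; have [->|gn] := eqVneq g 0; first by rewrite mul0e => -[E1]; move: cpos; rewrite -E1 ltxx.
  by rewrite gt0_muley // lte_fin lt_def gn -lee_fin.
- move: E1; have [->|hn] := eqVneq h 0; first by rewrite mule0 => -[E1]; move: cpos; rewrite -E1 ltxx.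
  by rewrite gt0_mulye // lte_fin lt_def hn -lee_fin.
Qed.
End GammaThird.

(** * The double integral of the weight *)

Section DoubleIntegral.
Variable R : realType.
Notation mu := (@lebesgue_measure R).
Notation D0 := (`]0%R, +oo[%classic : set R).

(** The Beta value [B(1/3, 1/3)]. *)
Definition betathird : R := Num.sqrt 3 * gamma3 R ^+ 3 / (2 * pi).

Lemma betathird_gt0 : 0 < betathird.
Proof.
have [_ [g0 _]] := beta_third R.
by rewrite divr_gt0 ?mulr_gt0 ?exprn_gt0 ?sqrtr_gt0 ?pi_gt0.
Qed.

Lemma measurable_riesz (x : R) : measurable_fun setT (riesz x).
Proof.
by apply: measurable_funX; apply: measurable_maxr => //; exact: measurable_funB.
Qed.

Lemma is_derive_exprn (n : nat) (x : R) :
  is_derive x 1 (fun y : R => y ^+ n.+1) (x ^+ n *+ n.+1).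
Proof.
apply: DeriveDef; first exact: exprn_derivable.
by rewrite exp_derive [_ *: 1]mulr1 scaler_nat.
Qed.

Local Open Scope ereal_scope.

(** [9/40 = 1/2 - 2/5 + 1/8], the integral of [b (1 - b^3)^2] over [[0, 1]]. *)
Lemma integral_riesz_cube : \int[mu]_(b in D0) (b * riesz 1 (b ^+ 3))%:E = (9 / 40)%:E.
Proof.
transitivity (\int[mu]_(b in `]0%R, 1%R]) (b * riesz 1 (b ^+ 3))%:E).
  rewrite integral_mkcond [RHS]integral_mkcond; apply: eq_integral => b _.
  rewrite !patchE !mem_setE !in_itv /= andbT.
  case: (ltP 0%R b) => //= b0; case: (leP b 1%R) => // b1.
  by rewrite riesz0 ?mulr0 // exprn_ege1 // ltW.
pose f (b : R) := (b * (1 - b ^+ 3) ^+ 2)%R.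
pose F (b : R) := (2^-1 * b ^+ 2 - 2 / 5 * b ^+ 5 + 8^-1 * b ^+ 8)%R.
have dF (b : R) : is_derive b 1%R F (f b).
  have -> : f b = (2^-1 * (b ^+ 1 *+ 2) - 2 / 5 * (b ^+ 4 *+ 5) + 8^-1 * (b ^+ 7 *+ 8))%R.
    by rewrite /f; field.
  apply: is_deriveD; first apply: is_deriveB.
  - by apply: is_deriveZ; apply: is_derive_exprn.
  - by apply: is_deriveZ; apply: is_derive_exprn.
  by apply: is_deriveZ; apply: is_derive_exprn.
have cF : continuous F.
  by move=> b; apply/differentiable_continuous/derivable1_diffP; have [] := dF b.
have cf : continuous f.
  move=> b; rewrite /f; apply: cvgM; first exact: cvg_id.
  apply: (@continuous_comp _ _ _ (fun b : R => 1 - b ^+ 3)%R (fun b : R => b ^+ 2)%R).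
    by apply: cvgB; [exact: cvg_cst|exact: exprn_continuous].
  exact: exprn_continuous.
rewrite integral_itv_obnd_cbnd.
  transitivity (\int[mu]_(b in `[0%R, 1%R]) (f b)%:E).
    apply: eq_integral => b; rewrite inE /= in_itv /= => /andP[b0 b1].
    by rewrite /riesz max_r // subr_ge0 exprn_ile1.
  rewrite (@continuous_FTC2 _ f F) //.
  - by rewrite -EFinB /F; congr (_%:E); field.
  - exact: continuous_subspaceT.
  - split; first by move=> b _; have [] := dF b.
    + by apply: cvg_at_right_filter; exact: cF.
    + by apply: cvg_at_left_filter; exact: cF.
  - by move=> b _; rewrite derive1E; have [_ ->] := dF b.
apply: measurable_funTS; apply/measurable_EFinP; apply: measurable_funM => //.
by apply: (measurableT_comp (@measurable_riesz 1)); exact: measurable_funX.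
Qed.

(** Homogeneity separates the variables: replacing [u] by [b u] turns the argument into
    [b^3 u (1 + u) / X], and scaling [b] by [r = (u (1 + u) / X)^(-1/3)] brings out the factor
    [r^2], whose integral over [u] is [X^(2/3) B(1/3, 1/3)]. *)
Lemma riesz_double_integral (X : R) : (0 < X)%R ->
  \int[mu]_(b in D0) \int[mu]_(u in D0) (riesz 1 (b * u * (b + u) / X))%:E =
  (9 / 40 * X `^ (2 / 3) * betathird)%:E.
Proof.
move=> X0.
pose g (z : R * R) := (z.1 * riesz 1 (z.1 ^+ 3 * (z.2 * (1 + z.2)) / X))%R.
have mg : measurable_fun setT g.
  apply: measurable_funM; first exact: measurable_fst.
  apply: (measurableT_comp (@measurable_riesz 1)).
  apply: measurable_funM => //; apply: measurable_funM.
    by apply: measurable_funX; exact: measurable_fst.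
  apply: measurable_funM; first exact: measurable_snd.
  by apply: measurable_funD => //; exact: measurable_snd.
have mG (b : R) : measurable_fun setT (fun u : R => (riesz 1 (b * u * (b + u) / X))%:E).
  apply/measurable_EFinP; apply: (measurableT_comp (@measurable_riesz 1)).
  apply: measurable_funM => //; apply: measurable_funM; first exact: measurable_funM.
  exact: measurable_funD.
transitivity (\int[mu]_(b in D0) \int[mu]_(u in D0) (g (b, u))%:E).
  apply: eq_integral => b; rewrite inE /= in_itv /= andbT => b0.
  rewrite [LHS](integral_scale b0); last 2 first.
  - by apply: measurable_funTS; exact: mG.
  - by move=> x _; rewrite lee_fin riesz_ge0.
  rewrite -ge0_integralZl //; last 3 first.
  - apply: measurable_funTS; exact: (measurableT_comp (mG b) (measurable_scale b)).
  - by move=> x _; rewrite lee_fin riesz_ge0.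
  - by rewrite lee_fin ltW.
  apply: eq_integral => u _; rewrite -EFinM /g /=; congr (_ * riesz 1 _)%:E; field.
  by rewrite gt_eqF.
rewrite tonelli_half_line //; last by move=> x y x0 y0; rewrite mulr_ge0 ?riesz_ge0 // ltW.
have [_ [_ B]] := beta_third R.
transitivity (\int[mu]_(u in D0) ((9 / 40 * X `^ (2 / 3))%:E * (u `^ (3^-1 - 1) * (1 + u) `^ (- (2 / 3)))%:E)).
  apply: eq_integral => u; rewrite inE /= in_itv /= andbT => u0.
  pose c := (u * (1 + u) / X)%R.
  have c0 : (0 < c)%R by rewrite divr_gt0 // mulr_gt0 // addr_gt0.
  pose r := (c `^ (- 3^-1))%R.
  have r0 : (0 < r)%R by rewrite powR_gt0.
  have r3 : (r ^+ 3 * c = 1)%R.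
    rewrite -powR_mulrn ?(ltW r0) // -powRrM -{2}[c]powRr1 ?(ltW c0) // -powRD ?(gt_eqF c0) ?implybT //.
    by rewrite (_ : - 3^-1 * 3 + 1 = 0)%R ?powRr0 //; field.
  rewrite /g /= (integral_scale r0); last 2 first.
  - apply: measurable_funTS; apply/measurable_EFinP.
    apply: measurable_funM => //; apply: (measurableT_comp (@measurable_riesz 1)).
    by apply: measurable_funM => //; apply: measurable_funM => //; exact: measurable_funX.
  - by move=> b b0; rewrite lee_fin mulr_ge0 ?riesz_ge0 // ltW.
  transitivity (r%:E * \int[mu]_(b in D0) (r%:E * (b * riesz 1 (b ^+ 3))%:E)).
    congr (_ * _); apply: eq_integral => b _; rewrite -EFinM [in RHS]mulrA; congr (_ * riesz 1 _)%:E.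
    rewrite -[RHS]mulr1 -[X in _ = (_ * X)%R]r3 /c /=; field.
    by rewrite gt_eqF.
  rewrite ge0_integralZl //; last 3 first.
  - apply: measurable_funTS; apply/measurable_EFinP; apply: measurable_funM => //.
    by apply: (measurableT_comp (@measurable_riesz 1)); exact: measurable_funX.
  - by move=> b; rewrite /= in_itv /= andbT => b0; rewrite lee_fin mulr_ge0 ?riesz_ge0 // ltW.
  - by rewrite lee_fin ltW.
  rewrite integral_riesz_cube muleA -!EFinM; congr (_%:E).
  have -> : (r * r = c `^ (- (2 / 3)))%R.
    by rewrite -powRD ?(gt_eqF c0) ?implybT //; congr (_ `^ _)%R; field.
  rewrite /c powRM ?invr_ge0 ?(ltW X0) ?mulr_ge0 ?addr_ge0 ?(ltW u0) //.
  rewrite powRM ?addr_ge0 ?(ltW u0) //.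
  rewrite -[X^-1%R]powR_inv1 ?(ltW X0) // -powRrM.
  rewrite (_ : -1 * - (2 / 3) = 2 / 3)%R; last by field.
  rewrite (_ : 3^-1 - 1 = - (2 / 3) :> R)%R; last by field.
  by ring.
rewrite ge0_integralZl //; last 3 first.
- apply: measurable_funTS; apply/measurable_EFinP; apply: measurable_funM.
    exact: measurable_powR.
  by apply: (measurableT_comp (@measurable_powR R _)); exact: measurable_funD.
- by move=> x _; rewrite lee_fin mulr_ge0 ?powR_ge0.
- by rewrite lee_fin mulr_ge0 ?powR_ge0.
by rewrite B -EFinM.
Qed.
End DoubleIntegral.

(** * Sums over all pairs and over coprime pairs *)

Section PairSum.
Variable R : realType.
Notation mu := (@lebesgue_measure R).
Notation D0 := (`]0%R, +oo[%classic : set R).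

Section OneDim.
Local Open Scope ereal_scope.
Variable f : R -> \bar R.
Hypothesis mf : measurable_fun D0 f.
Hypothesis f0 : forall x, (0 < x)%R -> 0 <= f x.
Hypothesis f_noninc : forall x y, (0 < x)%R -> (x <= y)%R -> f y <= f x.

Let mfS (a b : itv_bound R) : [set` Interval a b] `<=` D0 -> measurable_fun [set` Interval a b] f.
Proof. by move=> h; apply: measurable_funS mf. Qed.

Let subO (a : R) (b : itv_bound R) : (0 <= a)%R -> [set` Interval (BRight a) b] `<=` D0.
Proof.
by move=> a0 x /=; rewrite !itv_boundlr !bnd_simp => /andP[h _]; rewrite (le_lt_trans a0 h).
Qed.

Let subC (a : R) (b : itv_bound R) : (0 < a)%R -> [set` Interval (BLeft a) b] `<=` D0.
Proof.
by move=> a0 x /=; rewrite !itv_boundlr !bnd_simp => /andP[h _]; rewrite (lt_le_trans a0 h).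
Qed.

Lemma integral_itv_split (a b c : itv_bound R) : (a <= b)%O -> (b <= c)%O ->
  [set` Interval a c] `<=` D0 ->
  \int[mu]_(x in [set` Interval a c]) f x =
  \int[mu]_(x in [set` Interval a b]) f x + \int[mu]_(x in [set` Interval b c]) f x.
Proof.
move=> ab bc ac; have E := itv_bndbnd_setU ab bc.
rewrite {1}E ge0_integral_setU -?E //.
- exact: mfS.
- by move=> x /ac; rewrite /= in_itv /= andbT; exact: f0.
- apply/disj_setPRL => x; rewrite /= !itv_boundlr => /andP[h _].
  by apply/negP; rewrite negb_and; apply/orP; right; rewrite -ltNge (le_lt_trans h) // bnd_simp.
Qed.

Lemma sum_le_integral N : \sum_(1 <= d < N) f d%:R <= \int[mu]_(x in D0) f x.
Proof.
have I0 (A : set (measurableTypeR R)) : A `<=` D0 -> forall x, A x -> 0 <= f x.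
  by move=> h x /h; rewrite /= in_itv /= andbT; exact: f0.
have main n : \sum_(1 <= d < n.+1) f d%:R <= \int[mu]_(x in `]0%R, n%:R]) f x.
  elim: n => [|n IH]; first by rewrite big_geq // set_itv_ge ?bnd_simp ?ltxx // integral_set0.
  rewrite big_nat_recr //=.
  rewrite (@integral_itv_split _ (BRight n%:R)) ?bnd_simp ?ler0n ?ler_nat //; last first.
    exact: subO.
  apply: leeD => //.
  have -> : f n.+1%:R = \int[mu]_(x in `]n%:R, n.+1%:R]) cst (f n.+1%:R) x.
    rewrite integral_cst //= lebesgue_measure_itv /= lte_fin ltr_nat ltnSn.
    by rewrite -EFinB -natrB // subSnn mule1.
  apply: ge0_le_integral => //.
  - by move=> x _; apply: f0.
  - by apply: mfS; apply: subO; rewrite ler0n.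
  - move=> x; rewrite /= in_itv /= => /andP[h1 h2]; apply: f_noninc => //.
    by apply: le_lt_trans h1.
case: N => [|N]; first by rewrite big_geq // integral_ge0 // => x; apply: I0.
apply: le_trans (main N) _; apply: ge0_subset_integral => //; first by apply: I0.
exact: subO.
Qed.

(** The vanishing from [N] on lets a finite sum dominate the integral over a whole half line. *)
Lemma integral_le_sum N : (forall x, (N%:R <= x)%R -> f x = 0) ->
  \int[mu]_(x in `[1%R, +oo[) f x <= \sum_(1 <= d < N) f d%:R.
Proof.
move=> fN.
have I0 (A : set (measurableTypeR R)) : A `<=` D0 -> forall x, A x -> 0 <= f x.
  by move=> h x /h; rewrite /= in_itv /= andbT; exact: f0.
have main n : \int[mu]_(x in `[1%R, n.+1%:R[) f x <= \sum_(1 <= d < n.+1) f d%:R.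
  elim: n => [|n IH]; first by rewrite big_geq // set_itv_ge ?bnd_simp ?ltxx // integral_set0.
  rewrite big_nat_recr //=.
  rewrite (@integral_itv_split _ (BLeft n.+1%:R)) ?bnd_simp ?ler1n ?ler_nat //; last first.
    exact: subC.
  apply: leeD => //.
  have -> : f n.+1%:R = \int[mu]_(x in `[n.+1%:R, n.+2%:R[) cst (f n.+1%:R) x.
    rewrite integral_cst //= lebesgue_measure_itv /= lte_fin ltr_nat ltnSn.
    by rewrite -EFinB -natrB // subSnn mule1.
  apply: ge0_le_integral => //.
  - by apply: I0; apply: subC; rewrite ltr0n.
  - by apply: mfS; apply: subC; rewrite ltr0n.
  - by move=> x; rewrite /= in_itv /= => /andP[h1 h2]; apply: f_noninc; rewrite ?ltr0n.
case: N fN => [|N] fN.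
  rewrite big_geq // integral0_eq // => x; rewrite /= in_itv /= andbT => h.
  by apply: fN; apply: le_trans h.
rewrite (@integral_itv_split _ (BLeft N.+1%:R)) ?bnd_simp ?ler1n //; last first.
  exact: subC.
rewrite [X in _ + X]integral0_eq ?adde0 // => x; rewrite /= in_itv /= andbT; exact: fN.
Qed.
End OneDim.

Lemma riesz_noninc (x y z : R) : y <= z -> riesz x z <= riesz x y.
Proof.
move=> yz; have h : Num.max 0 (x - z) <= Num.max 0 (x - y).
  by rewrite ge_max !le_max lexx /= lerD2l lerN2 yz orbT.
by rewrite /riesz lerXn2r ?nnegrE // le_max lexx.
Qed.

Section TwoDim.
Local Open Scope ereal_scope.

Lemma measurable_section_integral (g : R * R -> R) (S : set (measurableTypeR R)) :
  measurable S -> measurable_fun setT g -> (forall z, (0 <= g z)%R) ->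
  measurable_fun setT (fun x => \int[mu]_(y in S) (g (x, y))%:E).
Proof.
move=> mS mg g0.
pose f (z : R * R) : \bar R := (g z * \1_S z.2)%:E.
have mf : measurable_fun setT f.
  apply/measurable_EFinP; apply: measurable_funM => //.
  by apply: (measurableT_comp _ measurable_snd); exact: measurable_indic.
have f0 z : 0 <= f z by rewrite lee_fin mulr_ge0.
have := @measurable_fun_fubini_tonelli_F _ _ _ _ R mu f mf f0.
congr measurable_fun; apply/funext => x; rewrite [RHS]integral_mkcond.
apply: eq_integral => y _; rewrite patchE /f indicE /=.
by case: ifP => _; rewrite ?mulr1n ?mulr1 ?mulr0n ?mulr0.
Qed.

Variables (X : R) (N : nat).
Hypothesis X0 : (0 < X)%R.
(** Makes the finite sums complete: for [b >= 1] and [d >= N] one has [b d^2 >= X], and the weight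
    is zero. *)
Hypothesis XN : (X <= N%:R ^+ 2)%R.

Let G (b u : R) : R := riesz 1 (b * u * (b + u) / X).

Let G0 b u : (0 <= G b u)%R. Proof. exact: riesz_ge0. Qed.

Let GC b u : G b u = G u b. Proof. by rewrite /G; congr riesz; congr (_ / _)%R; ring. Qed.

Let G_noninc u x y : (0 < u)%R -> (0 < x)%R -> (x <= y)%R -> (G y u <= G x u)%R.
Proof.
move=> u0 x0 xy; apply: riesz_noninc; rewrite ler_wpM2r ?invr_ge0 ?(ltW X0) //.
by apply: ler_pM; rewrite ?mulr_ge0 ?addr_ge0 ?(ltW u0) ?(ltW x0) ?ler_wpM2r ?(ltW u0) ?lerD2r.
Qed.

Let G_zero b u : (0 <= b)%R -> (0 <= u)%R -> (X <= b * u ^+ 2)%R -> G b u = 0%R.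
Proof.
move=> b0 u0 h; apply: riesz0; rewrite ler_pdivlMr // mul1r; apply: le_trans h _.
rewrite -mulrA ler_wpM2l // expr2 ler_wpM2l // lerDr //.
Qed.

Let mg : measurable_fun setT (fun z : R * R => G z.1 z.2).
Proof.
apply: (measurableT_comp (@measurable_riesz R 1)); apply: measurable_funM => //.
by apply: measurable_funM; [exact: measurable_funM|exact: measurable_funD].
Qed.

Let mG (S : set (measurableTypeR R)) b : measurable_fun S (EFin \o G b).
Proof.
apply: measurable_funTS; apply/measurable_EFinP.
apply: (measurableT_comp (@measurable_riesz R 1)); apply: measurable_funM => //.
by apply: measurable_funM; [exact: measurable_funM|exact: measurable_funD].
Qed.

Let mh (S : set (measurableTypeR R)) : measurable S ->
  measurable_fun setT (fun x => \int[mu]_(y in S) (G x y)%:E).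
Proof. by move=> mS; apply: (measurable_section_integral mS mg) => z; exact: G0. Qed.

Let h b := \int[mu]_(u in D0) (G b u)%:E.
(** The strip [b < 1], which a sum over positive integers does not see. *)
Let E := \int[mu]_(b in `]0%R, 1%R[) h b.
Let T := \int[mu]_(b in D0) h b.

Let h_noninc (S : set (measurableTypeR R)) x y : measurable S -> S `<=` D0 ->
  (0 < x)%R -> (x <= y)%R ->
  \int[mu]_(u in S) (G y u)%:E <= \int[mu]_(u in S) (G x u)%:E.
Proof.
move=> mS SD x0 xy; apply: ge0_le_integral => //.
- by move=> u _; rewrite lee_fin.
- exact: mG.
- exact: mG.
- by move=> u /SD; rewrite /= in_itv /= andbT => u0; rewrite lee_fin G_noninc.
Qed.

Let h_ge0 (S : set (measurableTypeR R)) b : 0 <= \int[mu]_(u in S) (G b u)%:E.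
Proof. by apply: integral_ge0 => u _; rewrite lee_fin. Qed.

Let mD0 : measurable (D0 : set (measurableTypeR R)). Proof. exact: measurable_itv. Qed.

Lemma double_sum_le :
  (\sum_(1 <= b < N) \sum_(1 <= d < N) G b%:R d%:R)%:E <= T.
Proof.
rewrite -sumEFin; apply: (@le_trans _ _ (\sum_(1 <= b < N) h b%:R)).
  rewrite big_nat [leRHS]big_nat; apply: lee_sum => b /andP[b1 _].
  rewrite -sumEFin; apply: sum_le_integral.
  - exact: mG.
  - by move=> x _; rewrite lee_fin.
  - by move=> x y x0 xy; rewrite lee_fin GC [leRHS]GC G_noninc // ltr0n.
apply: sum_le_integral.
- by apply: measurable_funTS; exact: mh.
- by move=> x _; exact: h_ge0.
- by move=> x y x0 xy; exact: h_noninc.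
Qed.

(** On the quadrant [b, u >= 1] the integral is below the sum by monotonicity. The rest is covered
    by the strips [b < 1] and [u < 1], which have the same integral by symmetry and Tonelli's
    theorem. *)
Lemma double_integral_le :
  T <= (\sum_(1 <= b < N) \sum_(1 <= d < N) G b%:R d%:R)%:E + (E + E).
Proof.
have m1 : measurable (`]0%R, 1%R[%classic : set (measurableTypeR R)) by exact: measurable_itv.
have m2 : measurable (`[1%R, +oo[%classic : set (measurableTypeR R)) by exact: measurable_itv.
have s2 : `[1%R, +oo[ `<=` D0.
  by move=> x; rewrite /= !in_itv /= !andbT; exact: lt_le_trans.
have s1 : `]0%R, 1%R[ `<=` D0.
  by move=> x; rewrite /= !in_itv /= !andbT => /andP[].
have split (f : R -> \bar R) : measurable_fun D0 f -> (forall x, (0 < x)%R -> 0 <= f x) ->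
   \int[mu]_(x in D0) f x = \int[mu]_(x in `]0%R, 1%R[) f x + \int[mu]_(x in `[1%R, +oo[) f x.
  by move=> mf f0; apply: integral_itv_split => //; rewrite bnd_simp.
pose h0 b := \int[mu]_(u in `]0%R, 1%R[) (G b u)%:E.
pose h1 b := \int[mu]_(u in `[1%R, +oo[) (G b u)%:E.
have hE b : h b = h0 b + h1 b.
  by apply: split; [exact: mG|move=> x _; rewrite lee_fin].
have N_le (x y : R) : (1 <= x)%R -> (N%:R <= y)%R -> (X <= x * y ^+ 2)%R.
  move=> x1 hy; apply: (le_trans XN); apply: (@le_trans _ _ (y ^+ 2)%R).
    by rewrite lerXn2r ?nnegrE // (le_trans _ hy).
  by rewrite ler_peMl // sqr_ge0.
have h1_sum : \int[mu]_(b in `[1%R, +oo[) h1 b <=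
    (\sum_(1 <= b < N) \sum_(1 <= d < N) G b%:R d%:R)%:E.
  apply: (@le_trans _ _ (\sum_(1 <= b < N) h1 b%:R)).
    apply: integral_le_sum.
    - by apply: measurable_funTS; exact: mh.
    - by move=> x _; exact: h_ge0.
    - by move=> x y x0 xy; exact: h_noninc.
    move=> x hx; apply: integral0_eq => u; rewrite /= in_itv /= andbT => u1.
    have x0 : (0 <= x)%R by apply: le_trans hx.
    by rewrite GC G_zero ?N_le // (le_trans _ u1).
  rewrite -sumEFin big_nat [leRHS]big_nat; apply: lee_sum => b /andP[b1 _].
  rewrite -sumEFin; apply: integral_le_sum.
  - exact: mG.
  - by move=> x _; rewrite lee_fin.
  - by move=> x y x0 xy; rewrite lee_fin GC [leRHS]GC G_noninc // ltr0n.
  - by move=> x hx; rewrite G_zero ?N_le ?ler1n // (le_trans _ hx).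
have h0_E : \int[mu]_(b in D0) h0 b = E.
  pose g (z : R * R) := (G z.1 z.2 * \1_(`]0%R, 1%R[%classic : set R) z.2)%R.
  have mg' : measurable_fun setT g.
    apply: measurable_funM; first exact: mg.
    by apply: (measurableT_comp _ measurable_snd); exact: measurable_indic.
  have g0 x y : (0 < x)%R -> (0 < y)%R -> (0 <= g (x, y))%R.
    by move=> _ _; rewrite /g /= mulr_ge0.
  transitivity (\int[mu]_(x in D0) \int[mu]_(y in D0) (g (x, y))%:E).
    apply: eq_integral => x _; rewrite /h0 integral_mkcond [RHS]integral_mkcond.
    apply: eq_integral => y _; rewrite !patchE /g /= indicE !mem_setE !in_itv /= andbT.
    by case: (ltP 0%R y) => //= _; case: ifP; rewrite ?mulr1n ?mulr1 ?mulr0n ?mulr0.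
  rewrite (tonelli_half_line mg' g0) /E integral_mkcond [RHS]integral_mkcond.
  apply: eq_integral => y _; rewrite !patchE !mem_setE !in_itv /= andbT.
  case: (ltP 0%R y) => //= y0; case: ifP => y1.
    apply: eq_integral => x _; rewrite /g /= indicE mem_setE in_itv /= y0 y1 mulr1n mulr1.
    by rewrite GC.
  apply: integral0_eq => x _.
  by rewrite /g /= indicE mem_setE in_itv /= y0 y1 mulr0n mulr0.
rewrite /T (split h); last 2 first.
- by apply: measurable_funTS; exact: mh.
- by move=> x _; exact: h_ge0.
rewrite [leRHS]addeCA; apply: leeD; first exact: lexx.
have -> : \int[mu]_(b in `[1%R, +oo[) h b = \int[mu]_(b in `[1%R, +oo[) (h0 b + h1 b).
  by apply: eq_integral => b _; rewrite hE.
have -> : \int[mu]_(b in `[1%R, +oo[) (h0 b + h1 b) =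
    \int[mu]_(b in `[1%R, +oo[) h0 b + \int[mu]_(b in `[1%R, +oo[) h1 b.
  apply: ge0_integralD.
  - exact: m2.
  - by move=> x _; exact: h_ge0.
  - by apply: measurable_funTS; exact: mh.
  - by move=> x _; exact: h_ge0.
  - by apply: measurable_funTS; exact: mh.
rewrite [leRHS]addeC; apply: leeD; last exact: h1_sum.
rewrite -h0_E; apply: ge0_subset_integral.
- exact: m2.
- exact: mD0.
- by apply: measurable_funTS; exact: mh.
- by move=> x _; exact: h_ge0.
- exact: s2.
Qed.

(** For fixed [b] the weight is at most 1 and vanishes when [b u^2 >= X], so that the inner integral
    is at most [(X/b)^(1/2)]. *)
Lemma corner_le : E <= (2 * X `^ (2%:R^-1) * betathird R)%:E.
Proof.
have [_ [_ B]] := beta_third R.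
have hb b : (0 < b)%R -> h b <= (X `^ (2%:R^-1) * b `^ (- 2%:R^-1))%:E.
  move=> b0; pose r := (X `^ (2%:R^-1) * b `^ (- 2%:R^-1))%R.
  have r0 : (0 < r)%R by rewrite mulr_gt0 ?powR_gt0.
  have r2 : (b * r ^+ 2 = X)%R.
    rewrite exprMn -!powR_mulrn ?powR_ge0 // -!powRrM mulVf // powRr1 ?(ltW X0) //.
    rewrite mulNr mulVf // powR_inv1 ?(ltW b0) // mulrCA divff ?mulr1 // gt_eqF //.
  have -> : (X `^ (2%:R^-1) * b `^ (- 2%:R^-1))%:E = \int[mu]_(x in `]0%R, r]) cst 1 x.
    by rewrite integral_cst //= lebesgue_measure_itv /= lte_fin r0 -EFinB subr0 mul1e.
  rewrite /h (@integral_itv_split (EFin \o G b) _ _ _ (BRight r)) ?bnd_simp ?(ltW r0) //; last 2 first.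
  - exact: mG.
  - by move=> x _; rewrite lee_fin.
  rewrite [X in _ + X]integral0_eq ?adde0; last first.
    move=> u; rewrite /= in_itv /= andbT => ru.
    have u0 : (0 < u)%R by apply: lt_trans ru.
    rewrite G_zero ?(ltW b0) ?(ltW u0) // -r2 ler_wpM2l ?(ltW b0) //.
    by rewrite lerXn2r ?nnegrE ?(ltW u0) ?(ltW r0) ?(ltW ru).
  apply: ge0_le_integral.
  - exact: measurable_itv.
  - by move=> x _; rewrite lee_fin.
  - exact: mG.
  - exact: measurable_cst.
  - move=> x; rewrite /= in_itv /= => /andP[x0 _]; rewrite lee_fin -[leRHS](expr1n _ 2).
    apply: riesz_le => //; rewrite divr_ge0 ?(ltW X0) // !mulr_ge0 ?addr_ge0 ?(ltW b0) ?(ltW x0) //.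
(* The Beta integral is used again as a majorant: on []0, 1[], [b^(-1/2) <= b^(-2/3) <= 2 b^(-2/3)
   (1 + b)^(-2/3)]. *)
apply: (@le_trans _ _ (\int[mu]_(u in D0) ((2 * X `^ (2%:R^-1))%:E * (u `^ (3^-1 - 1) * (1 + u) `^ (- (2 / 3)))%:E))); last first.
  rewrite ge0_integralZl //; last 3 first.
  - apply: measurable_funTS; apply/measurable_EFinP; apply: measurable_funM.
      exact: measurable_powR.
    by apply: (measurableT_comp (@measurable_powR R _)); exact: measurable_funD.
  - by move=> x _; rewrite lee_fin mulr_ge0 ?powR_ge0.
  - by rewrite lee_fin mulr_ge0 ?powR_ge0.
  by rewrite B -EFinM.
have mk : measurable_fun setT (fun u : R => (2 * X `^ (2%:R^-1))%:E * (u `^ (3^-1 - 1) * (1 + u) `^ (- (2 / 3)))%:E).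
  apply: measurable_funeM; apply/measurable_EFinP; apply: measurable_funM.
    exact: measurable_powR.
  by apply: (measurableT_comp (@measurable_powR R _)); exact: measurable_funD.
have k0 (u : R) : 0 <= (2 * X `^ (2%:R^-1))%:E * (u `^ (3^-1 - 1) * (1 + u) `^ (- (2 / 3)))%:E.
  by rewrite -EFinM lee_fin !mulr_ge0 ?powR_ge0.
apply: (@le_trans _ _ (\int[mu]_(u in `]0%R, 1%R[) ((2 * X `^ (2%:R^-1))%:E * (u `^ (3^-1 - 1) * (1 + u) `^ (- (2 / 3)))%:E))); last first.
  apply: ge0_subset_integral.
  - exact: measurable_itv.
  - exact: measurable_itv.
  - exact: measurable_funTS.
  - by move=> x _; exact: k0.
  - by move=> x; rewrite /= !in_itv /= !andbT => /andP[].
apply: ge0_le_integral.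
- exact: measurable_itv.
- by move=> x _; exact: h_ge0.
- by apply: measurable_funTS; exact: mh.
- exact: measurable_funTS.
move=> b; rewrite /= in_itv /= => /andP[b0 b1].
apply: (le_trans (hb b b0)); rewrite -EFinM lee_fin [(2 * _)%R]mulrC -mulrA.
rewrite ler_wpM2l ?powR_ge0 // mulrCA.
apply: (@le_trans _ _ (b `^ (3^-1 - 1) * 1)%R).
  rewrite mulr1; apply: ger_powR; first by rewrite b0 ltW.
  lra.
rewrite ler_wpM2l ?powR_ge0 //.
apply: (@le_trans _ _ (2 * 2 `^ (-1))%R).
  by rewrite powR_inv1 // divff.
rewrite ler_wpM2l //; apply: (@le_trans _ _ (2 `^ (- (2 / 3)))%R).
  apply: ler_powR; [lra|lra].
rewrite !powRN lef_pV2 ?posrE ?powR_gt0 ?addr_gt0 //.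
apply: ge0_ler_powR; rewrite ?nnegrE ?addr_ge0 ?(ltW b0) //; lra.
Qed.
End TwoDim.

Lemma sum_symmetric (g : nat -> nat -> R) N : (forall b d, g b d = g d b) ->
  \sum_(1 <= b < N) \sum_(1 <= d < N) g b d =
  (\sum_(1 <= b < N) \sum_(b.+1 <= d < N) g b d) *+ 2 + \sum_(1 <= b < N) g b b.
Proof.
move=> gC; case: N => [|N]; first by rewrite !big_geq // mul0rn addr0.
elim: N => [|N IH]; first by rewrite !big_geq // mul0rn addr0.
rewrite [LHS]big_nat_recr //=.
have -> : \sum_(1 <= b < N.+1) \sum_(1 <= d < N.+2) g b d =
    \sum_(1 <= b < N.+1) \sum_(1 <= d < N.+1) g b d + \sum_(1 <= b < N.+1) g b N.+1.
  by rewrite -big_split /=; apply: eq_bigr => b _; rewrite big_nat_recr.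
have -> : \sum_(1 <= b < N.+2) \sum_(b.+1 <= d < N.+2) g b d =
    \sum_(1 <= b < N.+1) \sum_(b.+1 <= d < N.+1) g b d + \sum_(1 <= b < N.+1) g b N.+1.
  rewrite big_nat_recr //= [X in _ + X]big_geq // addr0 -big_split /=.
  by rewrite big_nat [RHS]big_nat; apply: eq_bigr => b /andP[_ hb]; rewrite big_nat_recr.
have uE : \sum_(1 <= d < N.+1) g N.+1 d = \sum_(1 <= b < N.+1) g b N.+1.
  by apply: eq_bigr => b _.
rewrite IH [\sum_(1 <= d < N.+2) g N.+1 d]big_nat_recr //= uE.
rewrite [\sum_(1 <= b < N.+2) g b b]big_nat_recr //= !mulr2n.
set u := \sum_(_ <= _ < _) g _ N.+1; ring.
Qed.

Definition pair_sum N (X : R) :=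
  \sum_(1 <= b < N) \sum_(b.+1 <= d < N) riesz 1 ((farey_poly b d)%:R / X).

(** The strips cost [X^(1/2)] and the diagonal [X^(1/3)]; [9/80] is half of [9/40], for the pairs
    with [b < d]. The error is stated with [3/5] because [coprime_sum_asymp] needs an exponent [t]
    for which the sum of [g^(-3 t)] over [g >= 2] is below 1, and [t = 1/2] fails this. *)
Lemma pair_sum_asymp : exists2 K, 0 < K & forall (X : R) N, 0 < X -> X <= N%:R ^+ 2 ->
  `|pair_sum N X - 9 / 80 * betathird R * X `^ (2 / 3)| <= K * X `^ (3 / 5).
Proof.
have B0 := betathird_gt0 R.
(* Half of the diagonal, and half of the two strips. *)
exists (2^-1 + 2 * betathird R) => [|X N X0 XN]; first by rewrite addr_gt0 // mulr_gt0.
(* For [X < 1] all weights vanish, and the main term itself is below the error because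
   [2/3 > 3/5]. *)
case: (ltP X 1) => X1.
  have -> : pair_sum N X = 0.
    rewrite /pair_sum big1_seq // => b /andP[_]; rewrite mem_index_iota => /andP[b1 _].
    rewrite big1_seq // => d /andP[_]; rewrite mem_index_iota => /andP[d1 _].
    apply: riesz0; rewrite ler_pdivlMr // mul1r (le_trans (ltW X1)) // ler1n.
    by rewrite !muln_gt0 addn_gt0 b1 /= (leq_ltn_trans _ d1).
  have q0 : (0 : R) <= 9 / 80 by lra.
  rewrite sub0r normrN (ger0_norm (mulr_ge0 (mulr_ge0 q0 (ltW B0)) (powR_ge0 _ _))).
  have h : X `^ (2 / 3) <= X `^ (3 / 5) by apply: ger_powR; rewrite ?X0 ?ltW //; lra.
  by apply: ler_pM; [rewrite mulr_ge0 // ltW|exact: powR_ge0|lra|].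
pose g b d : R := riesz 1 (b%:R * d%:R * (b%:R + d%:R) / X).
have gC b d : g b d = g d b by rewrite /g; congr riesz; congr (_ / _); ring.
have S1 := double_sum_le N X0.
have S2 := double_integral_le X0 XN.
have E1 := corner_le X0.
rewrite (riesz_double_integral X0) lee_fin in S1.
have S3 : 9 / 40 * X `^ (2 / 3) * betathird R <=
    (\sum_(1 <= b < N) \sum_(1 <= d < N) g b d) +
     (2 * X `^ (2%:R^-1) * betathird R + 2 * X `^ (2%:R^-1) * betathird R).
  rewrite -lee_fin -(riesz_double_integral X0); apply: (le_trans S2).
  by rewrite !EFinD; apply: leeD => //; apply: leeD.
have D0' : 0 <= \sum_(1 <= b < N) g b b by apply: sumr_ge0 => b _; exact: riesz_ge0.
have D1 : \sum_(1 <= b < N) g b b <= X `^ (3^-1).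
  apply: le_trans (@card_lt_le R (X `^ (3^-1)) N (powR_ge0 _ _)).
  rewrite [leRHS]big_mkcond /= big_nat [leRHS]big_nat; apply: ler_sum => b /andP[b1 _].
  have b0 : (0 : R) < b%:R by rewrite ltr0n.
  case: ltP => h.
    rewrite -[leRHS](expr1n _ 2) /g; apply: riesz_le => //.
    by rewrite divr_ge0 ?(ltW X0) // !mulr_ge0 ?addr_ge0.
  rewrite /g riesz0 // ler_pdivlMr // mul1r.
  have -> : X = (X `^ (3^-1)) ^+ 3.
    by rewrite -powR_mulrn ?powR_ge0 // -powRrM mulVf ?powRr1 ?(ltW X0).
  apply: (@le_trans _ _ (b%:R ^+ 3)); first by rewrite lerXn2r ?nnegrE ?powR_ge0 ?(ltW b0).
  by rewrite !exprS expr0 mulr1 mulrA ler_wpM2l ?mulr_ge0 // lerDl.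
have sym := sum_symmetric N gC.
have pE : \sum_(1 <= b < N) \sum_(b.+1 <= d < N) g b d = pair_sum N X.
  by do 2![apply: eq_bigr => ? _]; rewrite /g /farey_poly !(natrD, natrM).
rewrite pE in sym; rewrite -/(g _ _) in S1.
have S1' : \sum_(1 <= b < N) \sum_(1 <= d < N) g b d <= 9 / 40 * X `^ (2 / 3) * betathird R by [].
rewrite sym in S1' S3.
have p1 : X `^ (3^-1) <= X `^ (3 / 5) by apply: ler_powR; [exact: X1|clear; lra].
have p2 : X `^ (2^-1) <= X `^ (3 / 5) by apply: ler_powR; [exact: X1|clear; lra].
have p3 : X `^ (2^-1) * betathird R <= X `^ (3 / 5) * betathird R by rewrite ler_wpM2r // ltW.
clear S1 S2 E1; rewrite mulr2n in S1' S3.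
move: D0' D1 p1 p3 S1' S3; clear.
set D := \sum_(_ <= _ < _) _; set P := pair_sum _ _; move: (betathird R) (X `^ _) (X `^ _) (X `^ _) (X `^ _).
move=> B a c d e *; rewrite ler_norml; apply/andP; split; nra.
Qed.
End PairSum.

(** * The value of [ζ(2)] with a rate *)

Section Basel.
Variable R : realType.

Lemma sin_le_id (x : R) : 0 <= x -> sin x <= x.
Proof.
move=> x0; rewrite -subr_ge0.
have := @ler_of_derive R (fun y => y - sin y) (fun y => 1 - cos y) 0 x x0.
rewrite sin0 subrr; apply => y _; last by rewrite subr_ge0 cos_le1.
Qed.

Let angle n k : R := (2 * k + 1)%:R * pi / (2 ^ n.+2)%:R.

Let angle_gt0 n k : 0 < angle n k.
Proof. by rewrite divr_gt0 ?mulr_gt0 ?pi_gt0 ?ltr0n ?addn1 ?expn_gt0. Qed.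

Let angle_rev (A i : nat) : (i < A)%N ->
  (2 * (A + (A - i.+1)) + 1)%:R = 4 * A%:R - (2 * i + 1)%:R :> R.
Proof.
move=> h; apply/eqP; rewrite eq_sym subr_eq -natrD -natrM eqr_nat; apply/eqP; lia.
Qed.

Let angle_lt n k : (k < 2 ^ n)%N -> angle n k < pi / 2.
Proof.
move=> h; rewrite /angle ltr_pdivrMr ?ltr0n ?expn_gt0 //.
have -> : pi / 2 * (2 ^ n.+2)%:R = (2 * 2 ^ n)%:R * pi :> R.
  by rewrite !expnS !natrM; field.
by rewrite ltr_pM2r ?pi_gt0 // ltr_nat; lia.
Qed.

(* [4 / sin(x)^2 = 1 / sin(x/2)^2 + 1 / sin(pi/2 - x/2)^2] doubles the number of terms. *)
Lemma sum_csc_sqr n : \sum_(0 <= k < 2 ^ n) (sin (angle n k) ^+ 2)^-1 = 2 * 4 ^+ n.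
Proof.
elim: n => [|n IH].
  rewrite big_nat1 expr0 mulr1 /angle muln0 add0n mul1r.
  have -> : pi / (2 ^ 2)%:R = (pi / 2) / 2 :> R by rewrite -mulrA -invfM -natrM.
  have hc := cos_pihalf R.
  have e : pi / 2 = (pi / 2 / 2) *+ 2 :> R by move: (pi / 2) => x; rewrite [_ *+ 2 in RHS]mulr2n; lra.
  rewrite e cos_mulr2n in hc; have c2 := cos2Dsin2 (pi / 2 / 2 : R).
  have -> : sin (pi / 2 / 2) ^+ 2 = 2^-1 :> R by move: hc c2; move: (cos _) (sin _) => x y; lra.
  by rewrite invrK.
rewrite (@big_cat_nat _ _ _ (2 ^ n)) //=; last by rewrite leq_exp2l.
have -> : \sum_(2 ^ n <= i < 2 ^ n.+1) (sin (angle n.+1 i) ^+ 2)^-1 =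
  \sum_(0 <= i < 2 ^ n) (cos (angle n.+1 i) ^+ 2)^-1.
  rewrite -{1}[(2 ^ n)%N]add0n big_addn expnS mul2n -addnn addnK big_nat_rev /= add0n.
  rewrite big_nat [RHS]big_nat; apply: eq_bigr => i /andP[_ hi]; congr (_ ^+ 2)^-1.
  rewrite -(cosN (angle _ _)) -cosBpihalf; congr cos.
  rewrite addnC /angle angle_rev // !expnS !natrM; field.
  by rewrite pnatr_eq0 -lt0n expn_gt0.
rewrite -big_split /= exprS mulrCA -IH mulr_sumr big_nat [RHS]big_nat; apply: eq_bigr => k /andP[_ hk].
have -> : angle n k = angle n.+1 k *+ 2.
  rewrite mulr2n /angle [(2 ^ n.+3)%N]expnS natrM invfM; field.
  by rewrite pnatr_eq0 -lt0n expn_gt0.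
have y0 := angle_gt0 n.+1 k.
have y1 : angle n.+1 k < pi / 2.
  by apply: angle_lt; rewrite (ltn_trans hk) // ltn_exp2l.
have s0 : sin (angle n.+1 k) != 0 by rewrite gt_eqF // sin_gt0_pihalf // y0.
have c0 : cos (angle n.+1 k) != 0.
  by rewrite gt_eqF // cos_gt0_pihalf // y1 andbT (lt_trans _ y0) // oppr_lt0 divr_gt0 ?pi_gt0.
have c2 := cos2Dsin2 (angle n.+1 k); rewrite sin_mulr2n.
move: (sin _) (cos _) s0 c0 c2 => s c s0 c0 c2.
transitivity ((c ^+ 2 + s ^+ 2) / (s ^+ 2 * c ^+ 2)); first by field; rewrite ?s0 ?c0.
by rewrite c2 -mulr_natr; field; rewrite ?s0 ?c0.
Qed.

(** For an angle [y] in []0, pi/2[] the value [1/y^2] lies between [1/sin(y)^2 - 1] and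
    [1/sin(y)^2], and the sum of the latter is known. The lower bound loses 1 for each of the [2^n]
    terms. *)
Lemma sum_odd_inv_sqr n :
  (pi : R) ^+ 2 / 8 - pi ^+ 2 / 16 / 2 ^+ n <= \sum_(0 <= k < 2 ^ n) ((2 * k + 1)%:R ^+ 2)^-1 <= (pi : R) ^+ 2 / 8.
Proof.
have p0 := pi_gt0 R.
have A0 : (0 : R) < 2 ^+ n by rewrite exprn_gt0.
have E4 : 4 ^+ n = 2 ^+ n * 2 ^+ n :> R by rewrite -exprMn -natrM.
have E k : ((2 * k + 1)%:R ^+ 2)^-1 = pi ^+ 2 / (16 * 2 ^+ n * 2 ^+ n) * (angle n k ^+ 2)^-1.
  rewrite /angle !expnS [(2 * (2 * _))%:R]natrM [(2 * 2 ^ n)%:R]natrM natrX.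
  have : 0 < (2 * k + 1)%:R :> R by rewrite ltr0n addn1.
  move: ((2 * k + 1)%:R) (pi : R) (2 ^+ n) p0 A0 => a b c b0 c0 a0; field.
  by rewrite !gt_eqF.
rewrite (eq_bigr _ (fun k _ => E k)) -mulr_sumr.
have c0 : 0 < pi ^+ 2 / (16 * 2 ^+ n * 2 ^+ n) :> R.
  by rewrite divr_gt0 ?exprn_gt0 // !mulr_gt0.
have S := sum_csc_sqr n; rewrite E4 in S.
have bd k : (k < 2 ^ n)%N -> (sin (angle n k) ^+ 2)^-1 - 1 <= (angle n k ^+ 2)^-1 <= (sin (angle n k) ^+ 2)^-1.
  move=> hk; have y0 := angle_gt0 n k; have y1 := angle_lt hk.
  have s0 : 0 < sin (angle n k) by rewrite sin_gt0_pihalf // y0.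
  have c0' : 0 < cos (angle n k).
    by rewrite cos_gt0_pihalf // y1 andbT (lt_trans _ y0) // oppr_lt0 divr_gt0 ?pi_gt0.
  have h1 : sin (angle n k) <= angle n k by rewrite sin_le_id // ltW.
  have h2 : angle n k * cos (angle n k) <= sin (angle n k).
    apply: mulr_cos_le_sin; rewrite (ltW y0) /= (ltW (lt_le_trans y1 _)) //.
    by rewrite ler_pdivrMr // ler_pMr // ler1n.
  have c2 := cos2Dsin2 (angle n k).
  move: (angle n k) (sin _) (cos _) y0 s0 c0' h1 h2 c2 => y s c y0 s0 c0' h1 h2 c2.
  apply/andP; split; last by rewrite lef_pV2 ?posrE ?exprn_gt0 // lerXn2r ?nnegrE // ltW.
  have -> : (s ^+ 2)^-1 - 1 = c ^+ 2 / s ^+ 2.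
    by rewrite (_ : c ^+ 2 = 1 - s ^+ 2); [field; rewrite gt_eqF|rewrite -c2 addrK].
  rewrite ler_pdivrMr ?exprn_gt0 // mulrC ler_pdivlMr ?exprn_gt0 // mulrC -exprMn.
  by rewrite lerXn2r ?nnegrE ?mulr_ge0 ?(ltW y0) ?(ltW s0) ?(ltW c0').
apply/andP; split.
  have -> : pi ^+ 2 / 8 - pi ^+ 2 / 16 / 2 ^+ n =
     pi ^+ 2 / (16 * 2 ^+ n * 2 ^+ n) * (2 * (2 ^+ n * 2 ^+ n) - 2 ^+ n) :> R.
    by move: (pi : R) (2 ^+ n : R) A0 => P A A0'; field; rewrite gt_eqF.
  rewrite ler_wpM2l ?(ltW c0) // -S.
  have -> : 2 ^+ n = \sum_(0 <= k < 2 ^ n) 1 :> R by rewrite sumr_const_nat subn0 natrX.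
  rewrite -sumrB big_nat [leRHS]big_nat; apply: ler_sum => k /andP[_ hk].
  by have /andP[] := bd k hk.
have -> : pi ^+ 2 / 8 = pi ^+ 2 / (16 * 2 ^+ n * 2 ^+ n) * (2 * (2 ^+ n * 2 ^+ n)) :> R.
  by move: (pi : R) (2 ^+ n : R) A0 => P A A0'; field; rewrite gt_eqF.
rewrite ler_wpM2l ?(ltW c0) // -S.
rewrite big_nat [leRHS]big_nat; apply: ler_sum => k /andP[_ hk].
by have /andP[] := bd k hk.
Qed.

Let sum_block M N : (0 < M)%N -> (M <= N)%N -> (N <= 2 * M)%N ->
  0 <= (\sum_(1 <= g < N) (g%:R ^+ 2)^-1 : R) - \sum_(1 <= g < M) (g%:R ^+ 2)^-1 <= M%:R^-1.
Proof.
move=> M0 MN N2; rewrite (@big_cat_nat _ _ _ M) //= addrAC subrr add0r.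
apply/andP; split; first by apply: sumr_ge0 => i _; rewrite invr_ge0 sqr_ge0.
have M1 : (0 : R) < M%:R by rewrite ltr0n.
apply: (@le_trans _ _ (\sum_(M <= g < N) (M%:R ^+ 2)^-1)).
  rewrite big_nat [leRHS]big_nat; apply: ler_sum => i /andP[hi _].
  by rewrite lef_pV2 ?posrE ?exprn_gt0 ?ltr0n ?(leq_trans M0) // lerXn2r ?nnegrE // ler_nat.
rewrite sumr_const_nat -[leLHS]mulr_natr.
have -> : (M%:R ^+ 2)^-1 * (N - M)%:R = M%:R^-1 * ((N - M)%:R / M%:R) :> R.
  by field; rewrite gt_eqF.
by rewrite ler_piMr ?invr_ge0 // ler_pdivrMr // mul1r ler_nat; lia.
Qed.

Lemma sum_even_odd (F : nat -> R) M :
  \sum_(0 <= g < 2 * M) F g = \sum_(0 <= k < M) F (2 * k)%N + \sum_(0 <= k < M) F (2 * k + 1)%N.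
Proof.
elim: M => [|M IH]; first by rewrite muln0 !big_geq ?addr0.
by rewrite mulnS !addSn add0n !big_nat_recr //= IH addn1; ring.
Qed.

(** Let [S(M)] be the sum over [g < M], with [M = 2^n]. Separating even and odd terms gives
    [S(2 M) = S(M)/4] plus the odd sum, while [S(2 M) - S(M)] lies between [0] and [1/M]; hence
    [S(M)] is [4/3] times [pi^2/8] up to [O(1/M)]. A general [N] lies between two such powers. *)
Lemma basel_bound N : (0 < N)%N ->
  `|(\sum_(1 <= g < N) (g%:R ^+ 2)^-1 : R) - pi ^+ 2 / 6| <= 8 / N%:R.
Proof.
move=> N0; pose n := trunc_log 2 N; have /andP[l1 l2] := trunc_log_bounds (isT : (1 < 2)%N) N0.
rewrite -/n in l1 l2.
have M0 : (0 < 2 ^ n)%N by rewrite expn_gt0.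
have N2 : (N <= 2 * 2 ^ n)%N by rewrite -expnS ltnW.
have /andP[b1 b2] := sum_block M0 l1 N2.
have M2 : (2 ^ n <= 2 * 2 ^ n)%N by lia.
have /andP[b3 b4] := sum_block M0 M2 (leqnn _).
have /andP[w1 w2] := sum_odd_inv_sqr n.
have eo : \sum_(1 <= g < 2 * 2 ^ n) (g%:R ^+ 2)^-1 =
    4^-1 * \sum_(1 <= g < 2 ^ n) (g%:R ^+ 2)^-1 + \sum_(0 <= k < 2 ^ n) ((2 * k + 1)%:R ^+ 2)^-1 :> R.
  have e1 (j : nat) : (0 < j)%N -> \sum_(1 <= g < j) (g%:R ^+ 2)^-1 = \sum_(0 <= g < j) (g%:R ^+ 2)^-1 :> R.
    by move=> j0; rewrite [RHS]big_ltn // expr0n invr0 add0r.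
  rewrite !e1 //; last by rewrite muln_gt0.
  rewrite sum_even_odd mulr_sumr; congr (_ + _); apply: eq_bigr => k _.
  by rewrite natrM exprMn invfM; congr (_^-1 * _); rewrite -natrX.
have NM : (2 ^ n)%:R^-1 <= 2 / N%:R :> R.
  rewrite ler_pdivlMr ?ltr0n // mulrC ler_pdivrMr ?ltr0n // -natrM ler_nat; lia.
have p0 := pi_ge0 R; have p4 : pi <= 4 :> R by have := pihalf_lt2 R; lra.
have p2 : pi ^+ 2 <= 16 :> R by rewrite expr2; move: p0 p4; nra.
have t1 : pi ^+ 2 / 16 / 2 ^+ n <= (2 ^ n)%:R^-1 :> R.
  rewrite natrX ler_piMl ?invr_ge0 ?exprn_ge0 // ler_pdivrMr // mul1r //.
have q0 : (0 : R) <= (N%:R)^-1 by rewrite invr_ge0.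
move: b1 b2 b3 b4 w1 w2 eo NM t1 q0.
move: (2 ^ n)%:R^-1 (_ / 2 ^+ n) (N%:R^-1).
move: (\sum_(1 <= g < N) _) (\sum_(1 <= g < 2 * 2 ^ n) _) (\sum_(0 <= k < 2 ^ n) _) (\sum_(1 <= g < 2 ^ n) _) (pi ^+ 2).
move=> a b c d P u v w *; rewrite ler_norml; apply/andP; split; lra.
Qed.
End Basel.

Lemma gcd_eq_dvd g u v : (0 < g)%N -> (0 < u)%N ->
  [&& (g %| u)%N, (g %| v)%N & coprime (v %/ g) (u %/ g)] = (gcdn v u == g).
Proof.
move=> g0 u0; apply/and3P/eqP => [[/dvdnP[p ->] /dvdnP[q ->]]|<-].
  by rewrite !mulnK // /coprime => /eqP h; rewrite -muln_gcdl h mul1n.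
have G0 : (0 < gcdn v u)%N by rewrite gcdn_gt0 u0 orbT.
split; rewrite ?dvdn_gcdl ?dvdn_gcdr //.
by rewrite /coprime -(eqn_pmul2r G0) muln_gcdl !divnK ?dvdn_gcdl ?dvdn_gcdr ?mul1n.
Qed.

Lemma big_nat_zero_tail (V : nmodType) (F : nat -> V) N M : (N <= M)%N ->
  (forall u, (N <= u)%N -> F u = 0) -> \sum_(0 <= u < M) F u = \sum_(0 <= u < N) F u.
Proof.
move=> NM F0; rewrite (@big_cat_nat _ _ _ N) //= [X in _ + X]big_nat [X in _ + X]big1 ?addr0 //.
by move=> i /andP[/F0].
Qed.

(** * From all pairs to coprime pairs *)

Section CoprimeSum.
Variable R : realType.

Definition coprime_sum N (X : R) :=
  \sum_(1 <= b < N) \sum_(b.+1 <= d < N) (coprime d b)%:R * riesz 1 ((farey_poly b d)%:R / X).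

(** The pairs of gcd [g] are the [g]-fold multiples of the coprime pairs, and [farey_poly] is
    homogeneous of degree 3. *)
Lemma pair_sum_gcd N (X : R) : 0 < X -> X <= N%:R ^+ 2 ->
  pair_sum N X = \sum_(1 <= g < N) coprime_sum N (X / g%:R ^+ 3).
Proof.
move=> X0 XN.
(* Extending the weight by zero to all pairs lets both ranges start at [0], so that multiples of [g]
   can be reindexed. *)
pose H b d : R := ((0 < b) && (b < d))%N%:R * riesz 1 ((farey_poly b d)%:R / X).
have H0 u v : (N <= v)%N -> H u v = 0.
  move=> Nv; rewrite /H; case: (ltnP 0 u) => [u0|_] /=; last by rewrite mul0r.
  rewrite riesz0 ?mulr0 // ler_pdivlMr // mul1r (le_trans XN) // -natrX ler_nat.
  apply: leq_trans (farey_poly_ge _ _); apply: leq_trans (leq_pmull _ u0).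
  by rewrite leq_exp2r.
have H1 u v : (N <= u)%N -> H u v = 0.
  move=> Nu; case: (ltnP u v) => h; last by rewrite /H [(u < v)%N]ltnNge h andbF mul0r.
  by apply: H0; apply: leq_trans Nu (ltnW h).
have sumH (a : nat -> nat -> R) :
    \sum_(1 <= b < N) \sum_(b.+1 <= d < N) a b d * riesz 1 ((farey_poly b d)%:R / X) =
    \sum_(0 <= b < N) \sum_(0 <= d < N) a b d * H b d.
  rewrite (big_nat_widenl 1 0) // big_mkcond /=; apply: eq_bigr => b _.
  case: (ltnP 0 b) => b0 /=; last first.
    by rewrite big1 // => d _; rewrite /H ltnNge b0 mul0r mulr0.
  rewrite (big_nat_widenl b.+1 0) // big_mkcond /=; apply: eq_bigr => d _.
  by rewrite /H b0 /=; case: ltnP => _; rewrite ?mul1r ?mul0r ?mulr0.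
have E1 : pair_sum N X = \sum_(0 <= b < N) \sum_(0 <= d < N) 1 * H b d.
  rewrite -sumH; apply: eq_bigr => b _; apply: eq_bigr => d _; by rewrite mul1r.
have E2 g : (0 < g)%N -> coprime_sum N (X / g%:R ^+ 3) =
    \sum_(0 <= b < N) \sum_(0 <= d < N) (gcdn d b == g)%:R * H b d.
  move=> g0; have gN : (N <= g * N)%N by rewrite leq_pmull.
  have gR : g%:R != 0 :> R by rewrite pnatr_eq0 -lt0n.
  pose F u v : R := (coprime (v %/ g) (u %/ g))%:R * H u v.
  transitivity (\sum_(0 <= b < N) \sum_(0 <= d < N) F (g * b)%N (g * d)%N).
    rewrite /coprime_sum (big_nat_widenl 1 0) // big_mkcond /=; apply: eq_bigr => b _.
    case: (ltnP 0 b) => b0 /=; last first.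
      by rewrite big1 // => d _; rewrite /F /H muln_gt0 [(0 < b)%N]ltnNge b0 andbF mul0r mulr0.
    rewrite (big_nat_widenl b.+1 0) // big_mkcond /=; apply: eq_bigr => d _.
    rewrite /F /H muln_gt0 g0 b0 ltn_mul2l g0 !mulKn //=; case: ltnP => _; last by rewrite mul0r mulr0.
    rewrite mul1r; congr (_ * riesz _ _).
    have -> : farey_poly (g * b) (g * d) = (g ^ 3 * farey_poly b d)%N by rewrite /farey_poly; ring.
    by rewrite natrM natrX; field; rewrite gR gt_eqF.
  rewrite -(sum_multiples N (fun u => \sum_(0 <= d < N) F u (g * d)%N) g0).
  rewrite -(big_nat_zero_tail gN); last by move=> u Nu; rewrite big1 // => v _; rewrite H1 // mulr0.
  rewrite big_mkcond /=; apply: eq_bigr => u _.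
  rewrite -(@big_nat_zero_tail _ (fun v => (gcdn v u == g)%:R * H u v) _ _ gN); last by move=> v Nv; rewrite H0 // mulr0.
  rewrite -(sum_multiples N (fun v => F u v) g0) big_mkcond /=.
  case: (posnP u) => [->|u0].
    rewrite dvdn0; apply: eq_bigr => v _; rewrite /F /H /= mul0r !mulr0; by case: ifP.
  case: ifP => gu; last first.
    rewrite big1 // => v _; rewrite -gcd_eq_dvd // gu /=; by rewrite mul0r.
  apply: eq_bigr => v _; rewrite -gcd_eq_dvd // gu /= /F.
  by case: ifP => _ //=; rewrite mul0r.
rewrite E1 [RHS](eq_big_nat _ _ (F2 := fun g => \sum_(0 <= b < N) \sum_(0 <= d < N) (gcdn d b == g)%:R * H b d)); last first.
  by move=> g /andP[g0 _]; apply: E2.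
rewrite [RHS]exchange_big /=; apply: eq_big_nat => b /andP[_ bN].
rewrite [RHS]exchange_big /=; apply: eq_big_nat => d /andP[_ dN].
rewrite -mulr_suml /H; case: (ltnP 0 b) => b0 /=; last by rewrite mul0r !mulr0.
case: (ltnP b d) => bd /=; last by rewrite mul0r !mulr0.
congr (_ * _).
have G0 : (0 < gcdn d b)%N by rewrite gcdn_gt0 b0 orbT.
have GN : (gcdn d b < N)%N by apply: leq_ltn_trans bN; apply: dvdn_leq => //; exact: dvdn_gcdr.
rewrite (big_rem (gcdn d b)) ?mem_index_iota ?G0 //= eqxx big1_seq ?addr0 // => g.
rewrite mem_rem_uniq ?iota_uniq // inE andTb => /andP[/negPf h _]; by rewrite eq_sym h.
Qed.

Lemma powR_le_of_exp (x y : R) (p : R) n : 0 <= x -> 0 <= y -> (0 < n)%N ->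
  x `^ (p * n%:R) <= y ^+ n -> x `^ p <= y.
Proof.
move=> x0 y0 n0; rewrite powRrM powR_mulrn ?powR_ge0 // ler_pXn2r ?nnegrE ?powR_ge0 //.
Qed.

(** [powRn_step] at the exponent [4/5] reads [b <= a (1 - 4 t / 5)], with [a] and [b] the powers at
    [n + 2] and [n + 1] and [t = 1/(n + 2)]; hence [1/b >= (1 + 4 t / 5) / a]. *)
Lemma tail_powRn_step n : n.+2%:R `^ (- (9 / 5)) <= 5 / 4 * (n.+1%:R `^ (- (4 / 5)) - n.+2%:R `^ (- (4 / 5))) :> R.
Proof.
have h : 0 < (4 / 5 : R) < 1 by apply/andP; split; lra.
have := powRn_step n.+1 h.
have x0 : (0 : R) < n.+2%:R by rewrite ltr0n.
have -> : n.+2%:R `^ (4 / 5 - 1) = n.+2%:R `^ (4 / 5) * n.+2%:R^-1 :> R.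
  by rewrite powRD ?powR_inv1 ?(ltW x0) // (gt_eqF x0) implybT.
have -> : n.+2%:R `^ (- (9 / 5)) = (n.+2%:R `^ (4 / 5))^-1 * n.+2%:R^-1 :> R.
  rewrite -powRN -{3}(powRr1 (ltW x0)) -powRN -powRD ?(gt_eqF x0) ?implybT //.
  congr (_ `^ _); lra.
rewrite !powRN.
have t0 : 0 < n.+2%:R^-1 :> R by rewrite invr_gt0.
have t1 : n.+2%:R^-1 <= 1 :> R by rewrite invf_le1 // ler1n.
have a0 : 0 < n.+2%:R `^ (4 / 5) :> R by rewrite powR_gt0.
have b0 : 0 < n.+1%:R `^ (4 / 5) :> R by rewrite powR_gt0 ?ltr0n.
move: (n.+2%:R `^ (4 / 5)) (n.+1%:R `^ (4 / 5)) (n.+2%:R^-1) a0 b0 t0 t1 => a b t a0 b0 t0 t1 H.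
have e1 : a^-1 * (1 + 4 / 5 * t) <= b^-1.
  rewrite mulrC ler_pdivrMr // [leRHS]mulrC ler_pdivlMr //.
  have h1 : (1 + 4 / 5 * t) * b <= (1 + 4 / 5 * t) * (a * (1 - 4 / 5 * t)).
    by rewrite ler_wpM2l //; lra.
  apply: (le_trans h1).
  have -> : (1 + 4 / 5 * t) * (a * (1 - 4 / 5 * t)) = a - a * (4 / 5 * t) ^+ 2 by ring.
  by rewrite lerBlDr lerDl mulr_ge0 ?sqr_ge0 // ltW.
lra.
Qed.

(** The terms [g = 2] and [g = 3] and the power [3^(-4/5)] are bounded by rationals after raising to
    the fifth power, and the terms from [4] on telescope: [29/100 + 14/100 + 5/4 (416/1000) =
    95/100]. *)
Lemma sum_powR95_le N : \sum_(2 <= g < N) g%:R `^ (- (9 / 5)) <= 95 / 100 :> R.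
Proof.
have p2 : 2 `^ (- (9 / 5)) <= 29 / 100 :> R.
  have q : 0 <= 29 / 100 :> R by lra.
  apply: (@powR_le_of_exp _ _ _ 5); [exact: ler0n|exact: q|by []|].
  have -> : - (9 / 5) * 5%:R = - 9%:R :> R by lra.
  rewrite powRN powR_mulrn // -[leLHS]mul1r ler_pdivrMr ?exprn_gt0 //; lra.
have p3 : 3 `^ (- (9 / 5)) <= 14 / 100 :> R.
  have q : 0 <= 14 / 100 :> R by lra.
  apply: (@powR_le_of_exp _ _ _ 5); [exact: ler0n|exact: q|by []|].
  have -> : - (9 / 5) * 5%:R = - 9%:R :> R by lra.
  rewrite powRN powR_mulrn // -[leLHS]mul1r ler_pdivrMr ?exprn_gt0 //; lra.
have p4 : 3 `^ (- (4 / 5)) <= 416 / 1000 :> R.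
  have q : 0 <= 416 / 1000 :> R by lra.
  apply: (@powR_le_of_exp _ _ _ 5); [exact: ler0n|exact: q|by []|].
  have -> : - (4 / 5) * 5%:R = - 4%:R :> R by lra.
  rewrite powRN powR_mulrn // -[leLHS]mul1r ler_pdivrMr ?exprn_gt0 //; lra.
have tail n : \sum_(4 <= g < n.+4) g%:R `^ (- (9 / 5)) <= 5 / 4 * (3 `^ (- (4 / 5)) - n.+3%:R `^ (- (4 / 5))) :> R.
  elim: n => [|n IH]; first by rewrite big_geq // subrr mulr0.
  rewrite big_nat_recr //=; have := tail_powRn_step n.+2; move: IH.
  move: (\sum_(_ <= _ < _) _) (_ `^ _) (_ `^ _) (_ `^ _) (_ `^ _) => a b c d e; lra.
have main n : \sum_(2 <= g < n.+4) g%:R `^ (- (9 / 5)) <= 95 / 100 :> R.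
  rewrite (@big_cat_nat _ _ _ 4) //= big_ltn // big_ltn // big_geq // addr0.
  have := tail n; have : 0 <= n.+3%:R `^ (- (4 / 5)) :> R by apply: powR_ge0.
  lra.
apply: le_trans (main N).
case: (leqP 2 N) => N2; last first.
  by rewrite big_geq ?sumr_ge0 // 1?ltnW // => *; apply: powR_ge0.
rewrite [leRHS](@big_cat_nat _ _ _ N) //=; last by rewrite -addn4 leq_addr.
by rewrite lerDl sumr_ge0 // => *; exact: powR_ge0.
Qed.

(** The divisor [pi^2/6] is [ζ(2)]. *)
Definition kappa := 9 / 80 * betathird R / (pi ^+ 2 / 6).

Lemma kappa_gt0 : 0 < kappa.
Proof.
have q : 0 < 9 / 80 :> R by lra.
by rewrite /kappa divr_gt0 ?(mulr_gt0 q (betathird_gt0 R)) // divr_gt0 ?exprn_gt0 ?pi_gt0.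
Qed.

Lemma coprime_sum0 N X : 0 < X -> X <= 1 -> coprime_sum N X = 0.
Proof.
move=> X0 X1; rewrite /coprime_sum big1_seq // => b /andP[_]; rewrite mem_index_iota => /andP[b1 _].
rewrite big1_seq // => d /andP[_]; rewrite mem_index_iota => /andP[d1 _].
rewrite riesz0 ?mulr0 // ler_pdivlMr // mul1r (le_trans X1) // ler1n.
by rewrite !muln_gt0 addn_gt0 b1 /= (leq_ltn_trans _ d1).
Qed.

(* Sorting all pairs by their gcd [g] determines the coprime sum at [X] from those at
   [X / g^3], [g >= 2]; as the sum of [g^(-9/5)] over [g >= 2] is less than 1, this gives
   the error term by induction on the size of [X], without Möbius inversion. *)
Lemma coprime_sum_asymp : exists2 M, 0 < M & forall (X : R) N, 0 < X -> X <= N%:R ^+ 2 ->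
  `|coprime_sum N X - kappa * X `^ (2 / 3)| <= M * X `^ (3 / 5).
Proof.
have [K K0 HK] := pair_sum_asymp R; have k0 := kappa_gt0.
pose M := 20 * (K + 8 * kappa).
have M0 : 0 < M by rewrite mulr_gt0 // addr_gt0 // mulr_gt0.
exists M => //.
(* For [g >= 2] one has [g^3 >= 8], so [X / g^3] falls into the range of the previous [n]. *)
have main n : forall (X : R) N, 0 < X -> X <= N%:R ^+ 2 -> X <= 8 ^+ n ->
  `|coprime_sum N X - kappa * X `^ (2 / 3)| <= M * X `^ (3 / 5).
  have small (X : R) N : 0 < X -> X <= 1 -> 
      `|coprime_sum N X - kappa * X `^ (2 / 3)| <= M * X `^ (3 / 5).
    move=> X0 X1; rewrite coprime_sum0 // sub0r normrN (ger0_norm (mulr_ge0 (ltW k0) (powR_ge0 _ _))).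
    apply: ler_pM; [exact: ltW|exact: powR_ge0|rewrite /M; lra|].
    by apply: ger_powR; [rewrite X0|lra].
  elim: n => [|n IH] X N X0 XN Xn; first exact: small.
  case: (leP X 1) => X1; first exact: small.
  have N1 : (1 < N)%N.
    rewrite ltnNge; apply/negP => h; have : N%:R ^+ 2 <= 1 :> R by rewrite expr_le1 ?ler0n // lern1.
    by move=> /(le_trans XN); rewrite leNgt X1.
  have N0 : (0 < N)%N by apply: ltnW.
  have pg (g : nat) p : (0 < g)%N -> (X / g%:R ^+ 3) `^ p = X `^ p * g%:R `^ (- (3 * p)).
    move=> g0; have gR : (0 : R) < g%:R by rewrite ltr0n.
    rewrite powRM ?invr_ge0 ?exprn_ge0 ?(ltW X0) //; congr (_ * _).
    rewrite -powR_mulrn ?(ltW gR) // -powRN -powRrM; congr (_ `^ _); ring.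
  have E := pair_sum_gcd X0 XN; rewrite (big_ltn N1) expr1n divr1 in E.
  have P := HK X N X0 XN; have B := @basel_bound R N N0.
  have S1 : `|\sum_(2 <= g < N) coprime_sum N (X / g%:R ^+ 3) -
        kappa * X `^ (2 / 3) * \sum_(2 <= g < N) (g%:R ^+ 2)^-1| <= M * X `^ (3 / 5) * (95 / 100).
    rewrite mulr_sumr -sumrB; apply: le_trans (ler_norm_sum _ _ _) _.
    apply: (@le_trans _ _ (M * X `^ (3 / 5) * \sum_(2 <= g < N) g%:R `^ (- (9 / 5)))); last first.
      by rewrite ler_wpM2l ?sum_powR95_le // mulr_ge0 ?powR_ge0 // ltW.
    rewrite mulr_sumr big_nat [leRHS]big_nat; apply: ler_sum => g /andP[g2 gN].
    have g0 : (0 < g)%N by apply: ltnW.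
    have gR : (0 : R) < g%:R by rewrite ltr0n.
    have g3 : 0 < g%:R ^+ 3 :> R by rewrite exprn_gt0.
    have := IH (X / g%:R ^+ 3) N; rewrite !pg // => H.
    have -> : (g%:R ^+ 2)^-1 = g%:R `^ (- (3 * (2 / 3))) :> R.
      rewrite (_ : 3 * (2 / 3) = 2%:R) ?powRN ?powR_mulrn ?(ltW gR) //; lra.
    have -> : - (9 / 5) = - (3 * (3 / 5)) :> R by lra.
    rewrite !mulrA; rewrite !mulrA in H; apply: H.
    - by rewrite divr_gt0.
    - rewrite ler_pdivrMr // (le_trans XN) // ler_peMr ?sqr_ge0 // -natrX ler1n expn_gt0 g0 //.
    - rewrite ler_pdivrMr // (le_trans Xn) // exprSr ler_wpM2l ?exprn_ge0 // -natrX ler_nat.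
      by rewrite (@leq_exp2r 2 g 3).
  (* The truncation of [ζ(2)] at [N] costs [X^(2/3) / N], and [N] is at least [X^(1/2)]. *)
  have S2 : kappa * X `^ (2 / 3) * `|\sum_(1 <= g < N) (g%:R ^+ 2)^-1 - pi ^+ 2 / 6| <= 8 * kappa * X `^ (3 / 5).
    apply: (@le_trans _ _ (kappa * X `^ (2 / 3) * (8 / N%:R))).
      by rewrite ler_wpM2l // mulr_ge0 ?powR_ge0 // ltW.
    have -> : kappa * X `^ (2 / 3) * (8 / N%:R) = 8 * kappa * (X `^ (2 / 3) / N%:R) by ring.
    apply: ler_wpM2l; first by rewrite mulr_ge0 // ltW.
    rewrite ler_pdivrMr ?ltr0n //.
    apply: (@le_trans _ _ (X `^ (3 / 5) * X `^ (2^-1))).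
      rewrite -powRD ?(gt_eqF X0) ?implybT //; apply: ler_powR; first exact: ltW.
      lra.
    rewrite ler_wpM2l ?powR_ge0 // (@powR_le_of_exp _ _ _ 2) ?(ltW X0) ?ler0n //.
    by rewrite mulVf ?powRr1 ?(ltW X0).
  rewrite (big_ltn N1) expr1n invr1 in S2.
  have kE : 9 / 80 * betathird R = kappa * (pi ^+ 2 / 6).
    by rewrite /kappa mulfVK // gt_eqF // mulr_gt0 ?exprn_gt0 ?pi_gt0.
  rewrite kE in P.
  have kx0 : 0 <= kappa * X `^ (2 / 3) by rewrite mulr_ge0 ?powR_ge0 // ltW.
  rewrite -(ger0_norm kx0) -normrM in S2.
  rewrite E in P.
  have ME : M * X `^ (3 / 5) = M * X `^ (3 / 5) * (95 / 100) + K * X `^ (3 / 5) + 8 * kappa * X `^ (3 / 5).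
    by rewrite /M; field.
  rewrite ME.
  have -> : coprime_sum N X - kappa * X `^ (2 / 3) =
    - (\sum_(2 <= g < N) coprime_sum N (X / g%:R ^+ 3) -
        kappa * X `^ (2 / 3) * \sum_(2 <= g < N) (g%:R ^+ 2)^-1) +
    (coprime_sum N X + \sum_(2 <= i < N) coprime_sum N (X / i%:R ^+ 3) - kappa * (pi ^+ 2 / 6) * X `^ (2 / 3)) +
    - (kappa * X `^ (2 / 3) * (1 + \sum_(2 <= i < N) i%:R ^- 2 - pi ^+ 2 / 6)) by ring.
  apply: le_trans (ler_normD _ _) _; apply: lerD; last by rewrite normrN.
  by apply: le_trans (ler_normD _ _) _; apply: lerD; rewrite ?normrN.
move=> X N X0 XN; apply: (main (Num.bound X)) => //.
apply: (le_trans (ltW (archi_boundP (ltW X0)))); rewrite -natrX ler_nat.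
by apply: ltnW; apply: ltn_expl.
Qed.
End CoprimeSum.

(** * Asymptotics for one order of the denominators *)

Section FareySum.
Variables (R : realType) (eta : R -> R) (e0 L : R).
Hypothesis e0_gt0 : 0 < e0.
Hypothesis eta_ge : forall y : R, e0 <= eta y.
Hypothesis eta_lip : forall y z : R, `|eta y - eta z| <= L * `|y - z|.
Notation mu := (@lebesgue_measure R).

Lemma riesz_scale (x z : R) : 0 < x -> riesz x z = x ^+ 2 * riesz 1 (z / x).
Proof.
move=> x0; rewrite /riesz -exprMn; congr (_ ^+ 2).
by rewrite maxr_pMr ?(ltW x0) // mulr0 mulrBr mulr1 mulrC mulfVK // gt_eqF.
Qed.

Lemma powR_divr (x t p : R) : 0 <= x -> 0 < t -> (x / t) `^ p = x `^ p * t `^ (- p).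
Proof.
move=> x0 t0; rewrite powRM ?invr_ge0 ?(ltW t0) //; congr (_ * _).
by rewrite -[t^-1]powR_inv1 ?(ltW t0) // -powRrM mulN1r.
Qed.

Lemma powR_comp_continuous (p : R) : continuous (fun y => eta y `^ p).
Proof.
have eg t : 0 < eta t by exact: lt_le_trans (eta_ge t).
have ce : continuous eta := lipschitz_continuous eta_lip.
move=> y; have dp : derivable (fun t : R => t `^ p) (eta y) 1.
  by apply: derivable_powR; rewrite in_itv /= eg.
have cp : {for eta y, continuous (fun t : R => t `^ p)}.
  exact/differentiable_continuous/derivable1_diffP.
exact: (@continuous_comp _ _ _ eta (fun t : R => t `^ p) y (ce y) cp).
Qed.

(** At a fixed position [y] the integrand of the mean is [x^2] times the coprime sum at [x / eta y].
    The lower bound [e0] makes its error uniform in [y], so the expansion can be integrated. *)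
Lemma farey_sum_asymp : exists2 C : R, 0 <= C & forall N x, 0 < x -> x <= N%:R ^+ 2 * e0 ->
  `|farey_sum eta N x - kappa R * (\int[mu]_(y in `[0, 1]) (eta y `^ (- (2 / 3)))) * x `^ (8 / 3)|
    <= C * x `^ (13 / 5).
Proof.
have eg t : 0 < eta t by exact: lt_le_trans (eta_ge t).
have [C1 C10 H1] := farey_sum_mean e0_gt0 eta_ge eta_lip.
have [M M0 HM] := coprime_sum_asymp R.
exists (C1 + M * e0 `^ (- (3 / 5))); first by rewrite addr_ge0 // mulr_ge0 ?powR_ge0 // ltW.
move=> N x x0 xN.
pose G y := \sum_(1 <= b < N) \sum_(b.+1 <= d < N) (coprime d b)%:R * riesz x ((farey_poly b d)%:R * eta y).
have W_lip b d y z : `|riesz x ((farey_poly b d)%:R * eta y) - riesz x ((farey_poly b d)%:R * eta z)|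
    <= 2 * x * (farey_poly b d)%:R * L * `|y - z|.
  have P0 : 0 <= (farey_poly b d)%:R :> R by [].
  apply: le_trans (riesz_lip (ltW x0) (mulr_ge0 P0 (ltW (eg y))) (mulr_ge0 P0 (ltW (eg z)))) _.
  rewrite -mulrBr normrM ger0_norm // mulrA -[leRHS]mulrA; apply: ler_wpM2l => //.
  by rewrite !mulr_ge0 // ltW.
have iW0 b d : mu.-integrable `[0, 1] (EFin \o (fun y => riesz x ((farey_poly b d)%:R * eta y))).
  by apply: continuous_itv_integrable; exact: lipschitz_continuous (W_lip b d).
have mI : measurable (`[0, 1]%classic : set (measurableTypeR R)) by exact: measurable_itv.
have iW b d : mu.-integrable `[0, 1] (EFin \o (fun y => (coprime d b)%:R * riesz x ((farey_poly b d)%:R * eta y))).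
  have h := integrableZl mI (coprime d b)%:R (iW0 b d).
  by apply: (eq_integrable mI _ _ _ h) => y _; rewrite /= EFinM.
have [iG EG] : mu.-integrable `[0, 1] (EFin \o G) /\ \int[mu]_(y in `[0, 1]) G y = farey_mean eta N x.
  have inner b := Rintegral_sum_seq (index_iota b.+1 N) mI (iW b).
  have [h1 h2] := Rintegral_sum_seq (index_iota 1 N) mI (fun b => (inner b).1).
  split=> //; rewrite h2; apply: eq_bigr => b _; rewrite (inner b).2; apply: eq_bigr => d _.
  by rewrite RintegralZl //; exact: iW0.
pose g y := kappa R * x `^ (8 / 3) * eta y `^ (- (2 / 3)).
have ig0 : mu.-integrable `[0, 1] (EFin \o (fun y => eta y `^ (- (2 / 3)))).
  by apply: continuous_itv_integrable; exact: powR_comp_continuous.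
have ig : mu.-integrable `[0, 1] (EFin \o g).
  have h := integrableZl mI (kappa R * x `^ (8 / 3)) ig0.
  by apply: (eq_integrable mI _ _ _ h) => y _; rewrite /= EFinM.
have eg' : \int[mu]_(y in `[0, 1]) g y = kappa R * (\int[mu]_(y in `[0, 1]) (eta y `^ (- (2 / 3)))) * x `^ (8 / 3).
  by rewrite /g RintegralZl // mulrAC.
have D : `|\int[mu]_(y in `[0, 1]) G y - \int[mu]_(y in `[0, 1]) g y| <= M * e0 `^ (- (3 / 5)) * x `^ (13 / 5).
  rewrite -RintegralB //.
  have m1 : mu (`[0, 1]%classic) = 1%:E by rewrite /= lebesgue_measure_itv /= lte01 oppr0 adde0.
  have iGg : mu.-integrable `[0, 1] (EFin \o (fun y => G y - g y)).
    by apply: (eq_integrable mI _ _ _ (integrableB mI iG ig)) => y _; rewrite /= EFinB.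
  have := @Rintegral_near_cst R (fun y => G y - g y) `[0, 1]%classic 0 (M * e0 `^ (- (3 / 5)) * x `^ (13 / 5)) 1 mI m1 iGg.
  rewrite mul0r subr0 mulr1; apply.
  move=> y _; rewrite subr0.
  have Xy0 : 0 < x / eta y by rewrite divr_gt0.
  have -> : G y = x ^+ 2 * coprime_sum N (x / eta y).
    rewrite /G /coprime_sum mulr_sumr; apply: eq_bigr => b _; rewrite mulr_sumr; apply: eq_bigr => d _.
    rewrite riesz_scale // mulrCA; congr (_ * (_ * riesz 1 _)).
    by field; rewrite !gt_eqF.
  have -> : g y = x ^+ 2 * (kappa R * (x / eta y) `^ (2 / 3)).
    rewrite /g powR_divr ?(ltW x0) //.
    have -> : x `^ (8 / 3) = x ^+ 2 * x `^ (2 / 3).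
      by rewrite -(powR_mulrn _ (ltW x0)) -powRD ?(gt_eqF x0) ?implybT //; congr (_ `^ _); lra.
    ring.
  rewrite -mulrBr normrM ger0_norm ?sqr_ge0 //.
  apply: (@le_trans _ _ (x ^+ 2 * (M * (x / eta y) `^ (3 / 5)))).
    rewrite ler_wpM2l ?sqr_ge0 //; apply: HM => //; rewrite ler_pdivrMr //.
    by apply: le_trans xN _; rewrite ler_wpM2l ?sqr_ge0.
  apply: (@le_trans _ _ (x ^+ 2 * (M * (x / e0) `^ (3 / 5)))).
    rewrite ler_wpM2l ?sqr_ge0 // ler_wpM2l ?(ltW M0) //.
    apply: ge0_ler_powR; rewrite ?nnegrE ?(ltW Xy0) ?divr_ge0 ?(ltW x0) ?(ltW e0_gt0) //.
    by apply: ler_wpM2l; [exact: ltW|rewrite lef_pV2 ?posrE].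
  rewrite powR_divr ?(ltW x0) //.
  rewrite -(powR_mulrn _ (ltW x0)) le_eqVlt; apply/orP; left; apply/eqP.
  have -> : x `^ (13 / 5) = x `^ 2%:R * x `^ (3 / 5).
    by rewrite -powRD ?(gt_eqF x0) ?implybT //; congr (_ `^ _); lra.
  ring.
rewrite -eg' mulrDl; apply: le_trans (ler_distD (farey_mean eta N x) _ _) _.
by apply: lerD; [exact: H1|rewrite -EG].
Qed.
End FareySum.

(** * Laplace transforms *)

Section Laplace.
Variable R : realType.
Notation mu := (@lebesgue_measure R).

Lemma is_derive_cong (f : R -> R) (x a b : R) : is_derive x 1 f a -> a = b -> is_derive x 1 f b.
Proof. by move=> h <-. Qed.

Lemma norm_sin_le (b : R) : `|sin b| <= `|b|.
Proof.
wlog b0 : b / 0 <= b => [H|].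
  by case: (leP 0 b) => [/H//|/ltW h]; rewrite -normrN -sinN -[leRHS]normrN H // oppr_ge0.
rewrite [leRHS]ger0_norm //; case: (leP b 1) => b1; last by rewrite (le_trans (sin_max _)) // ltW.
rewrite ler_norml sin_le_id // andbT; apply: (@le_trans _ _ 0); first by rewrite oppr_le0.
by rewrite sin_ge0_pi // b0 /= (le_trans b1) // (le_trans (pihalf_ge1 R)) // ler_pdivrMr // ler_peMr ?pi_ge0 // ler1n.
Qed.

Lemma one_sub_cosE (b : R) : 1 - cos b = 2 * sin (b / 2) ^+ 2.
Proof.
have e : b = (b / 2) *+ 2 by rewrite [_ *+ 2 in RHS]mulr2n; lra.
rewrite {1}e cos_mulr2n; have := cos2Dsin2 (b / 2).
by move: (cos _) (sin _) => x y h; lra.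
Qed.

Lemma one_sub_cos_le (b : R) : 1 - cos b <= b ^+ 2 / 2.
Proof.
rewrite one_sub_cosE; have := norm_sin_le (b / 2).
rewrite -(@ler_pXn2r _ 2) ?nnegrE // !real_normK ?num_real // => h.
have -> : b ^+ 2 / 2 = 2 * (b / 2) ^+ 2 by field.
by rewrite ler_wpM2l.
Qed.

Lemma norm_sin_sub_le (b : R) : `|sin b - b| <= b ^+ 2.
Proof.
wlog b0 : b / 0 <= b => [H|].
  case: (leP 0 b) => [/H//|/ltW h].
  by rewrite -normrN opprB -sqrrN; have := H (- b); rewrite sinN opprK addrC oppr_ge0; apply.
rewrite distrC ger0_norm ?subr_ge0 ?sin_le_id // -subr_ge0.
have := @ler_of_derive R (fun y => y ^+ 2 - (y - sin y)) (fun y => 2 * y - (1 - cos y)) 0 b b0.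
rewrite sin0 expr0n subr0 subrr; apply => y /andP[y0 _].
  have d := is_deriveB (is_derive_exprn 1 y) (is_deriveB (is_derive_id y 1) (is_derive_sin y)).
  apply: is_derive_cong d _; rewrite expr1; ring.
rewrite subr_ge0 one_sub_cosE.
have h := norm_sin_le (y / 2); have h1 : `|sin (y / 2)| <= 1 by exact: sin_max.
have -> : sin (y / 2) ^+ 2 = `|sin (y / 2)| * `|sin (y / 2)| by rewrite -normrM -expr2 ger0_norm ?sqr_ge0.
rewrite (ger0_norm (divr_ge0 y0 _)) // in h.
have : `|sin (y / 2)| * `|sin (y / 2)| <= (y / 2) * 1 by apply: ler_pM.
lra.
Qed.

Lemma expR_sub_bounds (a : R) : a <= expR a - 1 <= a * expR a.
Proof.
rewrite lerBrDl expR_ge1Dx /=; have := expR_ge1Dx (- a).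
rewrite -(ler_pM2r (expR_gt0 a)) -expRD addNr expR0 mulrDl mul1r; lra.
Qed.

Lemma norm_expR_sub1 (a : R) : `|expR a - 1| <= `|a| * expR `|a|.
Proof.
have /andP[h1 h2] := expR_sub_bounds a; have e0 := expR_gt0 a.
have [a0|a0] := leP 0 a; first by rewrite !ger0_norm //; apply: le_trans h1.
have n0 : expR a - 1 <= 0 by apply: (le_trans h2); rewrite mulr_le0_ge0 // ltW.
rewrite (ler0_norm n0) (ltr0_norm a0); apply: (@le_trans _ _ (- a)); first by lra.
by rewrite ler_peMr ?oppr_ge0 ?(ltW a0) // -expR0 ler_expR oppr_ge0 ltW.
Qed.

Lemma norm_expR_sub2 (a : R) : `|expR a - 1 - a| <= a ^+ 2 * expR `|a|.
Proof.
have /andP[h1 h2] := expR_sub_bounds a.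
rewrite ger0_norm ?subr_ge0 //; apply: (@le_trans _ _ (a * (expR a - 1))); first by lra.
apply: le_trans (ler_norm _) _; rewrite normrM -[a ^+ 2]real_normK ?num_real // expr2 -mulrA.
by rewrite ler_wpM2l // norm_expR_sub1.
Qed.

(** The second-order remainder of the complex exponential at [a + i b], split into real and
    imaginary parts. *)
Lemma cexp_remainder (a b : R) :
  `|expR a * cos b - 1 - a| + `|expR a * sin b - b| <= 3 * expR `|a| * (a ^+ 2 + b ^+ 2).
Proof.
have E1 : 1 <= expR `|a| by rewrite -[leLHS]expR0 ler_expR.
have Ea : expR a <= expR `|a| by rewrite ler_expR ler_norm.
have e0 := expR_ge0 a; have E0 := expR_ge0 `|a|.
have a2 := sqr_ge0 a; have b2 := sqr_ge0 b.
have p : `|expR a * cos b - 1 - a| <= a ^+ 2 * expR `|a| + expR `|a| * b ^+ 2.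
  have -> : expR a * cos b - 1 - a = (expR a - 1 - a) - expR a * (1 - cos b) by ring.
  apply: le_trans (ler_normB _ _) _; apply: lerD; first exact: norm_expR_sub2.
  rewrite normrM (ger0_norm e0) ger0_norm ?subr_ge0 ?cos_le1 //.
  apply: ler_pM => //.
  by apply: le_trans (one_sub_cos_le b) _; lra.
have q : `|expR a * sin b - b| <= expR `|a| * (`|a| * `|b|) + expR `|a| * b ^+ 2.
  have -> : expR a * sin b - b = (expR a - 1) * sin b + (sin b - b) by ring.
  apply: le_trans (ler_normD _ _) _; apply: lerD.
    rewrite normrM mulrA [expR _ * `|a|]mulrC.
    by apply: ler_pM => //; [exact: norm_expR_sub1|exact: norm_sin_le].
  by apply: le_trans (norm_sin_sub_le b) _; rewrite ler_peMl.
have ab : `|a| * `|b| <= a ^+ 2 + b ^+ 2.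
  rewrite -(real_normK (num_real a)) -(real_normK (num_real b)).
  by have := sqr_ge0 (`|a| - `|b|); have := normr_ge0 a; have := normr_ge0 b; nra.
have : expR `|a| * (`|a| * `|b|) <= expR `|a| * (a ^+ 2 + b ^+ 2) by rewrite ler_wpM2l.
have h3 : expR `|a| * b ^+ 2 <= expR `|a| * (a ^+ 2 + b ^+ 2) by rewrite ler_wpM2l // lerDr.
move: p q h3; clear; lra.
Qed.

(** The phase [th] serves both components of [exp(- z u)] with [z = s + i t]: [th = 0] gives the
    real part, [th = pi/2] the imaginary part. *)
Definition damped_cos (s t th u : R) := expR (- (s * u)) * cos (t * u + th).
Definition damped_sin (s t th u : R) := expR (- (s * u)) * sin (t * u + th).

(** First-order expansion in the parameters [s] and [t]; the addition formulas reduce it to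
    [cexp_remainder] at [- a u] and [b u]. *)
Lemma damped_cos_remainder s t th a b u :
  `|damped_cos (a + s) (b + t) th u - damped_cos s t th u
    - (a * (- u * damped_cos s t th u) + b * (- u * damped_sin s t th u))|
  <= 3 * (a ^+ 2 + b ^+ 2) * (u ^+ 2 * expR (`|a| * `|u| - s * u)).
Proof.
rewrite /damped_cos /damped_sin.
have -> : - ((a + s) * u) = - (a * u) + - (s * u) by ring.
have -> : (b + t) * u + th = (t * u + th) + b * u by ring.
rewrite expRD cosD; have := cexp_remainder (- (a * u)) (b * u).
rewrite normrN normrM sqrrN !exprMn -mulrDl expRD.
have c1 : `|cos (t * u + th)| <= 1 by exact: cos_max.
have s1 : `|sin (t * u + th)| <= 1 by exact: sin_max.
have e0 := expR_ge0 (- (s * u)).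
move: (expR (- (s * u))) (expR (- (a * u))) (expR (`|a| * `|u|)) (cos (t * u + th)) (sin (t * u + th)) (cos (b * u)) (sin (b * u)) c1 s1 e0 => e ea E c sn cb sb c1 s1 e0 H.
have -> : ea * e * (c * cb - sn * sb) - e * c - (a * (- u * (e * c)) + b * (- u * (e * sn))) =
  e * (c * (ea * cb - 1 - - (a * u)) - sn * (ea * sb - b * u)) by ring.
rewrite normrM (ger0_norm e0).
have -> : 3 * (a ^+ 2 + b ^+ 2) * (u ^+ 2 * (E * e)) = e * (3 * E * ((a ^+ 2 + b ^+ 2) * u ^+ 2)) by ring.
apply: ler_wpM2l => //; apply: le_trans H; apply: le_trans (ler_normB _ _) _.
by rewrite !normrM; apply: lerD; rewrite ler_piMl.
Qed.

Lemma is_derive_affine (t th u : R) : is_derive u 1 (fun x => t * x + th) t.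
Proof.
have h : is_derive u 1 (fun x : R => t * x) t.
  by have := @is_deriveZ R R R^o id t u 1 1 _; rewrite [t *: 1]mulr1; apply; exact: is_derive_id.
by have := is_deriveD h (is_derive_cst th u 1); rewrite addr0.
Qed.

(** Damped combinations of cosine and sine are closed under differentiation, so primitives within
    the family are found by solving for [p] and [q]. *)
Lemma is_derive_damped (s t th p q u : R) :
  is_derive u 1 (fun u => expR (- (s * u)) * (p * cos (t * u + th) + q * sin (t * u + th)))
   (expR (- (s * u)) * ((t * q - s * p) * cos (t * u + th) - (t * p + s * q) * sin (t * u + th))).
Proof.
have a1 := is_derive_affine (- s) 0 u; have a2 := is_derive_affine t th u.
have d1 : is_derive u 1 (fun u => expR (- s * u + 0)) (expR (- s * u + 0) * - s).
  exact: (@is_derive1_comp _ expR (fun x => - s * x + 0)).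
have d2 : is_derive u 1 (fun u => cos (t * u + th)) (- sin (t * u + th) * t).
  exact: (@is_derive1_comp _ cos (fun x => t * x + th)).
have d3 : is_derive u 1 (fun u => sin (t * u + th)) (cos (t * u + th) * t).
  exact: (@is_derive1_comp _ sin (fun x => t * x + th)).
rewrite (_ : (fun u => expR (- (s * u)) * _) =
  (fun u => expR (- s * u + 0) * (p * cos (t * u + th) + q * sin (t * u + th)))); last first.
  by apply/funext => v; rewrite addr0 mulNr.
have d4 := is_deriveD (is_deriveZ p d2) (is_deriveZ q d3).
apply: is_derive_cong (is_deriveM d1 d4) _; rewrite addr0 mulNr /GRing.scale /=.
have -> : (p \*: (fun v : R => cos (t * v + th)) + q \*: (fun v : R => sin (t * v + th))) u =
  p * cos (t * u + th) + q * sin (t * u + th) by [].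
ring.
Qed.

Lemma cvg_damped (s C : R) (F : R -> R) : 0 < s -> (forall u, `|F u| <= C * expR (- (s * u))) ->
  F u @[u --> +oo] --> 0.
Proof.
move=> s0 H.
have C0 : 0 <= C by have := H 0; rewrite mulr0 oppr0 expR0 mulr1; apply: le_trans.
apply/cvgrPdist_le => e e0; near=> u.
rewrite sub0r normrN; apply: le_trans (H u) _.
have u0 : 0 < u by near: u; apply: nbhs_pinfty_gt; exact: num_real.
have hu : C / (e * s) <= u by near: u; apply: nbhs_pinfty_ge; exact: num_real.
rewrite expRN ler_pdivrMr ?expR_gt0 //.
have h := expR_ge1Dx (s * u).
apply: (@le_trans _ _ (e * (s * u))); last by rewrite ler_wpM2l ?(ltW e0) // (le_trans _ h) // lerDr.
by rewrite mulrA mulrC -ler_pdivrMr // mulr_gt0.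
Unshelve. all: by end_near. Qed.

Lemma damped_FTC (f F : R -> R) (s C l : R) : 0 < s ->
  (forall u, 0 <= f u) -> (forall u : R, is_derive u 1 F (f u)) -> continuous f ->
  (forall u, `|F u| <= C * expR (- (s * u))) ->
  (\int[mu]_(u in `[l, +oo[) (f u)%:E = (- F l)%:E)%E.
Proof.
move=> s0 f0 dF cf bF.
rewrite (@ge0_continuous_FTC2y R f F l 0) -?EFinB ?sub0r //.
- exact: continuous_subspaceT.
- exact: cvg_damped bF.
- apply: cvg_at_right_filter; apply: differentiable_continuous; apply/derivable1_diffP.
  by have [] := dF l.
- by move=> x _; rewrite derive1E; have [_ ->] := dF x.
Qed.

Lemma continuous_damped (s t th p q : R) :
  continuous (fun u => expR (- (s * u)) * (p * cos (t * u + th) + q * sin (t * u + th))).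
Proof.
move=> u; apply: differentiable_continuous; apply/derivable1_diffP.
by have [] := is_derive_damped s t th p q u.
Qed.

Lemma damped_cosE s t th : damped_cos s t th =
  (fun u => expR (- (s * u)) * (1 * cos (t * u + th) + 0 * sin (t * u + th))).
Proof. by apply/funext => u; rewrite mul1r mul0r addr0. Qed.

Lemma continuous_damped_cos s t th : continuous (damped_cos s t th).
Proof. rewrite damped_cosE; exact: continuous_damped. Qed.

Lemma measurable_damped_cos s t th (D : set R) : measurable_fun D (damped_cos s t th).
Proof. apply: measurable_funTS; apply: continuous_measurable_fun; exact: continuous_damped_cos. Qed.

Lemma damped_sinE s t th : damped_sin s t th = (fun u => damped_cos s t (th - pi / 2) u).
Proof. by apply/funext => u; rewrite /damped_sin /damped_cos addrA cosBpihalf. Qed.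

Lemma norm_damped_cos s t th u : `|damped_cos s t th u| <= expR (- (s * u)).
Proof.
by rewrite normrM (ger0_norm (expR_ge0 _)) ler_piMr ?expR_ge0 // cos_max.
Qed.

Lemma integral_expR_half_line (s l : R) : 0 < s ->
  (\int[mu]_(u in `[l, +oo[) (expR (- (s * u)))%:E = (expR (- (s * l)) / s)%:E)%E.
Proof.
move=> s0.
have sn : s != 0 by rewrite gt_eqF.
have E r u : expR (- (s * u)) * (r * cos (0 * u + 0) + 0 * sin (0 * u + 0)) = r * expR (- (s * u)).
  by rewrite !mul0r !addr0 cos0 mulr1 mulrC.
rewrite (_ : expR (- (s * l)) / s = - (expR (- (s * l)) * (- s^-1 * cos (0 * l + 0) + 0 * sin (0 * l + 0)))); last by rewrite E; field.
apply: (@damped_FTC (fun u => expR (- (s * u))) (fun u => expR (- (s * u)) * (- s^-1 * cos (0 * u + 0) + 0 * sin (0 * u + 0))) s s^-1) => //.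
- move=> u; apply: is_derive_cong (is_derive_damped s 0 0 (- s^-1) 0 u) _.
  by rewrite !mul0r !addr0 cos0 sin0; field.
- rewrite (_ : (fun u => _) = (fun u => expR (- (s * u)) * (1 * cos (0 * u + 0) + 0 * sin (0 * u + 0)))).
    exact: continuous_damped.
  by apply/funext => u; rewrite E mul1r.
- by move=> u; rewrite E normrM normrN !ger0_norm ?expR_ge0 ?invr_ge0 // ltW.
Qed.

Lemma integrable_expR_half_line (s l : R) : 0 < s ->
  mu.-integrable `[l, +oo[ (EFin \o (fun u => expR (- (s * u)))).
Proof.
move=> s0; apply/integrableP; split.
  apply/measurable_EFinP; apply: measurable_funTS; apply: continuous_measurable_fun.
  rewrite (_ : (fun u => _) = damped_cos s 0 0); first exact: continuous_damped_cos.
  by apply/funext => u; rewrite /damped_cos mul0r addr0 cos0 mulr1.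
under eq_integral do rewrite /= ger0_norm ?expR_ge0 //.
by rewrite integral_expR_half_line // ltry.
Qed.

Lemma dominated_half_line (g : R -> R) (s l K : R) : 0 < s ->
  measurable_fun (`[l, +oo[ : set (measurableTypeR R)) g ->
  (forall u, l <= u -> `|g u| <= K * expR (- (s * u))) ->
  mu.-integrable `[l, +oo[ (EFin \o g) /\
  `|\int[mu]_(u in `[l, +oo[) g u| <= K * (expR (- (s * l)) / s).
Proof.
move=> s0 mg H.
have K0 : 0 <= K.
  by have := le_trans (normr_ge0 _) (H l (lexx l)); rewrite pmulr_lge0 // expR_gt0.
have mI : measurable (`[l, +oo[%classic : set (measurableTypeR R)) by exact: measurable_itv.
have iE := integrable_expR_half_line l s0.
have iK : mu.-integrable `[l, +oo[ (EFin \o (fun u => K * expR (- (s * u)))).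
  by apply: (eq_integrable mI _ _ _ (integrableZl mI K iE)) => u _; rewrite /= EFinM.
have ig : mu.-integrable `[l, +oo[ (EFin \o g).
  apply: le_integrable iK => //; first exact/measurable_EFinP.
  move=> u; rewrite /= in_itv /= andbT => lu.
  by rewrite lee_fin [leRHS]ger0_norm ?mulr_ge0 ?expR_ge0 // H.
split=> //; apply: le_trans (le_normr_Rintegral mI ig) _.
have -> : K * (expR (- (s * l)) / s) = \int[mu]_(u in `[l, +oo[) (K * expR (- (s * u))).
  by rewrite RintegralZl // /Rintegral integral_expR_half_line.
apply: le_Rintegral => //; first exact: integrable_norm ig.
by move=> u; rewrite /= in_itv /= andbT => lu; exact: H.
Qed.

Lemma integral_damped_cos (s t th l : R) : 0 < s ->
  \int[mu]_(u in `[l, +oo[) damped_cos s t th u =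
  expR (- (s * l)) * (s * cos (t * l + th) - t * sin (t * l + th)) / (s ^+ 2 + t ^+ 2).
Proof.
move=> s0; have q0 : 0 < s ^+ 2 + t ^+ 2 by rewrite ltr_pwDl ?exprn_gt0 ?sqr_ge0.
have sn : s != 0 by rewrite gt_eqF.
have mI : measurable (`[l, +oo[%classic : set (measurableTypeR R)) by exact: measurable_itv.
have iE := integrable_expR_half_line l s0.
have [iC _] : mu.-integrable `[l, +oo[ (EFin \o damped_cos s t th) /\
    `|\int[mu]_(u in `[l, +oo[) damped_cos s t th u| <= 1 * (expR (- (s * l)) / s).
  apply: dominated_half_line => //; first exact: measurable_damped_cos.
  by move=> u _; rewrite mul1r norm_damped_cos.
pose Fc u := expR (- (s * u)) * (- (s / (s ^+ 2 + t ^+ 2)) * cos (t * u + th) + (t / (s ^+ 2 + t ^+ 2)) * sin (t * u + th)).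
pose Fe u := expR (- (s * u)) * (- s^-1 * cos (0 * u + 0) + 0 * sin (0 * u + 0)).
have FeE u : Fe u = - (s^-1 * expR (- (s * u))).
  by rewrite /Fe !mul0r !addr0 cos0 mulr1 mulrC mulNr.
have dc u : is_derive (u : R) 1 Fc (damped_cos s t th u).
  apply: is_derive_cong (is_derive_damped s t th (- (s / (s ^+ 2 + t ^+ 2))) (t / (s ^+ 2 + t ^+ 2)) u) _.
  by rewrite /damped_cos; congr (_ * _); field; rewrite gt_eqF.
have de u : is_derive (u : R) 1 Fe (expR (- (s * u))).
  apply: is_derive_cong (is_derive_damped s 0 0 (- s^-1) 0 u) _.
  by rewrite !mul0r !addr0 cos0 sin0; field.
(* The fundamental theorem of calculus on a half line wants a nonnegative integrand. *)
have H : (\int[mu]_(u in `[l, +oo[) (damped_cos s t th u + expR (- (s * u)))%:E = (- (Fc l + Fe l))%:E)%E.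
  apply: (@damped_FTC _ (fun u => Fc u + Fe u) s (`|s / (s ^+ 2 + t ^+ 2)| + `|t / (s ^+ 2 + t ^+ 2)| + s^-1)) => //.
  - move=> u; have c1 := cos_geN1 (t * u + th).
    have -> : damped_cos s t th u + expR (- (s * u)) = expR (- (s * u)) * (cos (t * u + th) + 1).
      by rewrite /damped_cos mulrDr mulr1.
    by apply: mulr_ge0; [exact: expR_ge0|move: c1; move: (cos _) => x c1; lra].
  - move=> u; apply: continuousD; first exact: continuous_damped_cos.
    by apply: differentiable_continuous; apply/derivable1_diffP; have [] := is_derive_damped s 0 0 1 0 u; rewrite (_ : (fun u0 => expR (- (s * u0)) * _) = (fun u => expR (- (s * u)))) //; apply/funext => v; rewrite !mul0r !addr0 cos0 !mulr1.
  - move=> u; rewrite FeE [leRHS]mulrDl; apply: le_trans (ler_normB _ _) _; apply: lerD; last first.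
      by rewrite ger0_norm // mulr_ge0 ?expR_ge0 // invr_ge0 ltW.
    rewrite /Fc normrM (ger0_norm (expR_ge0 _)) mulrC ler_wpM2r ?expR_ge0 //.
    apply: le_trans (ler_normD _ _) _; rewrite !normrM normrN.
    by rewrite -!normrM normrM [X in _ + X <= _]normrM; apply: lerD; rewrite ler_piMr ?cos_max ?sin_max.
have E : \int[mu]_(u in `[l, +oo[) damped_cos s t th u + \int[mu]_(u in `[l, +oo[) expR (- (s * u)) = - (Fc l + Fe l).
  by rewrite -RintegralD // /Rintegral H.
have E2 : \int[mu]_(u in `[l, +oo[) expR (- (s * u)) = expR (- (s * l)) / s.
  by rewrite /Rintegral integral_expR_half_line.
move: E; rewrite E2 FeE /Fc => E.
have -> : \int[mu]_(u in `[l, +oo[) damped_cos s t th u =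
  (\int[mu]_(u in `[l, +oo[) damped_cos s t th u + expR (- (s * l)) / s) - expR (- (s * l)) / s by rewrite addrK.
by rewrite E; field; rewrite sn gt_eqF.
Qed.
End Laplace.

(** * Laplace transforms of a complex variable *)

Section ComplexLaplace.
Variables (R : realType) (u0 : R).
Notation mu := (@lebesgue_measure R).
Notation D := (`[u0, +oo[%classic : set (measurableTypeR R)).
Notation Re := (@complex.Re R).
Notation Im := (@complex.Im R).

Lemma norm_complex_le (x y : R) : `|x +i* y| <= (`|x| + `|y|)%:C.
Proof.
rewrite normc_def /= lecR; apply: (@le_trans _ _ (Num.sqrt ((`|x| + `|y|) ^+ 2))); last first.
  by rewrite sqrtr_sqr ger0_norm // addr_ge0.
rewrite ler_wsqrtr // sqrrD !real_normK ?num_real // lerD2r lerDl.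
by rewrite mulrn_wge0 // mulr_ge0.
Qed.

Lemma norm_Re_lt (z : R[i]) (e : R) : `|z| < e%:C -> `|Re z| < e /\ `|Im z| < e.
Proof.
case: z => x y; rewrite normc_def /= ltcR => h.
split; apply: le_lt_trans h; rewrite -[leLHS]sqrtr_sqr ler_wsqrtr // ?lerDl ?lerDr sqr_ge0 //.
Qed.

Definition real_laplace (phi : R -> R) s t th := \int[mu]_(u in D) (phi u * damped_cos s t th u).

(* The integral of [phi u * exp (- z u)]; the phase [pi / 2] turns [cos] into [- sin]. *)
Definition laplace (phi : R -> R) (z : R[i]) : R[i] :=
  real_laplace phi (Re z) (Im z) 0 +i* real_laplace phi (Re z) (Im z) (pi / 2).

Definition exp_bounded (al K : R) (phi : R -> R) :=
  measurable_fun D phi /\ forall u, u0 <= u -> `|phi u| <= K * expR (al * u).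

Let mD : measurable D. Proof. exact: measurable_itv. Qed.

Lemma exp_bounded_integral (al K : R) phi s t th : exp_bounded al K phi -> al < s ->
  mu.-integrable D (EFin \o (fun u => phi u * damped_cos s t th u)) /\
  `|real_laplace phi s t th| <= K * (expR (- ((s - al) * u0)) / (s - al)).
Proof.
move=> [mp bp] als; apply: dominated_half_line; first by rewrite subr_gt0.
- by apply: measurable_funM => //; exact: measurable_damped_cos.
- move=> u hu; rewrite normrM.
  have -> : - ((s - al) * u) = al * u + - (s * u) by ring.
  by rewrite expRD mulrA; apply: ler_pM => //; [exact: bp|exact: norm_damped_cos].
Qed.

Lemma real_laplaceD al K K' phi psi s t th : exp_bounded al K phi -> exp_bounded al K' psi -> al < s ->
  real_laplace (fun u => phi u + psi u) s t th = real_laplace phi s t th + real_laplace psi s t th.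
Proof.
move=> h1 h2 als; rewrite /real_laplace -RintegralD //.
- by apply: eq_Rintegral => u _; rewrite mulrDl.
- by have [] := exp_bounded_integral t th h1 als.
- by have [] := exp_bounded_integral t th h2 als.
Qed.

Lemma real_laplaceZ al K phi c s t th : exp_bounded al K phi -> al < s ->
  real_laplace (fun u => c * phi u) s t th = c * real_laplace phi s t th.
Proof.
move=> h1 als; rewrite /real_laplace -RintegralZl //.
- by apply: eq_Rintegral => u _; rewrite mulrA.
- by have [] := exp_bounded_integral t th h1 als.
Qed.

Lemma exp_boundedD al K K' phi psi : exp_bounded al K phi -> exp_bounded al K' psi ->
  exp_bounded al (K + K') (fun u => phi u + psi u).
Proof.
move=> [m1 b1] [m2 b2]; split; first exact: measurable_funD.
by move=> u hu; rewrite mulrDl; apply: le_trans (ler_normD _ _) _; apply: lerD; [exact: b1|exact: b2].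
Qed.

Lemma exp_boundedZ al K phi c : exp_bounded al K phi -> exp_bounded al (`|c| * K) (fun u => c * phi u).
Proof.
move=> [m1 b1]; split; first exact: measurable_funM.
by move=> u hu; rewrite normrM -mulrA ler_wpM2l // b1.
Qed.

Lemma laplaceD al K K' phi psi z : exp_bounded al K phi -> exp_bounded al K' psi -> al < Re z ->
  laplace (fun u => phi u + psi u) z = laplace phi z + laplace psi z.
Proof. by move=> h1 h2 h; rewrite /laplace !(real_laplaceD _ _ h1 h2 h). Qed.

Lemma laplaceZ al K phi c z : exp_bounded al K phi -> al < Re z ->
  laplace (fun u => c * phi u) z = c%:C * laplace phi z.
Proof.
move=> h1 h; rewrite /laplace !(real_laplaceZ _ _ _ h1 h); apply/eqP.
by rewrite eq_complex /= !mul0r subr0 addr0 !eqxx.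
Qed.

Lemma laplace_norm al K phi z : exp_bounded al K phi -> al < Re z ->
  `|laplace phi z| <= (2 * (K * (expR (- ((Re z - al) * u0)) / (Re z - al))))%:C.
Proof.
move=> h1 h; apply: le_trans (norm_complex_le _ _) _; rewrite lecR [2 * _]mulr_natl mulr2n.
by apply: lerD; [case: (exp_bounded_integral (Im z) 0 h1 h)|case: (exp_bounded_integral (Im z) (pi / 2) h1 h)].
Qed.

Lemma norm_le_shift (u : R) : u0 <= u -> `|u| <= u + 2 * `|u0|.
Proof.
move=> h; have [u1|u1] := leP 0 u; first by rewrite ger0_norm // lerDl mulr_ge0.
rewrite ltr0_norm // ltr0_norm; [lra|exact: le_lt_trans u1].
Qed.

Lemma norm_le_expR (e u : R) : 0 < e -> `|u| <= e^-1 * expR (e * `|u|).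
Proof.
move=> e0; rewrite -[leLHS]mul1r -(@mulVf _ e) ?gt_eqF // -mulrA ler_wpM2l ?invr_ge0 ?(ltW e0) //.
by apply: le_trans (expR_ge1Dx _); rewrite lerDr.
Qed.

Lemma sqr_le_expR (e u : R) : 0 < e -> u ^+ 2 <= 2 / e ^+ 2 * expR (e * `|u|).
Proof.
move=> e0; have h : 0 <= e * `|u| by rewrite mulr_ge0 // ltW.
have := expR_ge1Dxn 1 h; rewrite (_ : (1.+1`!)%:R = 2) // exprMn real_normK ?num_real // => H.
have -> : u ^+ 2 = 2 / e ^+ 2 * (e ^+ 2 * u ^+ 2 / 2) by field; rewrite gt_eqF.
by rewrite ler_wpM2l ?divr_ge0 ?sqr_ge0 //; apply: le_trans H; rewrite lerDr.
Qed.

(** The factor [u] costs an arbitrarily small exponent; [|u0|] enters because the half line may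
    contain negative numbers. *)
Lemma exp_bounded_id al K e phi : 0 < e -> exp_bounded al K phi ->
  exp_bounded (al + e) (K * (e^-1 * expR (2 * e * `|u0|))) (fun u => - u * phi u).
Proof.
move=> e0 [m1 b1]; split; first by apply: measurable_funM => //; exact: measurable_funN.
move=> u hu; rewrite normrM normrN mulrC.
apply: (@le_trans _ _ (K * expR (al * u) * (e^-1 * expR (e * (u + 2 * `|u0|))))).
  apply: ler_pM => //; first exact: b1.
  apply: le_trans (norm_le_expR u e0) _; rewrite ler_wpM2l ?invr_ge0 ?(ltW e0) // ler_expR.
  by rewrite ler_wpM2l ?(ltW e0) // norm_le_shift.
rewrite le_eqVlt; apply/orP; left; apply/eqP.
rewrite (_ : e * (u + 2 * `|u0|) = e * u + 2 * e * `|u0|); last by ring.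
by rewrite [(al + e) * u]mulrDl !expRD; field; rewrite gt_eqF.
Qed.

(** Differentiation under the integral sign in quantitative form: the remainder of the kernel is
    integrated with a bound uniform in the phase [th]. *)
Lemma real_laplace_remainder al K phi s t : exp_bounded al K phi -> al < s ->
  exists e M, [/\ 0 < e, 0 <= M & forall a b th r, `|a| <= r -> `|b| <= r -> r < e ->
   `|real_laplace phi (a + s) (b + t) th - real_laplace phi s t th -
     (a * real_laplace (fun u => - u * phi u) s t th + b * real_laplace (fun u => - u * phi u) s t (th - pi / 2))|
   <= M * r ^+ 2].
Proof.
move=> hb als; have [mp bp] := hb.
have K0 : 0 <= K.
  by have := le_trans (normr_ge0 _) (bp u0 (lexx u0)); rewrite pmulr_lge0 // expR_gt0.
(* The exponent [e] is spent twice, on [u^2] and on [exp(|a| |u|)], and [s - al - 2 e] remains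
   positive. *)
pose e := (s - al) / 4; have e0 : 0 < e by rewrite divr_gt0 ?subr_gt0.
pose K2 := 12 * K / e ^+ 2 * expR (4 * e * `|u0|).
have K20 : 0 <= K2 by rewrite !mulr_ge0 ?invr_ge0 ?sqr_ge0 ?expR_ge0.
exists e, (K2 * (expR (- ((s - al - 2 * e) * u0)) / (s - al - 2 * e))).
have dpos : 0 < s - al - 2 * e by rewrite /e; lra.
split => //; first exact: mulr_ge0 K20 (divr_ge0 (expR_ge0 _) (ltW dpos)).
move=> a b th r ar br re.
have h1 : exp_bounded (al + e) _ (fun u => - u * phi u) := exp_bounded_id e0 hb.
have als1 : al + e < s by rewrite /e; lra.
have als2 : al < a + s.
  have : - e < a by rewrite (lt_le_trans _ (lerNnormlW ar)) // ltrN2.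
  by rewrite /e; lra.
have [i1 _] := exp_bounded_integral (b + t) th hb als2.
have [i2 _] := exp_bounded_integral t th hb als.
have [i3 _] := exp_bounded_integral t th h1 als1.
have [i4 _] := exp_bounded_integral t (th - pi / 2) h1 als1.
pose g u := phi u * damped_cos (a + s) (b + t) th u - phi u * damped_cos s t th u -
  (a * (- u * phi u * damped_cos s t th u) + b * (- u * phi u * damped_cos s t (th - pi / 2) u)).
have i3' : mu.-integrable D (EFin \o (fun u => a * (- u * phi u * damped_cos s t th u))).
  by apply: (eq_integrable mD _ _ _ (integrableZl mD a i3)) => u _; rewrite /= EFinM.
have i4' : mu.-integrable D (EFin \o (fun u => b * (- u * phi u * damped_cos s t (th - pi / 2) u))).
  by apply: (eq_integrable mD _ _ _ (integrableZl mD b i4)) => u _; rewrite /= EFinM.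
have i5 : mu.-integrable D (EFin \o (fun u => phi u * damped_cos (a + s) (b + t) th u - phi u * damped_cos s t th u)).
  by apply: (eq_integrable mD _ _ _ (integrableB mD i1 i2)) => u _; rewrite /= EFinB.
have i6 : mu.-integrable D (EFin \o (fun u => (a * (- u * phi u * damped_cos s t th u) + b * (- u * phi u * damped_cos s t (th - pi / 2) u)))).
  by apply: (eq_integrable mD _ _ _ (integrableD mD i3' i4')) => u _; rewrite /= EFinD.
have -> : real_laplace phi (a + s) (b + t) th - real_laplace phi s t th -
     (a * real_laplace (fun u => - u * phi u) s t th + b * real_laplace (fun u => - u * phi u) s t (th - pi / 2)) =
  \int[mu]_(u in D) g u.
  by rewrite /g RintegralB // RintegralB // RintegralD // !RintegralZl.
have mg : measurable_fun D g.
  apply: measurable_funB; first by apply: measurable_funB; apply: measurable_funM => //; exact: measurable_damped_cos.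
  have mu' : measurable_fun D (fun u => - u * phi u) by case: h1.
  by apply: measurable_funD; apply: measurable_funM => //; apply: measurable_funM => //; exact: measurable_damped_cos.
have r0 : 0 <= r by apply: le_trans ar.
have bg u : u0 <= u -> `|g u| <= (r ^+ 2 * K2) * expR (- ((s - al - 2 * e) * u)).
  move=> hu.
  have -> : g u = phi u * (damped_cos (a + s) (b + t) th u - damped_cos s t th u -
    (a * (- u * damped_cos s t th u) + b * (- u * damped_sin s t th u))).
    by rewrite /g damped_sinE; ring.
  rewrite normrM.
  apply: (@le_trans _ _ (K * expR (al * u) * (3 * (a ^+ 2 + b ^+ 2) * (u ^+ 2 * expR (`|a| * `|u| - s * u))))).
    by apply: ler_pM => //; [exact: bp|exact: damped_cos_remainder].
  apply: (@le_trans _ _ (K * expR (al * u) * (3 * (r ^+ 2 + r ^+ 2) * (2 / e ^+ 2 * expR (e * (u + 2 * `|u0|)) * expR (e * (u + 2 * `|u0|) - s * u))))).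
    rewrite ler_wpM2l ?mulr_ge0 ?expR_ge0 //.
    have sq (x : R) : `|x| <= r -> x ^+ 2 <= r ^+ 2.
      by move=> h; rewrite -real_normK ?num_real // lerXn2r ?nnegrE.
    have ush := norm_le_shift hu.
    apply: ler_pM.
    - by rewrite mulr_ge0 // addr_ge0 ?sqr_ge0.
    - by rewrite mulr_ge0 ?sqr_ge0 ?expR_ge0.
    - by apply: ler_wpM2l => //; apply: lerD; exact: sq.
    - apply: ler_pM.
      + exact: sqr_ge0.
      + exact: expR_ge0.
      + apply: le_trans (sqr_le_expR u e0) _; rewrite ler_wpM2l ?divr_ge0 ?sqr_ge0 // ler_expR.
        by rewrite ler_wpM2l // ltW.
      + by rewrite ler_expR lerD2r; apply: ler_pM => //; apply: le_trans ar (ltW re).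
  rewrite le_eqVlt; apply/orP; left; apply/eqP; rewrite /K2.
  have e1 : expR (e * (u + 2 * `|u0|)) * expR (e * (u + 2 * `|u0|) - s * u) * expR (al * u) =
     expR (4 * e * `|u0|) * expR (- ((s - al - 2 * e) * u)).
    by rewrite -!expRD; congr expR; ring.
  transitivity (12 * K / e ^+ 2 * r ^+ 2 * (expR (e * (u + 2 * `|u0|)) * expR (e * (u + 2 * `|u0|) - s * u) * expR (al * u))).
    by field; rewrite gt_eqF.
  by rewrite e1; field; rewrite gt_eqF.
have [_] := dominated_half_line dpos mg bg.
by rewrite -[_ * K2 * _]mulrA mulrC.
Qed.

(** The two components are the remainders at the phases [0] and [pi/2]. Since the transform at phase
    [- pi/2] is minus that at [pi/2], the real linear map that they give is multiplication by a
    complex number. *)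
Lemma laplace_derive al K phi z : exp_bounded al K phi -> al < Re z ->
  is_derive (z : R[i]^o) 1 (laplace phi : R[i]^o -> R[i]^o) (laplace (fun u => - u * phi u) z).
Proof.
move=> hb h; have [e [M [e0 M0 H]]] := real_laplace_remainder (Im z) hb h.
apply: (@is_derive_quadratic R[i] (laplace phi) z _ (2 * M)%:C e%:C); rewrite ?ltcR ?lecR ?mulr_ge0 //.
case=> a b hlt.
pose r := Num.sqrt (a ^+ 2 + b ^+ 2).
have hr : `|a +i* b| = r%:C by rewrite normc_def.
have re : r < e by move: hlt; rewrite hr ltcR.
have ar : `|a| <= r by rewrite -sqrtr_sqr ler_wsqrtr // lerDl sqr_ge0.
have br : `|b| <= r by rewrite -sqrtr_sqr ler_wsqrtr // lerDr sqr_ge0.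
have H0 := H a b 0 r ar br re; have H1 := H a b (pi / 2) r ar br re.
case: z h H H0 H1 => s t /= h H H0 H1; rewrite hr /laplace /=.
set psi := (fun u => - u * phi u) in H0 H1 *.
have E0 : real_laplace psi s t (0 - pi / 2) = - real_laplace psi s t (pi / 2).
  have -> : - real_laplace psi s t (pi / 2) = -1 * real_laplace psi s t (pi / 2) by rewrite mulN1r.
  have als1 : al + (s - al) / 2 < s by lra.
  have hp := exp_bounded_id (divr_gt0 (_ : 0 < s - al) (ltr0n _ 2)) hb.
  rewrite /real_laplace -RintegralZl //; last first.
    by have [] := exp_bounded_integral t (pi / 2) (hp ltac:(by rewrite subr_gt0)) als1.
  apply: eq_Rintegral => u _; rewrite /damped_cos sub0r cosDpihalf cosBpihalf; ring.
rewrite E0 in H0; rewrite subrr in H1.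
have -> : (real_laplace phi (a + s) (b + t) 0 +i* real_laplace phi (a + s) (b + t) (pi / 2) -
   (real_laplace phi s t 0 +i* real_laplace phi s t (pi / 2)) -
   (a +i* b) * (real_laplace psi s t 0 +i* real_laplace psi s t (pi / 2))) =
  (real_laplace phi (a + s) (b + t) 0 - real_laplace phi s t 0 - (a * real_laplace psi s t 0 + b * - real_laplace psi s t (pi / 2)))
  +i* (real_laplace phi (a + s) (b + t) (pi / 2) - real_laplace phi s t (pi / 2) -
      (a * real_laplace psi s t (pi / 2) + b * real_laplace psi s t 0)).
  apply/eqP; rewrite eq_complex /=; apply/andP; split; apply/eqP; ring.
apply: le_trans (norm_complex_le _ _) _.
rewrite -rmorphXn -rmorphM lecR -mulrA [2 * _]mulr_natl mulr2n.
by apply: lerD.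
Qed.

(** The common building block: in the variable [u = ln x] the Riesz weight combines the tails with
    [w = 0, 1, 2], and the main term is the tail with [w = - 2/3]. *)
Definition exp_tail (l w u : R) := \1_(`[l, +oo[%classic : set R) u * expR (- (w * (u - l))).

Lemma exp_tail_bounded l w : exp_bounded (- w) (expR (w * l)) (exp_tail l w).
Proof.
split.
  apply: measurable_funM; first exact: measurable_indic.
  rewrite (_ : (fun u => expR _) = (fun u => expR (w * l) * damped_cos w 0 0 u)).
    by apply: measurable_funM => //; exact: measurable_damped_cos.
  apply/funext => u; rewrite /damped_cos mul0r addr0 cos0 mulr1 -expRD; congr expR; ring.
move=> u _; rewrite normrM (ger0_norm (expR_ge0 _)) -expRD.
rewrite (_ : w * l + - w * u = - (w * (u - l))); last by ring.
rewrite ler_piMl ?expR_ge0 // indicE; by case: (_ \in _); rewrite ?normr1 ?normr0.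
Qed.

Lemma real_laplace_tail l w s t th : u0 <= l -> 0 < s + w ->
  real_laplace (exp_tail l w) s t th =
  expR (- (s * l)) * ((s + w) * cos (t * l + th) - t * sin (t * l + th)) / ((s + w) ^+ 2 + t ^+ 2).
Proof.
move=> ul sw.
have mL : measurable (`[l, +oo[%classic : set (measurableTypeR R)) by exact: measurable_itv.
transitivity (\int[mu]_(u in `[l, +oo[) (expR (w * l) * damped_cos (s + w) t th u)).
  rewrite /real_laplace Rintegral_mkcond [RHS]Rintegral_mkcond; apply: eq_Rintegral => u _.
  rewrite !patchE !mem_setE !in_itv /= !andbT /exp_tail indicE mem_setE in_itv /= andbT.
  case: (leP l u) => lu; last by rewrite mul0r mul0r; case: ifP.
  rewrite (le_trans ul lu) mul1r /damped_cos !mulrA -!expRD; congr (expR _ * _); ring.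
rewrite RintegralZl //; last first.
  have [] // := @dominated_half_line R (damped_cos (s + w) t th) (s + w) l 1 sw.
    exact: measurable_damped_cos.
  by move=> u _; rewrite mul1r norm_damped_cos.
rewrite integral_damped_cos // !mulrA -expRD; congr (expR _ * _ / _); ring.
Qed.

(** The numerator is [exp(- z l)]. *)
Lemma laplace_tail l w z : u0 <= l -> 0 < Re z + w ->
  laplace (exp_tail l w) z =
  (damped_cos (Re z) (Im z) 0 l +i* damped_cos (Re z) (Im z) (pi / 2) l) / (z + w%:C).
Proof.
case: z => s t ul /= sw; rewrite /laplace !real_laplace_tail //=.
have q0 : 0 < (s + w) ^+ 2 + t ^+ 2 by rewrite ltr_pwDl ?exprn_gt0 ?sqr_ge0.
have zn : (s +i* t) + w%:C != 0.
  by apply/eqP => /eqP; rewrite eq_complex /= => /andP[/eqP h _]; rewrite h ltxx in sw.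
apply: (mulIf zn); rewrite mulfVK // /damped_cos !addr0 sinDpihalf cosDpihalf.
apply/eqP; rewrite eq_complex /=; apply/andP; split; apply/eqP.
  by field; rewrite gt_eqF.
by field; rewrite gt_eqF.
Qed.
End ComplexLaplace.

(** * Continuation of a Dirichlet series from its Riesz mean *)

Section Continuation.
Variables (R : realType) (u0 : R) (I : choiceType) (Lam : I -> R) (J : R -> {fset I}) (C K : R).
Notation Re := (@complex.Re R).
Notation Im := (@complex.Im R).

Let A (x : R) := \sum_(i <- J x) riesz x (Lam i).

Hypothesis u0_le0 : u0 <= 0.
Hypothesis Lam_ge : forall i, expR u0 <= Lam i.
(** [J x] may contain more than the indices with [Lam i < x], since the weight of the others is
    zero. *)
Hypothesis J_spec : forall x i, Lam i < x -> i \in J x.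
Hypothesis C_gt0 : 0 < C.
Hypothesis A_asymp : forall u, u0 <= u ->
  `|A (expR u) - C * expR (8 / 3 * u)| <= K * expR (13 / 5 * u).

Let Lam_gt0 i : 0 < Lam i. Proof. exact: lt_le_trans (expR_gt0 _) (Lam_ge i). Qed.

Let K_ge0 : 0 <= K.
Proof.
by have := le_trans (normr_ge0 _) (A_asymp (lexx u0)); rewrite pmulr_lge0 // expR_gt0.
Qed.

Lemma sum_fset_le (F : I -> R) (S T : {fset I}) : (forall i, 0 <= F i) -> (S `<=` T)%fset ->
  \sum_(i <- S) F i <= \sum_(i <- T) F i.
Proof.
move=> F0 ST; rewrite (big_fsetID _ (mem S)) /= [leRHS](big_fsetID _ (mem S)) /=.
have -> : [fset x in S | x \in S]%fset = [fset x in T | x \in S]%fset.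
  apply/fsetP => x; rewrite !inE /=; case: (boolP (x \in S)) => xS; rewrite ?andbF // andbT.
  by rewrite (fsubsetP ST).
by rewrite lerD2l (_ : [fset x in S | x \notin S]%fset = fset0) ?big_seq_fset0 ?sumr_ge0 //;
  apply/fsetP => x; rewrite !inE /= andbN.
Qed.

(** Lets means with different cut-offs be compared over a common finite set. *)
Lemma sum_riesz_fset x (S : {fset I}) : (forall i, Lam i < x -> i \in S) ->
  \sum_(i <- S) riesz x (Lam i) = A x.
Proof.
move=> HS.
have H (T : {fset I}) : (forall i, Lam i < x -> i \in T) ->
    \sum_(i <- T) riesz x (Lam i) = \sum_(i <- (S `|` J x)%fset | Lam i < x) riesz x (Lam i).
  move=> HT; rewrite (bigID (fun i => Lam i < x)) /= [X in _ + X]big1 ?addr0; last first.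
    by move=> i; rewrite -leNgt; exact: riesz0.
  rewrite -[LHS]big_filter -[RHS]big_filter; apply: perm_big.
  apply: uniq_perm; rewrite ?filter_uniq ?fset_uniq // => i; rewrite !mem_filter !inE.
  by case: (ltP (Lam i) x) => // h; rewrite HT // J_spec // orbT.
by rewrite (H S HS) /A (H (J x)) // => i; exact: J_spec.
Qed.

Let A_mono x y : x <= y -> A x <= A y.
Proof.
move=> xy; have sx : \sum_(i <- (J x `|` J y)%fset) riesz x (Lam i) = A x.
  by apply: sum_riesz_fset => i h; rewrite inE J_spec.
have sy : \sum_(i <- (J x `|` J y)%fset) riesz y (Lam i) = A y.
  by apply: sum_riesz_fset => i h; rewrite inE (J_spec h) orbT.
rewrite -sx -sy; apply: ler_sum => i _.
have h : Num.max 0 (x - Lam i) <= Num.max 0 (y - Lam i).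
  by rewrite ge_max !le_max lexx /= lerD2r xy orbT.
by rewrite /riesz lerXn2r ?nnegrE // le_max lexx.
Qed.

Let A_ge0 x : 0 <= A x.
Proof. by apply: sumr_ge0 => i _; exact: riesz_ge0. Qed.

(** With [x = exp u], the measure [A(x) x^(-s-3) dx] becomes [a u exp(- s u) du]. *)
Let a u := A (expR u) * expR (- (2 * u)).

Let measurable_a : measurable_fun (`[u0, +oo[%classic : set (measurableTypeR R)) a.
Proof.
apply: measurable_funM.
  apply: measurable_funTS; apply: nondecreasing_measurable => // x y xy.
  by apply: A_mono; rewrite ler_expR.
rewrite (_ : (fun u => expR _) = damped_cos 2 0 0); first exact: measurable_damped_cos.
by apply/funext => u; rewrite /damped_cos mul0r addr0 cos0 mulr1.
Qed.

Let tail0 u : exp_tail 0 (- (2 / 3)) u = if 0 <= u then expR (2 / 3 * u) else 0 :> R.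
Proof.
rewrite /exp_tail indicE mem_setE in_itv /= andbT subr0 mulNr opprK.
by case: ifP => _; rewrite ?mul1r ?mul0r.
Qed.

Let phi u := a u + (- C) * exp_tail 0 (- (2 / 3)) u.

Let phi_bounded : exp_bounded u0 (3 / 5) (K + C) phi.
Proof.
split.
  apply: measurable_funD => //; apply: measurable_funM => //.
  by have [] := exp_tail_bounded u0 0 (- (2 / 3) : R).
move=> u hu; have H := A_asymp hu.
have e1 : expR (13 / 5 * u) * expR (- (2 * u)) = expR (3 / 5 * u).
  by rewrite -expRD; congr expR; field.
have e2 : expR (8 / 3 * u) * expR (- (2 * u)) = expR (2 / 3 * u).
  by rewrite -expRD; congr expR; field.
have H2 : `|a u - C * expR (2 / 3 * u)| <= K * expR (3 / 5 * u).
  rewrite -e1 -e2 !mulrA -mulrBl normrM (ger0_norm (expR_ge0 (- _))).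
  by rewrite ler_wpM2r ?expR_ge0.
rewrite /phi tail0; case: ifP => h.
  by rewrite mulNr; apply: le_trans H2 _; rewrite ler_wpM2r ?expR_ge0 // lerDl ltW.
(* For [u < 0] nothing is subtracted, but there [exp(2/3 u)] is below [exp(3/5 u)]. *)
rewrite mulr0 addr0 -[a u](subrK (C * expR (2 / 3 * u))); apply: le_trans (ler_normD _ _) _.
rewrite [leRHS]mulrDl; apply: lerD => //; rewrite ger0_norm ?mulr_ge0 ?expR_ge0 ?(ltW C_gt0) //.
rewrite ler_wpM2l ?(ltW C_gt0) // ler_expR; move/negbT: h; rewrite -ltNge; lra.
Qed.

(** As [3/5 = 2/3 - 1/15], the error exceeds its share of [exp(2/3 u)] by [exp(- u/15)], which is
    largest at [u0]. *)
Let K2 := K * expR (- (u0 / 15)) + C.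

Let a_bounded : exp_bounded u0 (2 / 3) K2 a.
Proof.
split=> // u hu; have H := A_asymp hu.
have e1 : expR (13 / 5 * u) * expR (- (2 * u)) = expR (- (u / 15)) * expR (2 / 3 * u).
  by rewrite -!expRD; congr expR; field.
have e2 : expR (8 / 3 * u) * expR (- (2 * u)) = expR (2 / 3 * u).
  by rewrite -expRD; congr expR; field.
rewrite normrM (ger0_norm (expR_ge0 (- _))) -[A _](subrK (C * expR (8 / 3 * u))).
apply: (@le_trans _ _ ((K * expR (13 / 5 * u) + C * expR (8 / 3 * u)) * expR (- (2 * u)))).
  rewrite ler_wpM2r ?expR_ge0 //; apply: le_trans (ler_normD _ _) _; apply: lerD => //.
  by rewrite ger0_norm ?mulr_ge0 ?expR_ge0 ?(ltW C_gt0).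
rewrite mulrDl -[K * _ * _]mulrA -[C * _ * _]mulrA e1 e2 /K2 [leRHS]mulrDl lerD2r -[leRHS]mulrA.
rewrite ler_wpM2l // ler_wpM2r ?expR_ge0 //.
by rewrite ler_expR lerN2 ler_pM2r // invr_gt0.
Qed.

Let c (z : R[i]) : R[i] := z * (z + 1) * (z + 2) / 2.
Let s0 : R[i] := (2 / 3)%:C.

(* With [x = exp u], [Lam^(-s) = c s * \int max(0, x - Lam)^2 x^(-s-3) dx]; the subtracted
   main term [C x^(8/3)], [x >= 1], accounts for [C / (s - 2/3)]. *)
Definition continuation (z : R[i]^o) : R[i]^o :=
  c z * (laplace u0 phi z + C%:C / (z - s0)).

(** This is [exp(- l z)]. *)
Let cexpm l (z : R[i]) : R[i] := damped_cos (Re z) (Im z) 0 l +i* damped_cos (Re z) (Im z) (pi / 2) l.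

Let neq_Re (z w : R[i]) : Re z != Re w -> z - w != 0.
Proof. by apply: contra; rewrite subr_eq0 => /eqP ->. Qed.

(** For [Re z > 2/3] the tail subtracted in [phi] has the transform [1 / (z - 2/3)], and the two
    occurrences of [C] cancel. *)
Lemma continuationE z : 2 / 3 < Re z -> continuation z = c z * laplace u0 a z.
Proof.
move=> hz; rewrite /continuation; congr (_ * _).
have hb := exp_tail_bounded u0 0 (- (2 / 3) : R); rewrite mulr0 expR0 opprK in hb.
rewrite -[laplace u0 phi z]/(laplace u0 (fun u => a u + (- C) * exp_tail 0 (- (2 / 3)) u) z).
rewrite (laplaceD a_bounded (exp_boundedZ (- C) hb)) // (laplaceZ _ hb) // laplace_tail //; last lra.
rewrite /damped_cos !mulr0 oppr0 expR0 !add0r cos0 cos_pihalf mulr0 mulr1.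
have -> : z + (- (2 / 3))%:C = z - s0 by rewrite rmorphN.
rewrite rmorphN mulNr mulrA mulr1 -addrA [- _ + _]addrC subrr addr0 //.
Qed.

Let lam i := ln (Lam i).
Let lamE i : expR (lam i) = Lam i. Proof. by rewrite lnK // posrE. Qed.
Let lam_ge i : u0 <= lam i. Proof. by rewrite -ler_expR lamE. Qed.

Let term i u := riesz (expR u) (Lam i) * expR (- (2 * u)).

(** For [u >= lam i] the term is [(1 - exp(lam i - u))^2], and the three tails are its binomial
    expansion. *)
Let termE i u : term i u = exp_tail (lam i) 0 u + (-2) * exp_tail (lam i) 1 u + exp_tail (lam i) 2 u.
Proof.
rewrite /term /exp_tail indicE mem_setE in_itv /= andbT -lamE.
case: leP => h; last by rewrite riesz0 ?mul0r ?mulr0 ?addr0 // ler_expR ltW.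
rewrite /riesz max_r ?subr_ge0 ?ler_expR // !mul1r mul0r oppr0 expR0.
have -> : - (2 * u) = - u + - u by ring.
have -> : - (2 * (u - lam i)) = (lam i + - u) + (lam i + - u) by ring.
have -> : - (u - lam i) = lam i + - u by ring.
rewrite !expRD expRN; field; by rewrite gt_eqF // expR_gt0.
Qed.

(** A single term is at most the whole mean [a]. *)
Let term_bounded i : exists B, exp_bounded u0 (2 / 3) B (term i).
Proof.
exists (K2 * 1).
split.
  apply: measurable_funM.
    apply: measurable_funTS; apply: nondecreasing_measurable => // x y xy.
    have h : Num.max 0 (expR x - Lam i) <= Num.max 0 (expR y - Lam i).
      by rewrite ge_max !le_max lexx /= lerD2r ler_expR xy orbT.
    by rewrite /riesz lerXn2r ?nnegrE // le_max lexx.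
  rewrite (_ : (fun u => expR _) = damped_cos 2 0 0); first exact: measurable_damped_cos.
  by apply/funext => u; rewrite /damped_cos mul0r addr0 cos0 mulr1.
move=> u hu; rewrite mulr1; have [_ h] := a_bounded; apply: le_trans (h u hu).
rewrite /term /a [leLHS]normrM [leRHS]normrM ler_wpM2r //; rewrite (ger0_norm (riesz_ge0 _ _)) (ger0_norm (A_ge0 _)).
case: (ltP (Lam i) (expR u)) => hi; last by rewrite riesz0.
rewrite /A (big_fsetD1 i) ?J_spec //= lerDl sumr_ge0 // => *; exact: riesz_ge0.
Qed.

(** The origin of the factor [c]: [1/z - 2/(z + 1) + 1/(z + 2) = 2 / (z (z + 1)(z + 2)) = 1 / c
    z]. *)
Let laplace_term i z : 2 / 3 < Re z -> c z * laplace u0 (term i) z = cexpm (lam i) z.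
Proof.
move=> hz.
have hz0 : 0 < Re z by apply: lt_trans hz; rewrite divr_gt0.
have b0 := exp_tail_bounded u0 (lam i) (0 : R).
have b1 := exp_tail_bounded u0 (lam i) (1 : R).
have b2 := exp_tail_bounded u0 (lam i) (2 : R).
have up w B f : - w <= 0 -> exp_bounded u0 (- w) B f -> exists B', exp_bounded u0 0 B' f.
  move=> w0 [m b]; have B0 : 0 <= B.
    by have := le_trans (normr_ge0 _) (b u0 (lexx u0)); rewrite pmulr_lge0 // expR_gt0.
  exists (B * expR (- w * u0)); split => // u hu; apply: le_trans (b u hu) _.
  by rewrite mul0r expR0 mulr1 ler_wpM2l // ler_expR ler_wnM2l.
have [B0 h0] := up 0 _ _ ltac:(by rewrite oppr0) b0.
have [B1 h1] := up 1 _ _ ltac:(by rewrite oppr_le0) b1.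
have [B2 h2] := up 2 _ _ ltac:(by rewrite oppr_le0) b2.
have -> : laplace u0 (term i) z = laplace u0 (fun u => exp_tail (lam i) 0 u + (-2) * exp_tail (lam i) 1 u + exp_tail (lam i) 2 u) z.
  by congr (laplace u0 _ z); apply/funext => u; exact: termE.
rewrite (laplaceD (exp_boundedD h0 (exp_boundedZ (-2) h1)) h2) // (laplaceD h0 (exp_boundedZ (-2) h1)) //.
rewrite (laplaceZ _ h1) // !laplace_tail ?lam_ge ?addr0 //; [|lra..].
rewrite -/(cexpm (lam i) z) /c.
have n0 : z != 0 by rewrite -[z]subr0 neq_Re //= gt_eqF.
have n1 : z + 1 != 0 by rewrite -[1]opprK neq_Re //= gt_eqF //; lra.
have n2 : z + 2 != 0 by rewrite -[2]opprK neq_Re //= gt_eqF //; lra.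
have -> : (1 : R)%:C = 1 :> R[i] by [].
have -> : (2 : R)%:C = 2 :> R[i] by rewrite rmorphMn.
have -> : (-2 : R)%:C = -2 :> R[i] by rewrite rmorphN rmorphMn.
by field; rewrite ?n0 ?n1 ?n2.
Qed.

Let cpowE i z : cpow (Lam i)^-1 z = cexpm (lam i) z.
Proof.
rewrite /cpow /cexpm /damped_cos lnV ?posrE // /powR gt_eqF ?invr_gt0 // lnV ?posrE //.
rewrite !mulrN !addr0 cosDpihalf cosN sinN -/(lam i).
by apply/eqP; rewrite eq_complex /= !mul0r subr0 addr0 !eqxx.
Qed.

Let sum_term (S : {fset I}) z : 2 / 3 < Re z ->
  exists B, exp_bounded u0 (2 / 3) B (fun u => \sum_(i <- S) term i u) /\
  c z * laplace u0 (fun u => \sum_(i <- S) term i u) z = \sum_(i <- S) cpow (Lam i)^-1 z.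
Proof.
move=> hz; elim: (enum_fset S) => [|i s [B [IH1 IH2]]].
  exists 0; split.
    split.
      rewrite (_ : (fun u => \sum_(i <- [::]) term i u) = cst 0); first exact: measurable_cst.
      by apply/funext => u; rewrite big_nil.
    by move=> u _; rewrite big_nil normr0 mul0r.
  rewrite big_nil /laplace /real_laplace.
  have E th : \int[@lebesgue_measure R]_(u in `[u0, +oo[) ((\sum_(i <- [::]) term i u) * damped_cos (Re z) (Im z) th u) = 0.
    transitivity (fine (0 : \bar R)%E) => //; congr fine; apply: integral0_eq => u _.
    by rewrite big_nil mul0r.
  by rewrite !E mulr0.
have [Bi bi] := term_bounded i.
have E : (fun u => \sum_(j <- i :: s) term j u) = (fun u => term i u + \sum_(j <- s) term j u).
  by apply/funext => u; rewrite big_cons.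
exists (Bi + B); rewrite E; split; first exact: exp_boundedD.
by rewrite (laplaceD bi IH1) // mulrDr IH2 laplace_term // big_cons cpowE.
Qed.

(** A finite set containing [J (exp U)] has the same mean as the whole family up to [u = U]; beyond
    [U] the difference is at most [a]. The exponent [5/6], halfway between [2/3] and [1], leaves
    [exp(- U/6)] as the saving. *)
Lemma continuation_cvg z : 1 < Re z ->
  summability.partial_sum (fun i => cpow (Lam i)^-1 z : R[i]^o) @ summability.totally --> continuation z.
Proof.
move=> hz; have hz1 : 2 / 3 < Re z by lra.
have FF : ProperFilter (@summability.totally I) by exact: summability.totally_filter.
apply/cvgrPdist_le => e e0.
have [ep eE] : 0 < Re e /\ e = (Re e)%:C.
  case: e e0 => x y; rewrite ltcE /= => /andP[/eqP h hx]; split => //.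
  by apply/eqP; rewrite eq_complex /= eqxx h eqxx.
pose m := `|Re (c z)| + `|Im (c z)|.
pose B := K2 * (expR (- ((Re z - 5 / 6) * u0)) / (Re z - 5 / 6)).
have cz : `|c z| <= m%:C by rewrite /m; case: (c z) => x y; exact: norm_complex_le.
have m0 : 0 <= m by rewrite addr_ge0.
have K20 : 0 <= K2 by rewrite addr_ge0 ?mulr_ge0 ?expR_ge0 // ltW.
have hz2 : 5 / 6 < Re z by lra.
have B0 : 0 <= B by rewrite mulr_ge0 // divr_ge0 ?expR_ge0 // subr_ge0 ltW.
have [U HU] : exists U, m * (2 * B) * expR (- (U / 6)) <= Re e.
  exists (6 * (m * (2 * B) / Re e)); rewrite expRN ler_pdivrMr ?expR_gt0 //.
  rewrite [leRHS]mulrC -ler_pdivrMr // [6 * _]mulrC mulfK //.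
  by apply: le_trans (expR_ge1Dx _); rewrite lerDr.
exists (J (expR U)) => // S /= JS.
have -> : summability.partial_sum (fun i => cpow (Lam i)^-1 z : R[i]^o) S = \sum_(i <- S) cpow (Lam i)^-1 z.
  by rewrite /summability.partial_sum big_seq_fsetE.
have [BS [bS <-]] := sum_term S hz1.
rewrite continuationE // -mulrBr.
pose d u := a u + (-1) * \sum_(i <- S) term i u.
have -> : laplace u0 a z - laplace u0 (fun u => \sum_(i <- S) term i u) z = laplace u0 d z.
  rewrite (laplaceD a_bounded (exp_boundedZ (-1) bS)) // (laplaceZ _ bS) //.
  by rewrite rmorphN mulN1r.
have bd : exp_bounded u0 (5 / 6) (K2 * expR (- (U / 6))) d.
  have [ma ba] := a_bounded; have [mS _] := bS; split.
    by apply: measurable_funD => //; exact: measurable_funM.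
  move=> u hu.
  have sE : \sum_(i <- S) term i u = (\sum_(i <- S) riesz (expR u) (Lam i)) * expR (- (2 * u)).
    by rewrite mulr_suml.
  have dE : d u = (A (expR u) - \sum_(i <- S) riesz (expR u) (Lam i)) * expR (- (2 * u)).
    by rewrite /d sE /a; ring.
  have sle : \sum_(i <- S) riesz (expR u) (Lam i) <= A (expR u).
    have <- : \sum_(i <- (S `|` J (expR u))%fset) riesz (expR u) (Lam i) = A (expR u).
      by apply: sum_riesz_fset => i hi; rewrite inE (J_spec hi) orbT.
    by apply: sum_fset_le; [move=> i; exact: riesz_ge0|exact: fsubsetUl].
  have s0' : 0 <= \sum_(i <- S) riesz (expR u) (Lam i) by apply: sumr_ge0 => i _; exact: riesz_ge0.
  case: (leP u U) => uU.
    rewrite dE sum_riesz_fset ?subrr ?mul0r ?normr0 ?mulr_ge0 ?expR_ge0 // => i hi.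
    by apply: (fsubsetP JS); apply: J_spec; apply: lt_le_trans hi _; rewrite ler_expR.
  apply: (@le_trans _ _ `|a u|).
    rewrite dE /a !normrM ler_wpM2r // !ger0_norm ?subr_ge0 //.
    by rewrite lerBlDr lerDl.
  apply: le_trans (ba u hu) _; rewrite -mulrA -expRD ler_wpM2l // ler_expR; lra.
rewrite normrM; apply: (@le_trans _ _ (m%:C * (2 * (K2 * expR (- (U / 6)) * (expR (- ((Re z - 5 / 6) * u0)) / (Re z - 5 / 6))))%:C)).
  by apply: ler_pM => //; exact: laplace_norm.
rewrite eE -rmorphM lecR; apply: le_trans HU; rewrite le_eqVlt; apply/orP; left; apply/eqP.
rewrite /B; ring.
Qed.

Let derivable_c z : derivable (c : R[i]^o -> R[i]^o) z 1.
Proof.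
apply: derivableM; last exact: derivable_cst.
apply: derivableM; last by apply: derivableD; [exact: derivable_id|exact: derivable_cst].
apply: derivableM; first exact: derivable_id.
by apply: derivableD; [exact: derivable_id|exact: derivable_cst].
Qed.

Let derivable_laplace z : 3 / 5 < Re z -> derivable (laplace u0 phi : R[i]^o -> R[i]^o) z 1.
Proof. by move=> hz; have [] := laplace_derive phi_bounded hz. Qed.

Lemma continuation_holomorphic :
  holomorphic_on [set s | 3 / 5 < Re s /\ s <> (2 / 3)%:C] continuation.
Proof.
move=> s [hs sn]; apply: derivableM; first exact: derivable_c.
apply: derivableD; first exact: derivable_laplace.
apply: derivableM; first exact: derivable_cst.
apply: derivableV; first by rewrite subr_eq0; exact/eqP.
by apply: derivableD; [exact: derivable_id|exact: derivable_cst].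
Qed.

Lemma continuation_pole : simple_pole_with_residue continuation (2 / 3)%:C (40 / 27 * C)%:C.
Proof.
split.
  apply/eqP => /eqP; rewrite eq_complex /= eqxx andbT gt_eqF //.
  by rewrite mulr_gt0 // divr_gt0.
(* The divided difference [(c z - c s0) / (z - s0)], a polynomial; [c s0 = 40/27]. *)
pose q (z : R[i]^o) : R[i]^o := (z * z + z * s0 + s0 * s0 + 3 * (z + s0) + 2) / 2.
exists (fun z => c z * laplace u0 phi z + C%:C * q z); split.
  (* The radius [1/30] is less than [2/3 - 3/5 = 1/15]. *)
  apply/nbhs_normP; exists (30%:R^-1)%:C; first by rewrite /= ltcR invr_gt0.
  move=> s /= hs.
  have hre : 3 / 5 < Re s.
    have [h _] := norm_Re_lt hs; move: h; case: s {hs} => x y /=.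
    by rewrite ltr_norml => /andP[h1 h2]; lra.
  apply: derivableD.
    by apply: derivableM; [exact: derivable_c|exact: derivable_laplace].
  apply: derivableM; first exact: derivable_cst.
  apply: derivableM; last exact: derivable_cst.
  apply: derivableD; last exact: derivable_cst.
  apply: derivableD.
    apply: derivableD; last exact: derivable_cst.
    apply: derivableD; first by apply: derivableM; exact: derivable_id.
    by apply: derivableM; [exact: derivable_id|exact: derivable_cst].
  apply: derivableM; first exact: derivable_cst.
  by apply: derivableD; [exact: derivable_id|exact: derivable_cst].
near=> s.
have sn : s - s0 != 0 by rewrite subr_eq0; near: s; exact: nbhs_dnbhs_neq.
rewrite /continuation /q /c /s0 in sn *.
have -> : (40 / 27 * C)%:C = 40 / 27 * C%:C :> R[i].
  by rewrite rmorphM rmorphM fmorphV !rmorphMn.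
have e : (2 / 3)%:C = 2 / 3 :> R[i] by rewrite rmorphM fmorphV !rmorphMn.
rewrite e in sn *; move: (laplace u0 phi s) (C%:C) => l k.
have : s = (s - 2 / 3) + 2 / 3 by rewrite subrK.
move: (s - 2 / 3) sn => t tn ->.
by field.
Unshelve. all: by end_near. Qed.

End Continuation.

(** * Calculus on the closed unit interval *)

Section ClosedIntervalCalculus.
Variable R : realType.
Notation mu := (@lebesgue_measure R).
Implicit Types f g : R -> R.

Lemma derive_in_eps f (A : set R) x : derivable_in A f x -> forall e, 0 < e ->
  exists2 d, 0 < d & forall y, `|x - y| < d -> A y ->
    `|f y - f x - derive_in A f x * (y - x)| <= e * `|y - x|.
Proof.
move=> h e e0.
have H : diff_quotient f x @ within A x^' --> derive_in A f x by exact: h.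
have /cvgrPdist_le /(_ e e0) := H.
rewrite near_withinE near_withinE => /nbhs_normP[d /= d0 Hd].
exists d => // y xy Ay.
have [->|yx] := eqVneq y x; first by rewrite !subrr mulr0 subr0 normr0 mulr0.
have yx0 : 0 < `|y - x| by rewrite normr_gt0 subr_eq0.
have := Hd y xy yx Ay; rewrite /diff_quotient.
rewrite -(ler_pM2r yx0) -normrM mulrBl mulfVK ?subr_eq0 // => H1.
by rewrite distrC.
Qed.

Lemma is_derive_of_eps f (x l : R) : (forall e, 0 < e -> exists2 d, 0 < d &
    forall y, `|x - y| < d -> `|f y - f x - l * (y - x)| <= e * `|y - x|) ->
  is_derive x 1 f l.
Proof.
move=> H.
have cv : (fun h => h^-1 *: (f (h *: (1 : R) + x) - f x)) @ 0^' --> l.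
  apply/cvgrPdist_le => e e0; have [d d0 Hd] := H e e0.
  near=> h.
  have h0 : h != 0 by near: h; exact: nbhs_dnbhs_neq.
  have hd : `|h| < d by near: h; apply: dnbhs0_lt.
  have := Hd (h + x); rewrite opprD addrCA subrr addr0 normrN addrK => /(_ hd).
  rewrite [h *: _]mulr1 => Hh.
  have -> : l - h^-1 *: (f (h + x) - f x) = - (h^-1 * (f (h + x) - f x - l * h)).
    by rewrite [h^-1 *: _]/(h^-1 * _) [in RHS]mulrBr [l * h]mulrC mulKf // opprB.
  by rewrite normrN normrM normfV ler_pdivrMl ?normr_gt0 // [ `|h| * e]mulrC.
apply: DeriveDef; first by apply/cvg_ex; exists l.
by rewrite /derive; apply: cvg_lim.
Unshelve. all: by end_near. Qed.

(** Near an interior point the restriction to [[a, b]] is invisible; this turns the restricted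
    derivatives of [class_C] into ordinary ones. *)
Lemma is_derive_in_interior f (a b x : R) : a < x < b -> derivable_in `[a, b] f x ->
  is_derive x 1 f (derive_in `[a, b] f x).
Proof.
move=> /andP[ax xb] h; apply: is_derive_of_eps => e e0.
have [d d0 Hd] := derive_in_eps h e0.
exists (Num.min d (Num.min (x - a) (b - x))).
  by rewrite !lt_min d0 !subr_gt0 ax xb.
move=> y; rewrite !lt_min => /and3P[h1 h2 h3]; apply: Hd => //.
rewrite /= in_itv /=; move: h2 h3; rewrite !ltr_norml => /andP[h2 h2'] /andP[h3 h3'].
by apply/andP; split; lra.
Qed.

Lemma continuous_of_derivable_in f (A : set R) : (forall x, A x -> derivable_in A f x) ->
  {within A, continuous f}.
Proof.
move=> H; apply/subspace_continuousP => x Ax; apply/cvgrPdist_le => e e0.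
have [d d0 Hd] := derive_in_eps (H x Ax) ltr01.
set l := derive_in A f x in Hd.
have k0 : 0 < e / (`|l| + 1) by rewrite divr_gt0 // ltr_wpDl.
rewrite near_withinE; apply/nbhs_normP; exists (Num.min d (e / (`|l| + 1))).
  by rewrite /= lt_min d0.
move=> y /=; rewrite lt_min => /andP[h1 h2] Ay.
have := Hd y h1 Ay; rewrite mul1r => H1; rewrite distrC.
have -> : f y - f x = (f y - f x - l * (y - x)) + l * (y - x) by ring.
apply: le_trans (ler_normD _ _) _; rewrite normrM.
apply: (@le_trans _ _ ((`|l| + 1) * `|y - x|)); first by rewrite mulrDl mul1r addrC lerD2l.
by rewrite mulrC -ler_pdivlMr ?ltr_wpDl // distrC ltW.
Qed.

(** The error of linear interpolation. The parabola [q] agrees with [f] at [x0], [p] and [x1];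
    Rolle's theorem gives two points where the derivatives agree, and the mean value theorem between
    them gives [f2 xi = 2 k]. *)
Lemma second_difference f f1 f2 (x0 p x1 : R) : x0 < p -> p < x1 ->
  {within `[x0, x1], continuous f} ->
  (forall x : R, x0 < x < x1 -> is_derive x 1 f (f1 x)) ->
  (forall x : R, x0 < x < x1 -> is_derive x 1 f1 (f2 x)) ->
  exists2 xi, x0 < xi < x1 &
    f p - (x1 - p) / (x1 - x0) * f x0 - (p - x0) / (x1 - x0) * f x1 =
    f2 xi / 2 * ((p - x0) * (p - x1)).
Proof.
move=> xp px cf d1 d2.
have x01 : x0 < x1 by apply: lt_trans px.
pose sl := (f x1 - f x0) / (x1 - x0).
pose k := (f p - f x0 - sl * (p - x0)) / ((p - x0) * (p - x1)).
have n0 : p - x0 != 0 by rewrite subr_eq0 gt_eqF.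
have n1 : p - x1 != 0 by rewrite subr_eq0 lt_eqF.
have n2 : x1 - x0 != 0 by rewrite subr_eq0 gt_eqF.
pose q (y : R) := f x0 + sl * (y - x0) + k * ((y - x0) * (y - x1)).
pose G y := f y - q y.
have dq (x : R) : is_derive x 1 q (sl + k * (2 * x - x0 - x1)).
  have a1 (c : R) : is_derive x 1 (fun y : R => y - c) 1.
    by apply: is_derive_cong (is_deriveB (is_derive_id x 1) (is_derive_cst c x 1)) _; rewrite subr0.
  have e1 := is_deriveD (is_deriveD (is_derive_cst (f x0) x 1) (is_deriveZ sl (a1 x0)))
     (is_deriveZ k (is_deriveM (a1 x0) (a1 x1))).
  apply: is_derive_cong e1 _; rewrite /GRing.scale /=; ring.
have cq : continuous q.
  by move=> y; apply: differentiable_continuous; apply/derivable1_diffP; have [] := dq y.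
have cG : {within `[x0, x1], continuous G}.
  move=> y; apply: continuousB; first exact: cf.
  by apply: continuous_subspaceT.
have dG (x : R) : x0 < x < x1 -> is_derive x 1 G (f1 x - (sl + k * (2 * x - x0 - x1))).
  by move=> hx; have h1 := d1 x hx; have h2 := dq x; exact: is_deriveB.
have G0 : G x0 = 0 by rewrite /G /q !subrr mulr0 mul0r mulr0 !addr0 subrr.
have G1 : G x1 = 0 by rewrite /G /q !subrr !mulr0 addr0 /sl mulfVK // addrCA subrr addr0 subrr.
have Gp : G p = 0 by rewrite /G /q /k; field; rewrite ?n0 ?n1.
have roll (a b : R) : x0 <= a -> a < b -> b <= x1 -> G a = 0 -> G b = 0 ->
    exists2 c, a < c < b & f1 c = sl + k * (2 * c - x0 - x1).
  move=> xa ab bx Ga Gb.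
  have dab x : x \in `]a, b[ -> is_derive (x : R) 1 G (f1 x - (sl + k * (2 * x - x0 - x1))).
    by rewrite in_itv /= => /andP[h1 h2]; apply: dG; rewrite (le_lt_trans xa h1) (lt_le_trans h2 bx).
  have cab : {within `[a, b], continuous G}.
    apply: continuous_subspaceW cG => y /=; rewrite !in_itv /= => /andP[h1 h2].
    by rewrite (le_trans xa h1) (le_trans h2 bx).
  have [c hc E] := MVT_segment (ltW ab) dab cab.
  have [c' hc' [_ E']] := Rolle ab (fun x hx => @ex_derive _ _ _ _ _ _ _ (dab x hx)) cab (etrans Ga (esym Gb)).
  exists c'; first by move: hc'; rewrite in_itv.
  have [_ E2] := dab c' hc'; rewrite E' in E2.
  by apply/eqP; rewrite -subr_eq0 -E2.
have [c1 /andP[h1 h1'] E1] := roll x0 p (lexx _) xp (ltW px) G0 Gp.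
have [c2 /andP[h2 h2'] E2] := roll p x1 (ltW xp) px (lexx _) Gp G1.
have c12 : c1 < c2 by apply: lt_trans h2.
have inside x : x \in `[c1, c2] -> x0 < x < x1.
  by rewrite in_itv /= => /andP[k1 k2]; rewrite (lt_le_trans h1 k1) (le_lt_trans k2 h2').
have c12f : {within `[c1, c2], continuous f1}.
  by apply: derivable_within_continuous => x hx; have [] := d2 x (inside x hx).
have d12 x : x \in `]c1, c2[ -> is_derive (x : R) 1 f1 (f2 x).
  by rewrite in_itv /= => /andP[k1 k2]; apply: d2; apply: inside; rewrite in_itv /= !ltW.
have [xi] := MVT_segment (ltW c12) d12 c12f.
move=> hx E; have xin : x0 < xi < x1 by apply: inside; move: hx; rewrite !in_itv.
exists xi => //.
have k2 : f2 xi = 2 * k.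
  have n : c2 - c1 != 0 by rewrite subr_eq0 gt_eqF.
  by apply: (mulIf n); rewrite -E E1 E2; ring.
have -> : f2 xi / 2 = k by rewrite k2; field.
rewrite /k mulfVK ?mulf_neq0 // /sl; field.
exact: n2.
Qed.

Lemma lipschitz_of_derivable_in g : (forall x, `[0, 1]%classic x -> derivable_in `[0, 1] g x) ->
  {within `[0, 1], continuous (derive_in `[0, 1] g)} ->
  exists2 L, 0 <= L & forall y z, 0 <= y <= 1 -> 0 <= z <= 1 -> `|g y - g z| <= L * `|y - z|.
Proof.
move=> dg cg.
have [c1 hc1 H1] := EVT_max ler01 cg; have [c2 hc2 H2] := EVT_min ler01 cg.
pose L := `|derive_in `[0, 1] g c1| + `|derive_in `[0, 1] g c2|.
have L0 : 0 <= L by rewrite addr_ge0.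
exists L => // y z; wlog yz : y z / y <= z => [H hy hz|].
  by case: (leP y z) => [/H|/ltW /H h]; [apply|rewrite distrC [ `|y - z|]distrC; apply: h].
move=> /andP[y0 y1] /andP[z0 z1].
have hd x : x \in `]y, z[ -> is_derive (x : R) 1 g (derive_in `[0, 1] g x).
  rewrite in_itv /= => /andP[h1 h2]; apply: is_derive_in_interior.
    by rewrite (le_lt_trans y0 h1) (lt_le_trans h2 z1).
  by apply: dg; rewrite /= in_itv /= (ltW (le_lt_trans y0 h1)) (ltW (lt_le_trans h2 z1)).
have cyz : {within `[y, z], continuous g}.
  apply: continuous_subspaceW (continuous_of_derivable_in dg) => x /=; rewrite !in_itv /= => /andP[h1 h2].
  by rewrite (le_trans y0 h1) (le_trans h2 z1).
have [x hx E] := MVT_segment yz hd cyz.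
rewrite distrC [ `|y - z|]distrC E normrM ler_wpM2r //.
have xin : x \in `[0, 1].
  by move: hx; rewrite !in_itv /= => /andP[h1 h2]; rewrite (le_trans y0 h1) (le_trans h2 z1).
rewrite ler_norml; apply/andP; split.
  apply: le_trans (H2 x xin); rewrite lerNl; apply: (@le_trans _ _ `|derive_in `[0, 1] g c2|).
    by rewrite -normrN ler_norm.
  by rewrite lerDr.
by apply: le_trans (H1 x xin) _; apply: le_trans (ler_norm _) _; rewrite lerDl.
Qed.

(** The retraction of the line onto [[0, 1]]: it extends [2/|f''|] to a Lipschitz function on the
    whole line, whatever the values of [f] outside the interval. *)
Definition clamp (y : R) := Num.max 0 (Num.min 1 y).

Lemma clamp_in y : 0 <= clamp y <= 1.
Proof. by rewrite /clamp le_max lexx /= ge_max ler01 ge_min lexx. Qed.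

Lemma clamp_id y : 0 <= y <= 1 -> clamp y = y.
Proof. by move=> /andP[h1 h2]; rewrite /clamp min_r // max_r. Qed.

Lemma clamp_lip y z : `|clamp y - clamp z| <= `|y - z|.
Proof.
wlog yz : y z / y <= z => [H|].
  by case: (leP y z) => [/H//|/ltW /H]; rewrite distrC [ `|z - y|]distrC.
rewrite distrC [ `|y - z|]distrC [leRHS]ger0_norm ?subr_ge0 //.
have c t : clamp t = if t <= 0 then 0 else if 1 <= t then 1 else t.
  rewrite /clamp; case: (leP 1 t) => h1; case: (leP t 0) => h2.
  - by move: (le_trans h1 h2); rewrite ler10.
  - by rewrite max_r.
  - by [].
  - by [].
rewrite !c; case: (leP y 0) => ?; case: (leP z 0) => ?; case: (leP 1 y) => ?; case: (leP 1 z) => ?;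
  rewrite ler_norml; apply/andP; split; lra.
Qed.

Lemma inv_clamp_lipschitz (h : R -> R) (e L : R) : 0 < e -> 0 <= L ->
  (forall y, 0 <= y <= 1 -> e <= h y) ->
  (forall y z, 0 <= y <= 1 -> 0 <= z <= 1 -> `|h y - h z| <= L * `|y - z|) ->
  forall y z, `|(h (clamp y))^-1 - (h (clamp z))^-1| <= L / e ^+ 2 * `|y - z|.
Proof.
move=> e0 L0 he hl y z.
have hy := he _ (clamp_in y); have hz := he _ (clamp_in z).
have y0 := lt_le_trans e0 hy; have z0 := lt_le_trans e0 hz.
have -> : (h (clamp y))^-1 - (h (clamp z))^-1 = (h (clamp z) - h (clamp y)) / (h (clamp y) * h (clamp z)).
  by field; rewrite !gt_eqF.
rewrite normrM normfV [ `|h _ * _|]gtr0_norm ?mulr_gt0 // distrC.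
have H1 : `|h (clamp y) - h (clamp z)| <= L * `|y - z|.
  by apply: le_trans (hl _ _ (clamp_in y) (clamp_in z)) _; rewrite ler_wpM2l // clamp_lip.
have H2 : (h (clamp y) * h (clamp z))^-1 <= (e ^+ 2)^-1.
  rewrite lef_pV2 ?posrE ?mulr_gt0 ?exprn_gt0 // expr2.
  by apply: ler_pM => //; exact: ltW.
apply: le_trans (ler_pM (normr_ge0 _) _ H1 H2) _; first by rewrite invr_ge0 ltW // mulr_gt0.
by rewrite mulrAC.
Qed.
End ClosedIntervalCalculus.

(** * Farey intervals *)

Lemma sum_pick_seq (R : pzRingType) (I : eqType) (s : seq I) (j : I) (g : I -> R) : uniq s -> j \in s ->
  \sum_(k <- s) (j == k)%:R * g k = g j.
Proof.
move=> us js; rewrite (big_rem j) //= eqxx mul1r big1_seq ?addr0 // => k.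
by rewrite mem_rem_uniq // inE andTb => /andP[/negPf h _]; rewrite eq_sym h mul0r.
Qed.

(** The three conditions on the labels make them a bijection onto the triples [b < d < N], [a <= b],
    with [a] inverse to [d] modulo [b]. The labels are left abstract to serve both orders of the
    denominators. *)
Lemma sum_labelled (R : comPzRingType) (I : eqType) (s : seq I) (P : pred I) (be de al : I -> nat) (N : nat)
  (W : nat -> nat -> nat -> R) :
  uniq s ->
  (forall i, i \in s -> P i ->
     [&& 0 < be i, be i < de i, de i < N, 0 < al i, al i <= be i & is_inv_mod (be i) (al i) (de i)]%N) ->
  (forall i j, i \in s -> j \in s -> P i -> P j -> be i = be j -> de i = de j -> al i = al j -> i = j) ->
  (forall b d a, (0 < b)%N -> (b < d)%N -> (d < N)%N -> (0 < a)%N -> (a <= b)%N -> is_inv_mod b a d ->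
     exists i, [/\ i \in s, P i, be i = b, de i = d & al i = a]) ->
  \sum_(i <- s | P i) W (be i) (de i) (al i) =
  \sum_(1 <= b < N) \sum_(b.+1 <= d < N) \sum_(1 <= a < b.+1) (is_inv_mod b a d)%:R * W b d a.
Proof.
move=> us range inj surj.
transitivity (\sum_(i <- s | P i) \sum_(1 <= b < N) \sum_(b.+1 <= d < N) \sum_(1 <= a < b.+1)
    (be i == b)%:R * ((de i == d)%:R * ((al i == a)%:R * W b d a))).
  rewrite big_seq_cond [RHS]big_seq_cond; apply: eq_bigr => i /andP[si Pi].
  have /and5P[b0 bd dN a0 /andP[ab _]] := range i si Pi.
  have E b : \sum_(b.+1 <= d < N) \sum_(1 <= a < b.+1) (be i == b)%:R * ((de i == d)%:R * ((al i == a)%:R * W b d a)) =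
      (be i == b)%:R * W (be i) (de i) (al i).
    case: eqVneq => [<-|_]; last by rewrite mul0r big1 // => d _; rewrite big1 // => a _; rewrite mul0r.
    rewrite mul1r.
    transitivity (\sum_((be i).+1 <= d < N) (de i == d)%:R * W (be i) d (al i)).
      apply: eq_bigr => d _; rewrite -(@sum_pick_seq _ _ (index_iota 1 (be i).+1) (al i) (fun a => (de i == d)%:R * W (be i) d a)) ?iota_uniq ?mem_index_iota ?a0 //.
      by apply: eq_bigr => a _; rewrite mul1r mulrCA.
    by rewrite sum_pick_seq ?iota_uniq ?mem_index_iota ?bd.
  rewrite (eq_bigr _ (fun b _ => E b)) (@sum_pick_seq _ _ _ (be i) (fun=> W (be i) (de i) (al i))) ?iota_uniq //.
  by rewrite mem_index_iota b0 (ltn_trans bd dN).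
rewrite exchange_big /=; apply: eq_big_nat => b /andP[b0 _].
rewrite exchange_big /=; apply: eq_big_nat => d /andP[bd dN].
rewrite exchange_big /=; apply: eq_big_nat => a /andP[a0 ab].
transitivity (\sum_(i <- s) (P i && [&& be i == b, de i == d & al i == a])%:R * W b d a).
  rewrite big_mkcond /=; apply: eq_bigr => i _; case: (P i) => /=; last by rewrite mul0r.
  by case: eqP => _; case: eqP => _; case: eqP => _; rewrite ?mul1r ?mul0r.
rewrite -mulr_suml; congr (_ * _).
case: (boolP (is_inv_mod b a d)) => hinv.
  have [j [sj Pj bj dj aj]] := surj b d a b0 bd dN a0 ab hinv.
  rewrite -[RHS](@sum_pick_seq R _ s j (fun=> 1)) //; apply: eq_big_seq => i si; rewrite mulr1.
  congr (nat_of_bool _)%:R; apply/idP/eqP => [/and4P[Pi /eqP h1 /eqP h2 /eqP h3]|<-].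
    by apply: inj; rewrite ?h1 ?h2 ?h3.
  by rewrite Pj bj dj aj !eqxx.
rewrite big1_seq // => i /andP[_ si]; case: (boolP (P i)) => //= Pi.
have /and5P[_ _ _ _ /andP[_ h]] := range i si Pi.
case: and3P => // -[/eqP h1 /eqP h2 /eqP h3]; by rewrite h1 h2 h3 (negPf hinv) in h.
Qed.

(** For given [b] and [d] at most one [a] occurs, so the error sum runs over pairs only. *)
Lemma sum_labelled_approx (R : realType) (I : eqType) (s : seq I) (P : pred I) (be de al : I -> nat) (N : nat)
  (F : I -> R) (W : nat -> nat -> nat -> R) (E : nat -> nat -> R) :
  uniq s ->
  (forall i, i \in s -> P i ->
     [&& 0 < be i, be i < de i, de i < N, 0 < al i, al i <= be i & is_inv_mod (be i) (al i) (de i)]%N) ->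
  (forall i j, i \in s -> j \in s -> P i -> P j -> be i = be j -> de i = de j -> al i = al j -> i = j) ->
  (forall b d a, (0 < b)%N -> (b < d)%N -> (d < N)%N -> (0 < a)%N -> (a <= b)%N -> is_inv_mod b a d ->
     exists i, [/\ i \in s, P i, be i = b, de i = d & al i = a]) ->
  (forall b d, 0 <= E b d) ->
  (forall i, i \in s -> P i -> `|F i - W (be i) (de i) (al i)| <= E (be i) (de i)) ->
  `|\sum_(i <- s | P i) F i -
    \sum_(1 <= b < N) \sum_(b.+1 <= d < N) \sum_(1 <= a < b.+1) (is_inv_mod b a d)%:R * W b d a|
   <= \sum_(1 <= b < N) \sum_(b.+1 <= d < N) E b d.
Proof.
move=> us range inj surj E0 H.
rewrite -(sum_labelled W us range inj surj) -sumrB.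
apply: (@le_trans _ _ (\sum_(i <- s | P i) E (be i) (de i))).
  apply: le_trans (ler_norm_sum _ _ _) _.
  by rewrite big_seq_cond [leRHS]big_seq_cond; apply: ler_sum => i /andP[si Pi]; exact: H.
rewrite (sum_labelled (fun b d _ => E b d) us range inj surj).
rewrite big_nat [leRHS]big_nat; apply: ler_sum => b /andP[b0 _]; apply: ler_sum => d _.
rewrite -mulr_suml -natr_sum sum_is_inv_mod //; case: (coprime d b); rewrite ?mul1r ?mul0r //.
Qed.

Section ErrorSum.
Variable R : realType.

(** For fixed [b] the condition is [d < Y] with [Y^2 = X/b], and at most [Y] terms below [2 Y] give
    [2 X/b]. Weakening [1/b] to [b^(3/5 - 1)] avoids a logarithm, at the price of the exponent
    [8/5]. *)
Lemma hyperbola_sum_le (X : R) N : 0 < X ->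
  \sum_(1 <= b < N) \sum_(b.+1 <= d < N) (if (b * d ^ 2)%:R < X then (b + d)%:R else 0) <= 10 / 3 * X `^ (8 / 5).
Proof.
move=> X0.
have X85 : X `^ (8 / 5) = X * X `^ (3 / 5).
  by rewrite -{2}[X]powRr1 ?(ltW X0) // -powRD ?(gt_eqF X0) ?implybT //; congr (_ `^ _); field.
have h35 : 0 < (3 / 5 : R) < 1 by apply/andP; split; lra.
apply: (@le_trans _ _ (\sum_(1 <= b < N | b%:R < X) 2 * X * b%:R `^ (3 / 5 - 1))); last first.
  rewrite -mulr_sumr X85 (_ : 10 / 3 * (X * X `^ (3 / 5)) = 2 * X * ((3 / 5)^-1 * X `^ (3 / 5))); last by field.
  by rewrite ler_wpM2l ?mulr_ge0 ?(ltW X0) // sum_powRn_le // ltW.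
rewrite [leRHS]big_mkcond /= big_nat [leRHS]big_nat; apply: ler_sum => b /andP[b1 _].
have b0 : (0 : R) < b%:R by rewrite ltr0n.
case: ltP => bX; last first.
  rewrite big_nat big1 // => d /andP[bd _]; rewrite ltNge (le_trans bX) //= ler_nat.
  by rewrite leq_pmulr // expn_gt0 (leq_trans _ bd).
pose Y := Num.sqrt (X / b%:R).
have Y2 : Y ^+ 2 = X / b%:R by rewrite sqr_sqrtr // divr_ge0 // ltW.
have Y0 : 0 <= Y by exact: sqrtr_ge0.
apply: (@le_trans _ _ (\sum_(1 <= d < N | d%:R < Y) 2 * Y)).
  rewrite (big_nat_widenl b.+1 1) //= big_mkcond [leRHS]big_mkcond /=; apply: ler_sum => d _.
  case: (ltnP b d) => bd /=; last by case: ifP => // _; rewrite mulr_ge0.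
  have e : ((b * d ^ 2)%:R < X) = (d%:R < Y).
    rewrite natrM natrX mulrC -ltr_pdivlMr // -Y2; apply/idP/idP => h; last by rewrite ltrXn2r // ?nnegrE.
    by rewrite ltNge; apply/negP => h'; move: h; rewrite ltNge lerXn2r ?nnegrE.
  rewrite e; case: ifP => // dY; rewrite natrD mulr2n mulrDl mul1r.
  by apply: lerD; apply: ltW => //; apply: le_lt_trans dY; rewrite ler_nat ltnW.
rewrite -[2 * Y]mulr1 -mulr_sumr; apply: (@le_trans _ _ (2 * Y * Y)).
  by rewrite ler_wpM2l ?mulr_ge0 // card_lt_le.
rewrite -mulrA -expr2 Y2 -mulrA ler_wpM2l // ler_wpM2l ?(ltW X0) //.
rewrite -powR_inv1 ?(ltW b0) //; apply: ler_powR; rewrite ?ler1n //; lra.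
Qed.
End ErrorSum.

Section FareyIntervals.
Local Open Scope nat_scope.
Implicit Types i j : farey_interval.

Definition fc i := (val i).1.1.
Definition fd i := (val i).1.2.
Definition fa i := (val i).2.1.
Definition fb i := (val i).2.2.

Lemma farey_facts i : [/\ 0 < fb i, 0 < fd i, fc i < fd i, 0 < fa i & fa i <= fb i] /\ fa i * fd i = fb i * fc i + 1.
Proof.
rewrite /fa /fb /fc /fd; case: i => [[[c d] [a b]] h] /=.
move: h => /= /and5P[b0 d0 cd ab /and3P[cab ccd /eqP E]]; split=> //; split=> //.
  rewrite ltn_neqAle cd andbT; apply/eqP => cE; move: ccd E ab; rewrite cE /coprime gcdnn => /eqP ->; nia.
by case: a E {ab cab} => // E; rewrite mul0n addn1 in E.
Qed.

Lemma farey_eq i j : fa i = fa j -> fb i = fb j -> fc i = fc j -> fd i = fd j -> i = j.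
Proof.
move=> h1 h2 h3 h4; apply: val_inj; move: h1 h2 h3 h4; rewrite /fa /fb /fc /fd.
by case: (val i) => [[c d] [a b]]; case: (val j) => [[c' d'] [a' b']] /= -> -> -> ->.
Qed.

(** Both coprimality conditions follow from the determinant equation. *)
Lemma farey_exists a b c d : 0 < b -> 0 < d -> c <= d -> a <= b -> a * d = b * c + 1 ->
  exists i, [/\ fa i = a, fb i = b, fc i = c & fd i = d].
Proof.
move=> b0 d0 cd ab E.
have dvd1 g : g %| a * d -> g %| b * c -> g = 1.
  by rewrite E => h1 h2; apply/eqP; rewrite -dvdn1; rewrite dvdn_addr in h1.
have cab : coprime a b.
  by apply/eqP; apply: dvd1; [rewrite dvdn_mulr ?dvdn_gcdl|rewrite dvdn_mulr ?dvdn_gcdr].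
have ccd : coprime c d.
  by apply/eqP; apply: dvd1; [rewrite dvdn_mull ?dvdn_gcdr|rewrite dvdn_mull ?dvdn_gcdl].
have h : is_farey ((c, d), (a, b)) by rewrite /= b0 d0 cd ab cab ccd E eqxx.
by exists (exist (fun I => is_true (is_farey I)) ((c, d), (a, b)) h).
Qed.

Definition farey_pairs n := allpairs pair (iota 0 n) (iota 0 n).

(** Numerators do not exceed denominators, so all candidates occur among finitely many quadruples,
    from which [insub] extracts the Farey intervals. *)
Definition farey_fset n : {fset farey_interval} :=
  [fset i in (pmap insub (allpairs pair (farey_pairs n.+1) (farey_pairs n.+1)) : seq farey_interval)
    | (fb i < n) && (fd i < n)]%fset.

Lemma farey_fsetP n i : (i \in farey_fset n) = (fb i < n) && (fd i < n).
Proof.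
rewrite /farey_fset; set s := pmap _ _; rewrite !inE /=.
case: (boolP ((fb i < n) && (fd i < n))) => [/andP[h1 h2]|]; last by rewrite andbF.
rewrite andbT /s mem_pmap_sub; have [[_ _ cd _ ab] _] := farey_facts i.
rewrite [val i]surjective_pairing allpairs_f //.
  by rewrite [(val i).1]surjective_pairing allpairs_f // mem_iota add0n /= ltnS ltnW // (ltn_trans cd).
by rewrite [(val i).2]surjective_pairing allpairs_f // mem_iota add0n /= ltnS ltnW // (leq_ltn_trans ab).
Qed.

Lemma farey_upper_range i : fb i < fd i -> is_inv_mod (fb i) (fa i) (fd i).
Proof. by move=> _; have [_ E] := farey_facts i; rewrite /is_inv_mod E mulnC modnMDl. Qed.

(** The reflected interval is [[(b - a)/b, (d - c)/d]], and its determinant equation is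
    [(d - c) b = (b - a) d + 1]. *)
Lemma farey_lower_inv i : is_inv_mod (fd i) (fd i - fc i) (fb i).
Proof.
have [[b0 d0 cd a0 ab] E] := farey_facts i; rewrite /is_inv_mod.
have -> : (fd i - fc i) * fb i = (fb i - fa i) * fd i + 1.
  move: E ab cd; move: (fa i) (fb i) (fc i) (fd i) => a b c d E ab cd; rewrite !mulnBl; nia.
by rewrite modnMDl.
Qed.

Lemma inv_mod_quotient b a d : 0 < a -> 0 < d -> is_inv_mod b a d -> exists k, a * d = b * k + 1.
Proof.
move=> a0 d0; rewrite /is_inv_mod => /eqP h.
have ad : 0 < a * d by rewrite muln_gt0 a0.
have : b %| a * d - 1 by rewrite -eqn_mod_dvd // h.
by move=> /dvdnP[k hk]; exists k; rewrite [b * k]mulnC -hk subnK.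
Qed.

(** The left numerator is the quotient [k = (a d - 1) / b]. *)
Lemma farey_upper_exists b d a : 0 < b -> b < d -> 0 < a -> a <= b -> is_inv_mod b a d ->
  exists i, [/\ fa i = a, fb i = b & fd i = d].
Proof.
move=> b0 bd a0 ab h; have d0 : 0 < d by apply: ltn_trans bd.
have [k E] := inv_mod_quotient a0 d0 h.
have kd : k <= d by rewrite leqNgt; apply/negP => h'; move: E ab; nia.
by have [i [h1 h2 h3 h4]] := farey_exists b0 d0 kd ab E; exists i.
Qed.

(** The witness is [[(b - a)/b, (d - k)/d]], the reflection of [[k/d, a/b]]. *)
Lemma farey_lower_exists b d a : 0 < b -> b < d -> 0 < a -> a <= b -> is_inv_mod b a d ->
  exists i, [/\ fd i = b, fb i = d & fd i - fc i = a].
Proof.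
move=> b0 bd a0 ab h; have d0 : 0 < d by apply: ltn_trans bd.
have [k E] := inv_mod_quotient a0 d0 h.
have kd : k <= d by rewrite leqNgt; apply/negP => h'; move: E ab; nia.
have E' : (d - k) * b = d * (b - a) + 1.
  by rewrite mulnBl mulnBr; move: E kd ab; move=> E kd ab; nia.
have [i [h1 h2 h3 h4]] := farey_exists d0 b0 (leq_subr a b) (leq_subr k d) E'.
by exists i; rewrite h4 h3 subKn.
Qed.

(** When [b = d], this number divides [a d - b c = 1], and only [[0, 1]] is left. *)
Lemma farey_diag i j : fb i = fd i -> fb j = fd j -> i = j.
Proof.
have H t : fb t = fd t -> [/\ fa t = 1, fb t = 1, fc t = 0 & fd t = 1].
  have [[b0 d0 cd a0 ab] E] := farey_facts t => h.
  have b1 : fb t = 1.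
    have : fb t %| fb t * fc t + 1 by rewrite -E -h dvdn_mull.
    by rewrite dvdn_addr ?dvdn_mulr // dvdn1 => /eqP.
  have d1 : fd t = 1 by rewrite -h.
  by rewrite b1 d1 in cd ab a0 *; split=> //; lia.
by move=> /H[h1 h2 h3 h4] /H[k1 k2 k3 k4]; apply: farey_eq; congruence.
Qed.
End FareyIntervals.

Lemma farey_polyC b d : farey_poly b d = farey_poly d b.
Proof. by rewrite /farey_poly [(b * d)%N]mulnC addnC. Qed.

(** * The Riesz mean over Farey intervals *)

Section FareyRieszMean.
Variables (R : realType) (eta : R -> R) (e0 L : R) (Lam : farey_interval -> R).
Hypothesis e0_gt0 : 0 < e0.
Hypothesis eta_ge : forall y : R, e0 <= eta y.
Hypothesis eta_lip : forall y z : R, `|eta y - eta z| <= L * `|y - z|.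
Hypothesis Lam_spec : forall i, exists2 xi : R,
  (fc i)%:R / (fd i)%:R <= xi <= (fa i)%:R / (fb i)%:R &
  Lam i = (farey_poly (fb i) (fd i))%:R * eta xi.
Notation mu := (@lebesgue_measure R).

Let L_ge0 : 0 <= L.
Proof. by have := eta_lip 0 1; rewrite sub0r normrN normr1 mulr1; apply: le_trans. Qed.

Let eta_gt0 y : 0 < eta y. Proof. exact: lt_le_trans (eta_ge y). Qed.

Lemma farey_length i : (fa i)%:R / (fb i)%:R - (fc i)%:R / (fd i)%:R = ((fb i)%:R * (fd i)%:R)^-1 :> R.
Proof.
have [[b0 d0 _ _ _] E] := farey_facts i.
have br : (fb i)%:R != 0 :> R by rewrite pnatr_eq0 -lt0n.
have dr : (fd i)%:R != 0 :> R by rewrite pnatr_eq0 -lt0n.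
have Er : (fa i)%:R * (fd i)%:R = (fb i)%:R * (fc i)%:R + 1 :> R by rewrite -!natrM E natrD.
have -> : (fa i)%:R = ((fb i)%:R * (fc i)%:R + 1) / (fd i)%:R :> R by rewrite -Er mulfK.
by field; rewrite br dr.
Qed.

(** The interval has length [1/(b d)], which cancels all of [b d (b + d)] except [b + d]. *)
Let Lam_approx i y : (fc i)%:R / (fd i)%:R <= y <= (fa i)%:R / (fb i)%:R ->
  `|Lam i - (farey_poly (fb i) (fd i))%:R * eta y| <= L * (fb i + fd i)%:R.
Proof.
move=> /andP[y1 y2]; have [xi /andP[x1 x2] ->] := Lam_spec i.
have [[b0 d0 _ _ _] _] := farey_facts i.
have br : 0 < (fb i)%:R :> R by rewrite ltr0n.
have dr : 0 < (fd i)%:R :> R by rewrite ltr0n.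
rewrite -mulrBr normrM ger0_norm //.
apply: (@le_trans _ _ ((farey_poly (fb i) (fd i))%:R * (L * ((fb i)%:R * (fd i)%:R)^-1))).
  rewrite ler_wpM2l // (le_trans (eta_lip _ _)) // ler_wpM2l // -farey_length.
  by rewrite ler_norml; apply/andP; split; lra.
rewrite /farey_poly !natrM natrD le_eqVlt; apply/orP; left; apply/eqP; field.
by rewrite !gt_eqF.
Qed.

Let Lam_ge i : (farey_poly (fb i) (fd i))%:R * e0 <= Lam i.
Proof. by have [xi _ ->] := Lam_spec i; rewrite ler_wpM2l. Qed.

(** The cost of moving [xi] to an end point; it is zero once [b d^2 e0 >= x], when both weights
    vanish. *)
Let E (x : R) b d : R := if (b * d ^ 2)%:R < x / e0 then 2 * x * L * (b + d)%:R else 0.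

Let E_ge0 x b d : 0 < x -> 0 <= E x b d.
Proof. by move=> x0; rewrite /E; case: ifP => // _; rewrite !mulr_ge0 // ltW. Qed.

(** The pair [b, d] is kept apart from [fb i, fd i] so that it can be taken in either order. *)
Let riesz_Lam x i y b d : 0 < x -> farey_poly b d = farey_poly (fb i) (fd i) ->
  (b + d = fb i + fd i)%N ->
  (fc i)%:R / (fd i)%:R <= y <= (fa i)%:R / (fb i)%:R ->
  `|riesz x (Lam i) - riesz x ((farey_poly b d)%:R * eta y)| <= E x b d.
Proof.
move=> x0 Ep Es hy; rewrite /E; case: ltP => h.
  have l0 : 0 <= Lam i by apply: le_trans (Lam_ge i); rewrite mulr_ge0 // ltW.
  have p0 : 0 <= (farey_poly b d)%:R * eta y by rewrite mulr_ge0 // ltW.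
  apply: le_trans (riesz_lip (ltW x0) l0 p0) _.
  by rewrite -[leRHS]mulrA ler_wpM2l ?mulr_ge0 ?(ltW x0) // Ep Es Lam_approx.
rewrite ler_pdivrMr // in h.
have hP : x <= (farey_poly b d)%:R * e0.
  by apply: le_trans h _; rewrite ler_wpM2r ?(ltW e0_gt0) // ler_nat farey_poly_ge.
rewrite riesz0; last by apply: le_trans (Lam_ge i); rewrite -Ep.
by rewrite riesz0 ?subrr ?normr0 // (le_trans hP) // ler_wpM2l.
Qed.

Let sum_E x N : 0 < x -> \sum_(1 <= b < N) \sum_(b.+1 <= d < N) E x b d <=
  20 / 3 * L * e0 `^ (- (8 / 5)) * x `^ (13 / 5).
Proof.
move=> x0; have X0 : 0 < x / e0 by rewrite divr_gt0.
have -> : \sum_(1 <= b < N) \sum_(b.+1 <= d < N) E x b d = 2 * x * L *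
   \sum_(1 <= b < N) \sum_(b.+1 <= d < N) (if (b * d ^ 2)%:R < x / e0 then (b + d)%:R else 0).
  rewrite mulr_sumr; apply: eq_bigr => b _; rewrite mulr_sumr; apply: eq_bigr => d _.
  by rewrite /E; case: ifP => // _; rewrite mulr0.
apply: (@le_trans _ _ (2 * x * L * (10 / 3 * (x / e0) `^ (8 / 5)))).
  by rewrite ler_wpM2l ?mulr_ge0 ?(ltW x0) // hyperbola_sum_le.
rewrite powR_divr ?(ltW x0) //.
have -> : x `^ (13 / 5) = x * x `^ (8 / 5).
  by rewrite -{2}[x]powRr1 ?(ltW x0) // -powRD ?(gt_eqF x0) ?implybT //; congr (_ `^ _); field.
by rewrite le_eqVlt; apply/orP; left; apply/eqP; field.
Qed.

Definition farey_cutoff (x : R) := farey_fset (Num.bound (x / e0)).+1.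

Lemma farey_cutoff_spec x i : Lam i < x -> i \in farey_cutoff x.
Proof.
move=> h; rewrite farey_fsetP; have [[b0 d0 _ _ _] _] := farey_facts i.
have H : (farey_poly (fb i) (fd i))%:R < x / e0 by rewrite ltr_pdivlMr // (le_lt_trans (Lam_ge i)).
have H2 : (farey_poly (fb i) (fd i) < Num.bound (x / e0))%N.
  rewrite -(ltr_nat R); apply: lt_trans H (archi_boundP _).
  by rewrite divr_ge0 ?(ltW e0_gt0) // (le_trans _ (ltW h)) // (le_trans _ (Lam_ge i)) // mulr_ge0 // ltW.
have pb : (fb i <= farey_poly (fb i) (fd i))%N.
  by rewrite /farey_poly -mulnA leq_pmulr // muln_gt0 d0 addn_gt0 b0.
have pd : (fd i <= farey_poly (fb i) (fd i))%N.
  by rewrite farey_polyC /farey_poly -mulnA leq_pmulr // muln_gt0 b0 addn_gt0 d0.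
by rewrite !ltnS (ltnW (leq_ltn_trans pb H2)) (ltnW (leq_ltn_trans pd H2)).
Qed.

Let eta_onem y := eta (1 - y).

Let upper_sum x N : 0 < x ->
  `|\sum_(i <- farey_fset N | (fb i < fd i)%N) riesz x (Lam i) - farey_sum eta N x| <=
  20 / 3 * L * e0 `^ (- (8 / 5)) * x `^ (13 / 5).
Proof.
move=> x0; apply: le_trans (sum_E N x0); rewrite /farey_sum.
apply: (@sum_labelled_approx R farey_interval (farey_fset N) (fun i => fb i < fd i)%N fb fd fa N
  (fun i => riesz x (Lam i)) (fun b d a => riesz x ((farey_poly b d)%:R * eta (a%:R / b%:R))) (E x)).
- exact: fset_uniq.
- move=> i; rewrite farey_fsetP => /andP[h1 h2] h; have [[b0 d0 cd a0 ab] _] := farey_facts i.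
  by rewrite b0 h h2 a0 ab farey_upper_range.
- move=> i j _ _ _ _ hb hd ha; apply: farey_eq => //.
  have [[b0 _ _ _ _] Ei] := farey_facts i; have [_ Ej] := farey_facts j.
  rewrite ha hd hb Ej in Ei; rewrite hb in b0; move/addIn: Ei => /eqP.
  by rewrite eqn_pmul2l // => /eqP.
- move=> b d a b0 bd dN a0 ab h; have [i [h1 h2 h3]] := farey_upper_exists b0 bd a0 ab h.
  by exists i; rewrite farey_fsetP h1 h2 h3 (ltn_trans bd dN) dN bd.
- by move=> b d; exact: E_ge0.
- move=> i _ _; apply: riesz_Lam => //; rewrite lexx andbT -subr_ge0 farey_length invr_ge0 mulr_ge0 //.
Qed.

(* Here the reflected left end point [1 - c/d = (d - c)/d] plays the role of [a/b]. *)
Let lower_sum x N : 0 < x ->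
  `|\sum_(i <- farey_fset N | (fd i < fb i)%N) riesz x (Lam i) - farey_sum eta_onem N x| <=
  20 / 3 * L * e0 `^ (- (8 / 5)) * x `^ (13 / 5).
Proof.
move=> x0; apply: le_trans (sum_E N x0); rewrite /farey_sum.
apply: (@sum_labelled_approx R farey_interval (farey_fset N) (fun i => fd i < fb i)%N fd fb (fun i => fd i - fc i)%N N
  (fun i => riesz x (Lam i)) (fun b d a => riesz x ((farey_poly b d)%:R * eta_onem (a%:R / b%:R))) (E x)).
- exact: fset_uniq.
- move=> i; rewrite farey_fsetP => /andP[h1 h2] h; have [[b0 d0 cd a0 ab] _] := farey_facts i.
  by rewrite d0 h h1 subn_gt0 cd leq_subr farey_lower_inv.
- move=> i j _ _ _ _ hd hb hc.
  have [[_ d0 ci _ _] Ei] := farey_facts i; have [[_ _ cj _ _] Ej] := farey_facts j.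
  have hc' : fc i = fc j.
    by rewrite -(subKn (ltnW ci)) -(subKn (ltnW cj)) hc hd.
  apply: farey_eq => //; rewrite hb hc' -Ej hd in Ei; rewrite hd in d0.
  by apply/eqP; rewrite -(eqn_pmul2r d0) Ei.
- move=> b d a b0 bd dN a0 ab h; have [i [h1 h2 h3]] := farey_lower_exists b0 bd a0 ab h.
  by exists i; rewrite farey_fsetP h3 h1 h2 (ltn_trans bd dN) dN bd.
- by move=> b d; exact: E_ge0.
- move=> i _ _; have [[_ d0 cd _ _] _] := farey_facts i.
  have dn : (fd i)%:R != 0 :> R by rewrite pnatr_eq0 -lt0n.
  have -> : eta_onem ((fd i - fc i)%:R / (fd i)%:R) = eta ((fc i)%:R / (fd i)%:R).
    rewrite /eta_onem; congr eta; rewrite natrB ?(ltnW cd) //; field.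
    exact: dn.
  apply: riesz_Lam => //; rewrite ?[farey_poly (fd i) _]farey_polyC ?[(fd i + _)%N]addnC //.
  by rewrite lexx /= -subr_ge0 farey_length invr_ge0 mulr_ge0.
Qed.

Let diag_sum x N : 0 < x ->
  `|\sum_(i <- farey_fset N | (fb i == fd i)%N) riesz x (Lam i)| <= x ^+ 2.
Proof.
move=> x0; have r1 i : `|riesz x (Lam i)| <= x ^+ 2.
  rewrite ger0_norm ?riesz_ge0 // riesz_le ?(ltW x0) //.
  by apply: le_trans (Lam_ge i); rewrite mulr_ge0 // ltW.
rewrite -big_filter; have : uniq [seq i <- farey_fset N | fb i == fd i] by rewrite filter_uniq // fset_uniq.
have : all (fun i => fb i == fd i) [seq i <- farey_fset N | fb i == fd i] by exact: filter_all.
case: [seq i <- farey_fset N | fb i == fd i] => [|i [|j s]] /=.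
- by rewrite big_nil normr0 sqr_ge0.
- by rewrite big_seq1.
- by case/and3P => /eqP hi /eqP hj _; rewrite inE (farey_diag hi hj) eqxx.
Qed.

Lemma onem_integral : \int[mu]_(y in `[0, 1]) (eta_onem y `^ (- (2 / 3))) = \int[mu]_(y in `[0, 1]) (eta y `^ (- (2 / 3))).
Proof.
have h01 : ((0 : R) <= 1) && ((1 : R) <= 1) by rewrite ler01 lexx.
have cG : {within `[0, 1], continuous (fun y => eta y `^ (- (2 / 3)))}.
  apply: continuous_subspaceT; exact: (powR_comp_continuous e0_gt0 eta_ge eta_lip).
by rewrite (Rintegration_by_substitution_onem h01 cG) /unstable.onem subrr.
Qed.

(** The two orders of the denominators contribute equally, as reflection preserves the integral;
    this is the factor 2. The interval [[0, 1]], with [b = d], accounts for [x^2]. *)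
Lemma farey_riesz_asymp : exists2 K, 0 <= K & forall x, 0 < x ->
  `|\sum_(i <- farey_cutoff x) riesz x (Lam i) -
    2 * kappa R * (\int[mu]_(y in `[0, 1]) (eta y `^ (- (2 / 3)))) * x `^ (8 / 3)|
  <= K * x `^ (13 / 5) + x ^+ 2.
Proof.
have [K1 K10 H1] := farey_sum_asymp e0_gt0 eta_ge eta_lip.
have eta_lip2 y z : `|eta_onem y - eta_onem z| <= L * `|y - z|.
  apply: le_trans (eta_lip _ _) _; rewrite (_ : 1 - y - (1 - z) = z - y); last by ring.
  by rewrite distrC.
have [K2 K20 H2] := farey_sum_asymp e0_gt0 (fun y => eta_ge (1 - y)) eta_lip2.
pose K3 := 20 / 3 * L * e0 `^ (- (8 / 5)).
have K30 : 0 <= K3 by rewrite !mulr_ge0 ?powR_ge0.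
exists (K1 + K2 + K3 + K3); first by rewrite !addr_ge0.
move=> x x0; rewrite /farey_cutoff; set N := (Num.bound _).+1.
have xN : x <= N%:R ^+ 2 * e0.
  rewrite -ler_pdivrMr //; have h : x / e0 <= N%:R.
    apply: le_trans (ltW (archi_boundP _)) _; first by rewrite divr_ge0 // ltW.
    by rewrite ler_nat.
  by apply: le_trans h _; rewrite expr2 ler_peMr // ler1n.
have a1 := H1 N x x0 xN; have a2 := H2 N x x0 xN.
rewrite -/eta_onem onem_integral in a2.
have b1 := upper_sum N x0; have b2 := lower_sum N x0; have b3 := diag_sum N x0.
rewrite (bigID (fun i => fb i < fd i)%N) /= [X in _ + X - _](bigID (fun i => fd i < fb i)%N) /=.
have e2 : \sum_(i <- farey_fset N | ~~ (fb i < fd i)%N && (fd i < fb i)%N) riesz x (Lam i) =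
    \sum_(i <- farey_fset N | (fd i < fb i)%N) riesz x (Lam i).
  by apply: eq_bigl => i; case: (ltngtP (fb i) (fd i)).
have e3 : \sum_(i <- farey_fset N | ~~ (fb i < fd i)%N && ~~ (fd i < fb i)%N) riesz x (Lam i) =
    \sum_(i <- farey_fset N | (fb i == fd i)%N) riesz x (Lam i).
  by apply: eq_bigl => i; case: (ltngtP (fb i) (fd i)).
rewrite e2 e3.
rewrite -/K3 in b1 b2.
move: a1 a2 b1 b2 b3.
move: (\sum_(i <- _ | (fb i < fd i)%N) _) (\sum_(i <- _ | (fd i < fb i)%N) _) (\sum_(i <- _ | fb i == fd i) _) => s1 s2 s3.
move: (farey_sum _ _ _) (farey_sum _ _ _) (\int[mu]_(y in _) _) => f1 f2 J.
rewrite !ler_norml; set y := x `^ (13 / 5); set w := x `^ (8 / 3); set v := x ^+ 2.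
move=> /andP[? ?] /andP[? ?] /andP[? ?] /andP[? ?] /andP[? ?].
have -> : 2 * kappa R * J * w = kappa R * J * w + kappa R * J * w by ring.
rewrite !mulrDl; apply/andP; split; lra.
Qed.
End FareyRieszMean.

Lemma Gamma_third (R : realType) : Gamma (1 / 3) = gamma3 R.
Proof.
by rewrite /Gamma /gamma3 /gamma_int /Rintegral div1r.
Qed.

Lemma powR_expR (R : realType) (u p : R) : expR u `^ p = expR (p * u).
Proof. by rewrite /powR gt_eqF ?expR_gt0 // expRK. Qed.

(** The rational factors cancel: [40/27] times [2 (9/80)] is [1/3], and [6/2 = 3] comes from [ζ(2)]
    and [B(1/3, 1/3)]. *)
Lemma kappa_residue (R : realType) : 40 / 27 * (2 * kappa R) = Num.sqrt 3 * gamma3 R ^+ 3 / pi ^+ 3.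
Proof.
rewrite /kappa /betathird; have := pi_gt0 R; move: (pi : R) (gamma3 R) (Num.sqrt 3) => p g s p0.
by field; rewrite gt_eqF.
Qed.

(** * Taylor's formula on a Farey interval *)

Section FareyTaylor.
Variables (R : realType) (f : R -> R) (m : R).
Hypothesis hf : class_C 3 `[0, 1] f.
Hypothesis m_gt0 : 0 < m.
Hypothesis hm : forall x : R, 0 <= x <= 1 -> m <= `|derive_in_n `[0, 1] 2 f x|.
Notation mu := (@lebesgue_measure R).

Let f2 := derive_in_n `[0, 1] 2 f.

(** This is [2/|f''|], extended from [[0, 1]] to the line. *)
Definition farey_weight (y : R) : R := (`|f2 (clamp y)| / 2)^-1.

Let derivable_k k x : (k < 3)%N -> `[0, 1]%classic x -> derivable_in `[0, 1] (derive_in_n `[0, 1] k f) x.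
Proof. by case: hf => h _; exact: h. Qed.

Lemma farey_weight_bounds : exists e L, [/\ 0 < e, forall y, e <= farey_weight y &
  forall y z, `|farey_weight y - farey_weight z| <= L * `|y - z|].
Proof.
have [L L0 HL] : exists2 L, 0 <= L & forall y z, 0 <= y <= 1 -> 0 <= z <= 1 -> `|f2 y - f2 z| <= L * `|y - z|.
  apply: lipschitz_of_derivable_in; first by move=> x hx; apply: derivable_k.
  by case: hf.
pose B := (`|f2 0| + L) / 2.
have z01 : ((0 : R) <= 0) && ((0 : R) <= 1) by rewrite lexx ler01.
have f20 : 0 < `|f2 0| by apply: lt_le_trans (hm z01).
have B0 : 0 < B by rewrite divr_gt0 // ltr_pwDl.
have hB y : 0 <= y <= 1 -> `|f2 y| / 2 <= B.
  move=> hy; rewrite /B ler_pM2r ?invr_gt0 //.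
  have := HL y 0 hy z01; rewrite subr0 => h.
  have -> : f2 y = f2 0 + (f2 y - f2 0) by ring.
  apply: le_trans (ler_normD _ _) _; rewrite lerD2l; apply: le_trans h _; rewrite ler_piMr //.
  by case/andP: hy => h1 h2; rewrite ger0_norm.
have h0 y : 0 < `|f2 (clamp y)| / 2 by rewrite divr_gt0 // (lt_le_trans m_gt0) // hm // clamp_in.
exists B^-1, (L / 2 / (m / 2) ^+ 2); split.
- by rewrite invr_gt0.
- by move=> y; rewrite /farey_weight lef_pV2 ?posrE // hB // clamp_in.
- apply: (@inv_clamp_lipschitz R (fun y => `|f2 y| / 2)); rewrite ?divr_gt0 ?divr_ge0 //.
    by move=> y hy; rewrite ler_pM2r ?invr_gt0 // hm.
  move=> y z hy hz; rewrite -mulrBl normrM [ `|2^-1|]ger0_norm ?invr_ge0 // mulrAC ler_pM2r ?invr_gt0 //.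
  by apply: le_trans (ler_dist_dist _ _) (HL y z hy hz).
Qed.

(** The mediant is at distance [1/(d (b + d))] from [c/d] and [1/(b (b + d))] from [a/b], so the
    weights [b/(b + d)] and [d/(b + d)] are those of linear interpolation and [second_difference]
    applies. *)
Lemma farey_T_inv i : exists2 xi : R,
  (fc i)%:R / (fd i)%:R <= xi <= (fa i)%:R / (fb i)%:R &
  `|farey_T f i|^-1 = (farey_poly (fb i) (fd i))%:R * farey_weight xi.
Proof using hf.
have [[b0 d0 cd a0 ab] E] := farey_facts i; have len := farey_length R i.
have Er : (fa i)%:R * (fd i)%:R = (fb i)%:R * (fc i)%:R + 1 :> R by rewrite -!natrM E natrD.
have TE : farey_T f i = (fb i + fd i)%:R * (f ((fa i + fc i)%:R / (fb i + fd i)%:R)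
  - (fb i)%:R / (fb i + fd i)%:R * f ((fa i)%:R / (fb i)%:R)
  - (fd i)%:R / (fb i + fd i)%:R * f ((fc i)%:R / (fd i)%:R)).
  by rewrite /farey_T /farey_c /fa /fb /fc /fd; case: i {b0 d0 cd a0 ab E Er len} => [[[c d] [a b]] h].
have x00 : 0 <= (fc i)%:R / (fd i)%:R :> R by rewrite divr_ge0.
have x11 : (fa i)%:R / (fb i)%:R <= 1 :> R by rewrite ler_pdivrMr ?ltr0n // mul1r ler_nat.
move: len Er TE x00 x11; rewrite /farey_poly !natrM !natrD.
have br : 0 < (fb i)%:R :> R by rewrite ltr0n.
have dr : 0 < (fd i)%:R :> R by rewrite ltr0n.
move: (fa i)%:R (fb i)%:R (fc i)%:R (fd i)%:R br dr => a b c d b0' d0' len Er TE x00 x11.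
have bn : b != 0 by rewrite gt_eqF.
have dn : d != 0 by rewrite gt_eqF.
have sn : b + d != 0 by rewrite gt_eqF // addr_gt0.
have aE : a = (b * c + 1) / d by rewrite -Er mulfK.
have e0 : (a + c) / (b + d) - c / d = (d * (b + d))^-1 by rewrite aE; field; rewrite ?sn ?dn.
have e1 : a / b - (a + c) / (b + d) = (b * (b + d))^-1 by rewrite aE; field; rewrite ?sn ?dn ?bn.
have l0 : c / d < (a + c) / (b + d) by rewrite -subr_gt0 e0 invr_gt0 mulr_gt0 ?addr_gt0.
have l1 : (a + c) / (b + d) < a / b by rewrite -subr_gt0 e1 invr_gt0 mulr_gt0 ?addr_gt0.
have inside (x : R) : c / d < x < a / b -> 0 < x < 1.
  by move=> /andP[h1 h2]; rewrite (le_lt_trans x00 h1) (lt_le_trans h2 x11).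
have int k (x : R) : (k < 2)%N -> c / d < x < a / b ->
    is_derive x 1 (derive_in_n `[0, 1] k f) (derive_in_n `[0, 1] k.+1 f x).
  move=> k2 /inside hx; apply: is_derive_in_interior => //; apply: derivable_k; first exact: ltn_trans k2 _.
  by case/andP: hx => h1 h2; rewrite /= in_itv /= !ltW.
have cf : {within `[c / d, a / b], continuous f}.
  have cf01 : {within `[0, 1], continuous f}.
    by apply: continuous_of_derivable_in => x hx; exact: (@derivable_k 0).
  apply: continuous_subspaceW cf01 => x /=; rewrite !in_itv /= => /andP[h1 h2].
  by rewrite (le_trans x00 h1) (le_trans h2 x11).
have [xi hxi T2] := second_difference l0 l1 cf (fun x hx => int 0%N x isT hx) (fun x hx => int 1%N x isT hx).
exists xi; first by case/andP: hxi => h1 h2; rewrite !ltW.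
have xi01 : 0 <= xi <= 1 by case/andP: (inside _ hxi) => h1 h2; rewrite !ltW.
rewrite -[derive_in_n _ 2 f]/f2 in T2.
have e01 : a / b - c / d = (b * d)^-1 by [].
have e1' : (a + c) / (b + d) - a / b = - (b * (b + d))^-1 by rewrite -e1 opprB.
rewrite e0 e1 e01 e1' in T2.
have r1 : (b * (b + d))^-1 / (b * d)^-1 = d / (b + d) by field; rewrite bn sn dn.
have r0 : (d * (b + d))^-1 / (b * d)^-1 = b / (b + d) by field; rewrite bn sn dn.
rewrite r1 r0 in T2.
have -> : farey_T f i = - (f2 xi / 2 / (b * d * (b + d))).
  rewrite TE addrAC T2; field; by rewrite bn sn dn.
have P0 : 0 < b * d * (b + d) by rewrite !mulr_gt0 ?addr_gt0.
rewrite normrN (_ : `|f2 xi / 2 / (b * d * (b + d))| = `|f2 xi| / 2 / (b * d * (b + d))); last first.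
  by rewrite normrM normfV (gtr0_norm P0) normrM normfV (@gtr0_norm _ 2).
by rewrite invfM invrK mulrC /farey_weight clamp_id.
Qed.

(** The power [2^(2/3)] of the residue arises from [|f''| = 2 / eta]; positivity comes from the
    lower bound [m]. *)
Lemma farey_weight_integral :
  0 < \int[mu]_(y in `[0, 1]) (farey_weight y `^ (- (2 / 3))) /\
  \int[mu]_(v in `[0, 1]) (`|f2 v| `^ (2 / 3)) =
    2 `^ (2 / 3) * \int[mu]_(y in `[0, 1]) (farey_weight y `^ (- (2 / 3))).
Proof.
have [e [L [e0 ge lip]]] := farey_weight_bounds.
have mI : measurable (`[0, 1]%classic : set (measurableTypeR R)) by exact: measurable_itv.
have ig : mu.-integrable `[0, 1] (EFin \o (fun y => farey_weight y `^ (- (2 / 3)))).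
  by apply: continuous_itv_integrable; exact: (powR_comp_continuous e0 ge lip).
have wE y : 0 <= y <= 1 -> farey_weight y `^ (- (2 / 3)) = (`|f2 y| / 2) `^ (2 / 3).
  move=> hy; rewrite /farey_weight clamp_id //.
  have h : 0 < `|f2 y| / 2 by rewrite divr_gt0 // (lt_le_trans m_gt0) // hm.
  by rewrite -[_^-1]powR_inv1 ?(ltW h) // -powRrM mulrNN mul1r.
split.
  have ic : mu.-integrable `[0, 1] (EFin \o (fun=> (m / 2) `^ (2 / 3))).
    by apply: continuous_itv_integrable => y; exact: cst_continuous.
  apply: (@lt_le_trans _ _ (\int[mu]_(y in `[0, 1]) ((m / 2) `^ (2 / 3)))).
    by rewrite Rintegral_cst // /= lebesgue_measure_itv /= lte01 oppr0 adde0 mulr1 powR_gt0 // divr_gt0.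
  apply: le_Rintegral => // y; rewrite /= in_itv /= => hy; rewrite wE //.
  apply: ge0_ler_powR; rewrite ?nnegrE ?divr_ge0 ?(ltW m_gt0) //.
  by rewrite ler_pM2r ?invr_gt0 // hm.
rewrite -RintegralZl //; apply: eq_Rintegral => y; rewrite mem_setE in_itv /= => hy.
by rewrite wE // -powRM ?divr_ge0 //; congr (_ `^ _); rewrite mulrC divfK.
Qed.
End FareyTaylor.

Theorem theorem9 (R : realType) (f : R -> R) (m : R)
  (hf : class_C 3 `[0, 1] f)
  (m_gt0 : 0 < m)
  (hm : forall x : R, 0 <= x <= 1 -> m <= `|derive_in_n `[0, 1] 2 f x|) :
  exists F : R[i]^o -> R[i]^o,
    (exists sigma0 : R, forall s : R[i], sigma0 < complex.Re s ->
       farey_zeta_cvg f s /\ F s = farey_zeta f s) /\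
    holomorphic_on [set s | 3 / 5 < complex.Re s /\ s <> (2 / 3)%:C] F /\
    simple_pole_with_residue F (2 / 3)%:C
      (Num.sqrt 3 * Gamma (1 / 3) ^+ 3 / (2 `^ (2 / 3) * pi ^+ 3)
        * \int[@lebesgue_measure R]_(v in `[0, 1])
            (`|derive_in_n `[0, 1] 2 f v| `^ (2 / 3)))%:C.
Proof.
have [e [L [e0 ge lip]]] := farey_weight_bounds hf m_gt0 hm.
have spec := farey_T_inv hf.
have [Iw_gt0 IwE] := farey_weight_integral hf m_gt0 hm.
pose eta := farey_weight f; pose Lam i := `|farey_T f i|^-1.
pose Iw := \int[@lebesgue_measure R]_(y in `[0, 1]) (eta y `^ (- (2 / 3))).
pose C := 2 * kappa R * Iw.
have C_gt0 : 0 < C by apply: mulr_gt0; [apply: mulr_gt0 => //; exact: kappa_gt0|exact: Iw_gt0].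
have [K K0 HK] := farey_riesz_asymp e0 ge lip spec.
(* All [Lam i] are at least [e], since [b d (b + d) >= 1]; the minimum with [0] lets the main term
   start at [u = 0]. *)
pose u0 := Num.min 0 (ln e).
have u0_le0 : u0 <= 0 by rewrite ge_min lexx.
have Lam_ge i : expR u0 <= Lam i.
  apply: (@le_trans _ _ e).
    by rewrite -[leRHS]lnK ?posrE // ler_expR ge_min lexx orbT.
  have [xi _ h] := spec i; rewrite /Lam h; have [[b0 d0 _ _ _] _] := farey_facts i.
  rewrite -[leLHS]mul1r; apply: ler_pM => //; first exact: ltW.
  by rewrite ler1n /farey_poly !muln_gt0 b0 d0 addn_gt0 b0.
have J_spec : forall x i, Lam i < x -> i \in farey_cutoff e x := farey_cutoff_spec e0 ge spec.
have A_asymp u : u0 <= u ->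
    `|\sum_(i <- farey_cutoff e (expR u)) riesz (expR u) (Lam i) - C * expR (8 / 3 * u)|
      <= (K + expR (- (3 / 5 * u0))) * expR (13 / 5 * u).
  move=> hu; have := HK (expR u) (expR_gt0 u); rewrite !powR_expR => h.
  (* The extra [x^2] is absorbed: for [u >= u0], [2 u <= 13/5 u - 3/5 u0]. *)
  apply: le_trans h _; rewrite [leRHS]mulrDl lerD2l -expRM_natl -expRD ler_expR.
  by clear -hu; lra.
exists (continuation u0 Lam (farey_cutoff e) C); split; last split.
- exists 1 => s hs.
  have cv := continuation_cvg u0_le0 Lam_ge J_spec C_gt0 A_asymp hs.
  have tE : (fun i => cpow (Lam i)^-1 s : R[i]^o) = farey_term f s.
    by apply/funext => i; rewrite /Lam invrK.
  rewrite tE in cv; have FF : ProperFilter (@summability.totally farey_interval) by exact: summability.totally_filter.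
  split; first by apply/cvg_ex; exists (continuation u0 Lam (farey_cutoff e) C s).
  by rewrite /farey_zeta /summability.sum; apply/esym; apply: cvg_lim.
- exact: (continuation_holomorphic J_spec C_gt0 A_asymp).
- have -> : Num.sqrt 3 * Gamma (1 / 3) ^+ 3 / (2 `^ (2 / 3) * pi ^+ 3)
        * \int[@lebesgue_measure R]_(v in `[0, 1]) (`|derive_in_n `[0, 1] 2 f v| `^ (2 / 3)) = 40 / 27 * C.
    rewrite IwE -/Iw Gamma_third /C mulrA kappa_residue.
    have q0 : 2 `^ (2 / 3) != 0 :> R by rewrite gt_eqF // powR_gt0.
    have p0 : pi != 0 :> R by rewrite gt_eqF // pi_gt0.
    move: (2 `^ (2 / 3)) (pi : R) (gamma3 R) (Num.sqrt 3) q0 p0 => q p g s q0 p0.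
    by field; rewrite q0 p0.
  exact: (continuation_pole J_spec C_gt0 A_asymp).
Qed.
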